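(* Let $G$ be a fully dynamic graph with maximum degree at most $\Delta$ that is properly edge colored with $\Delta+C$ colors, where $C\in[1,\Delta-2]$. Let $b$ be an integer with $2\le b\le C$ satisfying $$\frac{b(C-1)+2}{\Delta}>\Delta-C+1.$$ Then there is a deterministic shift-based algorithm which, upon insertion of a new edge $e$ into $G$, extends the proper $(\Delta+C)$-edge coloring to $e$ while recoloring $O(\log_\beta n)$ edges, where $\beta=\frac{C+1}{b}$, in $O(m+\Delta^2)$ time ($m$ the current number of edges).
   Context: $n$ is the (fixed) number of vertices; the graph is simple. A proper edge coloring gives distinct colors to edges sharing an endpoint. A shift-based algorithm extends the coloring by taking a chain of edges $[e_1=e,e_2,\dots,e_k]$ (consecutive edges sharing exactly one endpoint), giving each $e_i$ the color of $e_{i+1}$ such that every intermediate partial coloring is proper, and then giving $e_k$ a color unused by its adjacent edges. Recoloring counts previously colored edges whose color changes. *)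

(* Defs.v *)
From HB Require Import structures.
From mathcomp Require Import all_boot all_order all_algebra.
From mathcomp Require Import reals exp.

Set Implicit Arguments.
Unset Strict Implicit.
Unset Printing Implicit Defensive.

(** * Graphs and partial edge colorings

    A simple graph on the vertex set 'I_n is given by its set of edges, an
    edge being a two-element set of vertices. *)

Definition edge (n : nat) := {set 'I_n}.

Definition simple_graph n (G : {set edge n}) : Prop :=
  forall f, f \in G -> #|f| = 2.

Definition degree n (G : {set edge n}) (v : 'I_n) : nat :=
  #|[set f in G | v \in f]|.

Definition max_degree n (G : {set edge n}) : nat := \max_(v : 'I_n) degree G v.

(** [f] and [g] share an endpoint. *)
Definition adjacent n (f g : edge n) : bool := (f != g) && (f :&: g != set0).

(** [None] means uncolored; pairs that are not edges of the graph are also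
    mapped to [None]. *)
Definition coloring (n k : nat) := {ffun edge n -> option 'I_k}.

Definition colored n k (c : coloring n k) : {set edge n} :=
  [set f | c f != None].

Definition proper n k (c : coloring n k) : Prop :=
  forall f g a, adjacent f g -> c f = Some a -> c g <> Some a.

Definition proper_edge_coloring n k (G : {set edge n}) (c : coloring n k) :
  Prop := colored c = G /\ proper c.

(** * Shift chains *)

Definition assign n k (c : coloring n k) (f : edge n) (a : 'I_k) :
    coloring n k :=
  [ffun h => if h == f then Some a else c h].

(** [f] takes over the color of [g], which becomes uncolored. *)
Definition move n k (c : coloring n k) (f g : edge n) : coloring n k :=
  [ffun h => if h == f then c g else if h == g then None else c h].

(** [shift c e s c']: in the partial coloring [c] the edge [e] is uncolored,
    [s] is a chain starting with [e], and [c'] is obtained by moving the colors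
    one edge down the chain, all the partial colorings on the way being proper,
    and then coloring the last edge with a color that no adjacent edge has. *)
Inductive shift n k :
    coloring n k -> edge n -> seq (edge n) -> coloring n k -> Prop :=
| shift_last (c : coloring n k) (e : edge n) (a : 'I_k) :
    c e = None ->
    (forall f, adjacent e f -> c f <> Some a) ->
    shift c e [:: e] (assign c e a)
| shift_next (c : coloring n k) (e f : edge n) (s : seq (edge n))
    (c' : coloring n k) :
    c e = None ->
    c f <> None ->
    #|e :&: f| = 1 ->
    proper (move c e f) ->
    shift (move c e f) f s c' ->
    shift c e (e :: s) c'.

(** The edges of the chain are pairwise distinct, so that the effect of [shift]
    is to give each edge of the chain the color that its successor has in the
    original coloring [c]. *)
Definition shift_extension n k (c : coloring n k) (e : edge n)
    (s : seq (edge n)) (c' : coloring n k) : Prop :=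
  uniq s /\ shift c e s c'.

(** The previously colored edges whose color changes; the newly inserted edge
    is not counted. *)
Definition recolored n k (c c' : coloring n k) : {set edge n} :=
  [set f in colored c | c' f != c f].

(** * Deterministic algorithms and their running time

    Random access machine running structured programs, with unit cost per
    instruction and per test.  It has registers and two-dimensional arrays
    (indexed, like the registers, by constants occurring in the program), all
    holding natural numbers.  The only arithmetic is successor and predecessor:
    after [t] steps all values are at most the largest initial value or program
    constant plus [t].  Hence each step is a constant number of word RAM
    operations on words of logarithmic size, and the unit cost measure cannot
    be abused to compute with large numbers. *)

Definition reg := nat.
Definition array := nat.

Record state := State {
  regs : reg -> nat;
  arrs : array -> nat -> nat -> nat }.

Definition set_reg (s : state) (x : reg) (m : nat) : state :=
  State (fun y => if y == x then m else regs s y) (arrs s).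

Definition set_cell (s : state) (A : array) (i j m : nat) : state :=
  State (regs s)
    (fun B i' j' => if [&& B == A, i' == i & j' == j] then m else arrs s B i' j').

Inductive test :=
| Teq (x y : reg)
| Tlt (x y : reg).

Definition holds (s : state) (b : test) : bool :=
  match b with
  | Teq x y => regs s x == regs s y
  | Tlt x y => regs s x < regs s y
  end.

Inductive program :=
| Const (x : reg) (m : nat)                   (* x := m       *)
| Copy (x y : reg)                            (* x := y       *)
| Succ (x y : reg)                            (* x := y + 1   *)
| Pred (x y : reg)                            (* x := y - 1   *)
| Read (x : reg) (A : array) (y z : reg)      (* x := A[y, z] *)
| Write (A : array) (y z x : reg)             (* A[y, z] := x *)
| Seq (p q : program)
| If (b : test) (p q : program)
| While (b : test) (p : program).

(** [exec p s t s']: started in state [s], the program [p] halts in state [s']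
    after [t] steps. *)
Inductive exec : program -> state -> nat -> state -> Prop :=
| exec_const x m s : exec (Const x m) s 1 (set_reg s x m)
| exec_copy x y s : exec (Copy x y) s 1 (set_reg s x (regs s y))
| exec_succ x y s : exec (Succ x y) s 1 (set_reg s x (regs s y).+1)
| exec_pred x y s : exec (Pred x y) s 1 (set_reg s x (regs s y).-1)
| exec_read x A y z s :
    exec (Read x A y z) s 1 (set_reg s x (arrs s A (regs s y) (regs s z)))
| exec_write A y z x s :
    exec (Write A y z x) s 1 (set_cell s A (regs s y) (regs s z) (regs s x))
| exec_seq p q s t1 s1 t2 s2 :
    exec p s t1 s1 -> exec q s1 t2 s2 -> exec (Seq p q) s (t1 + t2) s2
| exec_if_true b p q s t s' :
    holds s b -> exec p s t s' -> exec (If b p q) s t.+1 s'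
| exec_if_false b p q s t s' :
    ~~ holds s b -> exec q s t s' -> exec (If b p q) s t.+1 s'
| exec_while_false b p s :
    ~~ holds s b -> exec (While b p) s 1 s
| exec_while_true b p s t1 s1 t2 s2 :
    holds s b -> exec p s t1 s1 -> exec (While b p) s1 t2 s2 ->
    exec (While b p) s (t1 + t2).+1 s2.

Lemma exec_deterministic p s t1 s1 t2 s2 :
  exec p s t1 s1 -> exec p s t2 s2 -> t1 = t2 /\ s1 = s2.
Proof.
move=> H; elim: H t2 s2 => {p s t1 s1}
  [x m s|x y s|x y s|x y s|x A y z s|A y z x s
  |p q s t1 s1 t2 s2 _ IH1 _ IH2|b p q s t s' hb _ IH|b p q s t s' hb _ IH
  |b p s hb|b p s t1 s1 t2 s2 hb _ IH1 _ IH2] t' s'' H.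
1-6: by inversion H.
- inversion H as [| | | | | |? ? ? ? ? ? ? e1 e2| | | |]; subst.
  by have [? ?] := IH1 _ _ e1; subst; have [-> ->] := IH2 _ _ e2.
- inversion H as [| | | | | | |? ? ? ? ? ? h e1|? ? ? ? ? ? h e1| |]; subst.
    by have [-> ->] := IH _ _ e1.
  by rewrite hb in h.
- inversion H as [| | | | | | |? ? ? ? ? ? h e1|? ? ? ? ? ? h e1| |]; subst.
    by rewrite h in hb.
  by have [-> ->] := IH _ _ e1.
- inversion H as [| | | | | | | | |? ? ? h|? ? ? ? ? ? ? h e1 e2]; subst=> //.
  by rewrite h in hb.
- inversion H as [| | | | | | | | |? ? ? h|? ? ? ? ? ? ? h e1 e2]; subst.
    by rewrite hb in h.
  by have [? ?] := IH1 _ _ e1; subst; have [-> ->] := IH2 _ _ e2.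
Qed.

(** * Storing an edge-colored graph

    The graph and its coloring are kept in array 0: the entry at vertex [v] and
    color [a] is [w + 1] if the edge [vw] has color [a], and 0 if no edge at
    [v] has color [a] (or if [v] is not a vertex or [a] not a color). *)
Definition incidence_table n k (c : coloring n k) (i j : nat) : nat :=
  match insub i : option 'I_n, insub j : option 'I_k with
  | Some v, Some a =>
      if [pick w | c [set v; w] == Some a] is Some w then (nat_of_ord w).+1
      else 0
  | _, _ => 0
  end.

(** All the other arrays are zero: nothing else is stored between updates, and
    the time to clean up the working memory counts as part of an update. *)
Definition stores n k (s : state) (c : coloring n k) : Prop :=
  forall A i j, arrs s A i j = if A == 0 then incidence_table c i j else 0.

(** Input of the insertion of the edge [uv]; the initial contents of the other
    registers are unspecified. *)
Definition insertion_input n (s : state) (Delta C b : nat) (u v : 'I_n) : Prop :=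
  [/\ regs s 0 = n, regs s 1 = Delta, regs s 2 = C & regs s 3 = b] /\
  regs s 4 = u /\ regs s 5 = v.

(* Main.v *)
Require Import Defs.
From mathcomp Require Import all_boot all_order all_algebra.
From mathcomp Require Import reals exp.
From mathcomp Require Import zify lra.

Set Implicit Arguments.
Unset Strict Implicit.
Unset Printing Implicit Defensive.

(** Write [k = Delta + C] and let [e = uv].  Grow a breadth-first tree of paths
    from [v] (regarded as a child of [u]): if [p] is the parent of [w], a path to
    [w] is shifted until the edge [pw] is uncolored, and [pw] may then be replaced
    by an edge [wz] of a color [f] available at [p], that is, missing at [p] or
    the color of the edge from [p] to its parent.  Each such pair ([w], [f]) is a
    reach of [z].  If [f] is also available at [w], shifting along the path to
    [w] and giving [pw] the color [f] extends the coloring.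

    Every vertex has more than [C] available colors.  As long as no vertex is
    reached more than [b] times, [C + 1] times the number of expanded vertices is
    at most [b] times the number of visited vertices, so that the levels of the
    tree grow by the factor [(C + 1) / b] and the depth is logarithmic.

    If [z] is reached [b + 1] times, one of the reaches [w_j] can be completed by
    at most two more edges: shift along the path to [w_j], move the color of
    [w_j z] to the edge before it, and color [w_j z] with a color [alpha] missing
    at [w_j], or, if [z] has an [alpha]-edge [za], move its color to [w_j z] and
    give [za] a color missing at [z] and [a].  Candidates for the latter are the
    old color of [w_j z] and three colors missing at [z] and [a] in the original
    coloring, as a shift affects at most two of them.  If all this fails, counting
    the available colors of the [w_j] by the edges at [z] contradicts the
    hypothesis on [b].

    For the running time, an expanded vertex has at least [C + 1 >= Delta / 2]
    colored edges, hence [hd * Delta = O(m)] for the number [hd] of expanded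
    vertices. *)

(** * Partial colorings *)

(** Each reach of [z] is tested in its own shifted coloring, and this is what complicates the
    counting. A reach [j] that fails on the edge [za] shows that [y j], which [z] has just lost, is
    present at [a]: either it was there originally, or the shift brought it. Since a shift brings at
    most one color to each vertex and all paths belong to one tree, two paths that meet bring the
    same colors from shortly beyond the meeting point on; so the second case occurs at most once per
    color at [z] and twice per further reach. The other loss is two colors for each reach whose path
    passes through [z]. An endpoint of the new edge has [C + 1] missing colors; any other [z] may
    have only [C], but then its parent is itself a reach, whose path avoids [z], and one unit is
    recovered for each color available there. The hypothesis on [b] closes both counts. In the
    growth argument [u] can be reached without ever being expanded, so the size of a level is only
    at least [(C + 1) / b] times the previous one minus 1, and growth is measured from the fixed
    point of this recurrence. *)

Lemma set2_inj (T : finType) (x y z : T) : [set x; y] = [set x; z] -> y = z.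
Proof.
move=> E.
have: y \in [set x; z] by rewrite -E set22.
have: z \in [set x; y] by rewrite E set22.
rewrite !inE => /orP[/eqP->|/eqP-> //] /orP[/eqP-> //|/eqP-> //].
Qed.

Lemma set2_eq (T : finType) (x y z t : T) : [set x; y] = [set z; t] ->
  (x = z /\ y = t) \/ (x = t /\ y = z).
Proof.
move=> E.
have: x \in [set z; t] by rewrite -E set21.
rewrite !inE => /orP[] /eqP Ex; subst x.
  by left; split=> //; exact: set2_inj E.
by right; split=> //; move: E; rewrite [RHS]setUC => /set2_inj.
Qed.

Section Colorings.
Variables n k : nat.
Implicit Types (c : coloring n k) (x y z w t : 'I_n) (a f : 'I_k).

Definition wf_coloring c : Prop :=
  Defs.proper c /\ (forall e, c e != None -> #|e| = 2).

Definition nbr c x a : option 'I_n := [pick w | c [set x; w] == Some a].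

Definition missing c x a : bool := nbr c x a == None.

Definition ocode (m : nat) (o : option 'I_m) : nat :=
  if o is Some w then w.+1 else 0.

Lemma incidence_tableE c x a : incidence_table c x a = ocode (nbr c x a).
Proof. by rewrite /incidence_table !valK /nbr; case: pickP. Qed.

Lemma incidence_table_out1 c i j : n <= i -> incidence_table c i j = 0.
Proof. by move=> ni; rewrite /incidence_table insubF // ltnNge ni. Qed.

Lemma incidence_table_out2 c i j : k <= j -> incidence_table c i j = 0.
Proof.
by move=> ki; rewrite /incidence_table [insub j]insubF ?ltnNge ?ki //; case: insub.
Qed.

Lemma wf_loop c x : wf_coloring c -> c [set x; x] = None.
Proof.
case=> _ h; apply/eqP/negPn/negP => /h.
by rewrite setUid cards1.
Qed.

Lemma wf_neq c x y a : wf_coloring c -> c [set x; y] = Some a -> x != y.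
Proof. by move=> h; apply: contra_eq_neq => ->; rewrite wf_loop. Qed.

Lemma colorC c x y : c [set x; y] = c [set y; x].
Proof. by rewrite setUC. Qed.

Lemma wf_inj c x y z a : wf_coloring c ->
  c [set x; y] = Some a -> c [set x; z] = Some a -> y = z.
Proof.
case=> h _ Ey Ez; apply/eqP/negPn/negP => nyz.
apply: (h [set x; y] [set x; z] a) => //.
rewrite /adjacent; apply/andP; split.
  by apply: contra nyz => /eqP /set2_inj ->.
by apply/set0Pn; exists x; rewrite !inE eqxx.
Qed.

Lemma nbrP c x a y : wf_coloring c ->
  reflect (nbr c x a = Some y) (c [set x; y] == Some a).
Proof.
move=> h; apply: (iffP eqP) => [E|].
  rewrite /nbr; case: pickP => [w /eqP Ew|/(_ y)]; last by rewrite E eqxx.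
  by rewrite (wf_inj h E Ew).
by rewrite /nbr; case: pickP => // w /eqP Ew [<-].
Qed.

Lemma nbr_some c x a y : nbr c x a = Some y -> c [set x; y] = Some a.
Proof. by rewrite /nbr; case: pickP => // w /eqP Ew [<-]. Qed.

Lemma some_nbr c x a y : wf_coloring c ->
  c [set x; y] = Some a -> nbr c x a = Some y.
Proof. by move=> h /eqP; exact: (nbrP x a y h). Qed.

Lemma missingP c x a : reflect (forall y, c [set x; y] <> Some a) (missing c x a).
Proof.
rewrite /missing /nbr; case: pickP => [y /eqP Ey|h]; constructor.
  by move/(_ y).
by move=> y Ey; have := h y; rewrite Ey eqxx.
Qed.

Lemma notmissingP c x a : reflect (exists y, c [set x; y] = Some a) (~~ missing c x a).
Proof.
rewrite /missing /nbr; case: pickP => [y /eqP Ey|h]; constructor; first by exists y.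
by case=> y Ey; have := h y; rewrite Ey eqxx.
Qed.

Lemma card2_set2 (e : edge n) : #|e| = 2 -> exists x y, x != y /\ e = [set x; y].
Proof. by move=> /eqP/cards2P [x [y [nxy E]]]; exists x, y. Qed.

Lemma wf_intro c :
  (forall e, c e != None -> #|e| = 2) ->
  (forall x y z a, c [set x; y] = Some a -> c [set x; z] = Some a -> y = z) ->
  wf_coloring c.
Proof.
move=> h1 h2; split=> // f g a /andP[nfg /set0Pn[x]].
rewrite inE => /andP[xf xg] Ef Eg.
have other (e : edge n) : x \in e -> #|e| = 2 -> exists y, e = [set x; y].
  move=> xe e2; have [p [q [_ E]]] := card2_set2 e2; move: xe; rewrite E.
  by rewrite !inE => /orP[] /eqP <-; [exists q|exists p; rewrite setUC].
have [y Ey] : exists y, f = [set x; y] by apply: other => //; apply: h1; rewrite Ef.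
have [z Ez] : exists z, g = [set x; z] by apply: other => //; apply: h1; rewrite Eg.
subst f g; move: nfg; rewrite (h2 x y z a) // ?eqxx //.
Qed.

Section Move.
Variables (c : coloring n k) (x y z : 'I_n) (a : 'I_k).
Hypothesis wfc : wf_coloring c.
Hypothesis cxy : c [set x; y] = None.
Hypothesis cyz : c [set y; z] = Some a.
Hypothesis mxa : missing c x a.
Hypothesis nxy : x != y.

Let nyz : y != z. Proof. exact: wf_neq cyz. Qed.
Let nxz : x != z.
Proof. by apply: contra_eq_neq cyz => <-; rewrite setUC cxy. Qed.
Let nE : [set y; z] != [set x; y] :> edge n.
Proof.
rewrite [[set x; y]]setUC; apply: contra nxz => /eqP /set2_inj ->; exact: eqxx.
Qed.

Lemma moveE s t : move c [set x; y] [set y; z] [set s; t] =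
  if [set s; t] == [set x; y] then Some a
  else if [set s; t] == [set y; z] then None else c [set s; t].
Proof. by rewrite ffunE cyz. Qed.

Lemma move_wf : wf_coloring (move c [set x; y] [set y; z]).
Proof.
apply: wf_intro => [e|s t w f].
  rewrite ffunE; case: (e =P [set x; y]) => [->|_]; first by rewrite cards2 nxy.
  by case: ifP => // _; case: wfc => _; exact.
rewrite !moveE.
have aux p : [set s; p] = [set x; y] -> c [set s; t] = Some a ->
    [set s; t] != [set y; z] -> False.
  move=> /set2_eq [[-> _]|[-> _]] E.
    by move/missingP: mxa => /(_ t).
  by rewrite (wf_inj wfc E cyz) eqxx.
have aux' p : [set s; p] = [set x; y] -> c [set s; w] = Some a ->
    [set s; w] != [set y; z] -> False.
  move=> /set2_eq [[-> _]|[-> _]] E.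
    by move/missingP: mxa => /(_ w).
  by rewrite (wf_inj wfc E cyz) eqxx.
case: ([set s; t] =P [set x; y]) => [E|nE1];
  case: ([set s; w] =P [set x; y]) => [E'|nE2].
- by move=> _ _; apply: (@set2_inj _ s); rewrite E E'.
- move=> [<-]; case: ifP => // /negbT h1 h2; case: (aux' t E h2 h1).
- by case: ifP => // /negbT h1 h2 [Ef]; subst f; case: (aux w E' h2 h1).
- by case: ifP => // _ E1; case: ifP => // _ E2; exact: (wf_inj wfc E1 E2).
Qed.

(** The vertex [y] keeps the color [a], on [xy] instead of [yz]. So one step of a shift changes the
    set of colors present only at [x], which gains [a], and at [z], which loses it. *)
Lemma nbr_move s f : nbr (move c [set x; y] [set y; z]) s f =
  if f == a then (if s == y then Some x else if s == x then Some y
                  else if s == z then None else nbr c s f)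
  else nbr c s f.
Proof.
have W := move_wf.
have Hx : nbr (move c [set x; y] [set y; z]) y a = Some x.
  by apply: some_nbr => //; rewrite moveE [[set y; x]]setUC eqxx.
have Hy : nbr (move c [set x; y] [set y; z]) x a = Some y.
  by apply: some_nbr => //; rewrite moveE eqxx.
have Hz : nbr (move c [set x; y] [set y; z]) z a = None.
  apply/eqP/missingP => t; rewrite moveE.
  case: eqP => [/set2_eq[[E _]|[E _]] _|_].
  - by move: nxz; rewrite E eqxx.
  - by move: nyz; rewrite E eqxx.
  case: eqP => // h Et; apply: h; have := cyz; rewrite colorC => cyz'.
  by rewrite (wf_inj wfc Et cyz') setUC.
have H : forall s f, nbr c s f != nbr (move c [set x; y] [set y; z]) s f ->
   f = a /\ (s \in [:: x; y; z]).
  move=> {}s {}f.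
  case E1: (nbr c s f) => [t|].
    case: (boolP (move c [set x; y] [set y; z] [set s; t] == Some f)) => [/eqP E2|].
      by rewrite (some_nbr W E2) eqxx.
    rewrite moveE (nbr_some E1); case: ([set s; t] =P [set x; y]) => [E _ _|_].
      have [[]|[]] := set2_eq E => E2 E3; subst s t; have := nbr_some E1.
      - by rewrite cxy.
      - by rewrite colorC cxy.
    case: ([set s; t] =P [set y; z]) => [E _ _|]; last by rewrite eqxx.
    have E2 := nbr_some E1; rewrite E cyz in E2; case: E2 => <-; split=> //.
    by have [[-> _]|[-> _]] := set2_eq E; rewrite !inE eqxx ?orbT.
  case E2: (nbr _ s f) => [t|]; last by rewrite eqxx.
  move: (nbr_some E2); rewrite moveE; case: ([set s; t] =P [set x; y]) => [E [<-] _|_].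
    by split=> //; have [[-> _]|[-> _]] := set2_eq E; rewrite !inE eqxx ?orbT.
  by case: ifP => // _ /(some_nbr wfc); rewrite E1.
case: (eqVneq f a) => [->|nfa]; last first.
  apply/eqP; rewrite eq_sym; apply/negPn/negP => /H [E _].
  by rewrite E eqxx in nfa.
case: (eqVneq s y) => [-> //|nsy]; case: (eqVneq s x) => [-> //|nsx].
case: (eqVneq s z) => [-> //|nsz].
apply/eqP; rewrite eq_sym; apply/negPn/negP => /H [_].
by rewrite !inE (negbTE nsy) (negbTE nsx) (negbTE nsz).
Qed.

(** Lets a failed attempt be undone by moves in the opposite direction, without a copy of the
    coloring. *)
Lemma move_moveK :
  move (move c [set x; y] [set y; z]) [set z; y] [set y; x] = c.
Proof.
apply/ffunP=> e; rewrite !ffunE [[set z; y]]setUC [[set y; x]]setUC eqxx cyz.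
case: eqP => [->//|_]; case: eqP => [->//|//].
Qed.

End Move.

Section Assign.
Variables (c : coloring n k) (x y : 'I_n) (a : 'I_k).
Hypothesis wfc : wf_coloring c.
Hypothesis cxy : c [set x; y] = None.
Hypothesis mxa : missing c x a.
Hypothesis mya : missing c y a.
Hypothesis nxy : x != y.

Lemma assign_wf : wf_coloring (assign c [set x; y] a).
Proof.
apply: wf_intro => [e|s t w f].
  rewrite ffunE; case: (e =P [set x; y]) => [->|_]; first by rewrite cards2 nxy.
  by case: wfc => _; exact.
have aux p q : [set s; p] = [set x; y] -> c [set s; q] = Some a -> False.
  move=> /set2_eq [[-> _]|[-> _]].
    by move/missingP: mxa => /(_ q).
  by move/missingP: mya => /(_ q).
rewrite !ffunE; case: ([set s; t] =P [set x; y]) => [E|nE1];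
  case: ([set s; w] =P [set x; y]) => [E'|nE2].
- by move=> _ _; apply: (@set2_inj _ s); rewrite E E'.
- by move=> [<-] /(aux _ _ E).
- by move=> h [Ef]; subst f; case: (aux _ _ E' h).
- exact: wf_inj.
Qed.

Lemma nbr_assign s f : nbr (assign c [set x; y] a) s f =
  if f == a then (if s == y then Some x else if s == x then Some y
                  else nbr c s f)
  else nbr c s f.
Proof.
have W := assign_wf.
case: (eqVneq f a) => [->|nfa]; last first.
  case E: (nbr c s f) => [t|].
    apply: some_nbr => //; rewrite ffunE; case: ([set s; t] =P [set x; y]) => [E2|_].
      by have := nbr_some E; rewrite E2 cxy.
    exact: nbr_some.
  apply/eqP/missingP => t; rewrite ffunE; case: ([set s; t] =P [set x; y]) => [E2 [Ef]|_].
    by rewrite Ef eqxx in nfa.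
  by move/eqP/missingP: E.
case: (eqVneq s y) => [->|nsy].
  by apply: some_nbr => //; rewrite ffunE setUC eqxx.
case: (eqVneq s x) => [->|nsx].
  by apply: some_nbr => //; rewrite ffunE eqxx.
have nE t : [set s; t] != [set x; y].
  apply/negP => /eqP /set2_eq [[E _]|[E _]]; subst s.
    by rewrite eqxx in nsx.
  by rewrite eqxx in nsy.
case E: (nbr c s a) => [t|].
  by apply: some_nbr => //; rewrite ffunE (negbTE (nE t)); exact: nbr_some.
apply/eqP/missingP => t; rewrite ffunE (negbTE (nE t)).
by move/eqP/missingP: E.
Qed.

Lemma assign_shift : shift c [set x; y] [:: [set x; y]] (assign c [set x; y] a).
Proof.
constructor=> // f /andP[_ /set0Pn[s]]; rewrite !inE => /andP[sxy sf] Ef.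
have [p [q [npq E]]] : exists p q, p != q /\ f = [set p; q].
  by apply: card2_set2; case: wfc => _; apply; rewrite Ef.
have [t Et] : exists t, f = [set s; t].
  subst f; move: sf; rewrite !inE => /orP[] /eqP->; first by exists q.
  by exists p; rewrite setUC.
subst f; case/orP: sxy => /eqP Es; subst s; rewrite Et in Ef.
  by move/missingP: mxa => /(_ t).
by move/missingP: mya => /(_ t).
Qed.

End Assign.

Lemma missing_nbr c x a y : wf_coloring c -> c [set x; y] = Some a -> missing c x a = false.
Proof. by move=> h E; rewrite /missing (some_nbr h E). Qed.

End Colorings.

(** * Shifting along a path *)

Section Moves.
Variables n k : nat.

(** An unfinished shift, extended at its end: [shift] is built from the front of the chain, whereas
    the paths of the tree grow at the other end. The last argument is the edge that is currently
    uncolored. *)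
Inductive moves (c : coloring n k) (e : edge n) :
  seq (edge n) -> coloring n k -> edge n -> Prop :=
| moves_nil : moves c e [::] c e
| moves_rcons s c1 f g : moves c e s c1 f ->
    c1 f = None -> c1 g <> None -> #|f :&: g| = 1 -> Defs.proper (move c1 f g) ->
    moves c e (rcons s f) (move c1 f g) g.

Lemma moves_shift c e s c1 f s' c2 :
  moves c e s c1 f -> shift c1 f s' c2 -> shift c e (s ++ s') c2.
Proof.
move=> H; elim: H s' c2 => {s c1 f} [//|s c1 f g _ IH h1 h2 h3 h4] s' c2 h5.
by rewrite cat_rcons; apply: IH; apply: shift_next h5.
Qed.

Lemma moves_step c e s (c1 : coloring n k) x y z a :
  wf_coloring c1 -> c1 [set x; y] = None -> c1 [set y; z] = Some a ->
  missing c1 x a -> x != y ->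
  moves c e s c1 [set x; y] ->
  moves c e (rcons s [set x; y]) (move c1 [set x; y] [set y; z]) [set y; z].
Proof.
move=> h1 h2 h3 h4 h5 h6; apply: moves_rcons => //; first by rewrite h3.
  have -> : [set x; y] :&: [set y; z] = [set y].
    apply/setP=> t; rewrite !inE.
    case: (eqVneq t y) => [->|]; first by rewrite orbT.
    move=> _; rewrite orbF /=; case: (eqVneq t x) => //= ->.
    by apply/negbTE; apply: contra_eq_neq h3 => <-; rewrite colorC h2.
  by rewrite cards1.
by case: (move_wf h1 h3 h4 h5).
Qed.

End Moves.

Section Paths.
Variables (n k : nat) (c : coloring n k) (u v : 'I_n) (par : 'I_n -> 'I_n).
Hypothesis wfc : wf_coloring c.
Hypothesis cuv : c [set u; v] = None.
Hypothesis nuv : u != v.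
Hypothesis paru : par u = u.
Hypothesis parv : par v = u.

(* Paths are listed from their end back to the root [u]. *)
Fixpoint shifted (s : seq 'I_n) : coloring n k :=
  match s with
  | z :: ((p :: q :: _) as s') => move (shifted s') [set q; p] [set p; z]
  | _ => c
  end.

Fixpoint chain (s : seq 'I_n) : seq (edge n) :=
  match s with
  | z :: ((p :: _) as s') => rcons (chain s') [set p; z]
  | _ => [::]
  end.

(* The color that the vertex [x] of the path gains by the shift. *)
Fixpoint use (s : seq 'I_n) (x : 'I_n) : option 'I_k :=
  match s with
  | z :: ((p :: q :: _) as s') => if x == q then c [set p; z] else use s' x
  | _ => None
  end.

(* The colors missing at [x] once the edge from its parent is uncolored. *)
Definition avail (x : 'I_n) (a : 'I_k) : bool :=
  missing c x a || (c [set par x; x] == Some a).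

(* Only the last vertex of the path may be a repetition. *)
Inductive vpath : seq 'I_n -> Prop :=
| vpath_root : vpath [:: v; u]
| vpath_cons z p q r a : vpath [:: p, q & r] -> uniq [:: p, q & r] -> q = par p ->
    z != q -> c [set p; z] = Some a -> avail q a -> vpath [:: z, p, q & r].

Lemma vpath_shape s : vpath s -> exists z p r, s = [:: z, p & r] /\ p != z.
Proof.
case=> [|z p q r a _ _ _ _ E _]; first by exists v, u, [::].
by exists z, p, (q :: r); split=> //; exact: wf_neq E.
Qed.

(** One induction proves all of these because prolonging a path by [z] needs them for the shorter
    path: [sf_last] says that [pz] still has its color, and [sf_miss2] that this color is missing at
    [q]. The fields that speak about the last vertex assume that it is no repetition; [sf_miss2]
    does not, so it also holds for a reach of a vertex on its own path. *)
Record shift_facts s : Prop := ShiftFacts {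
  sf_wf : wf_coloring (shifted s);
  sf_none : forall z p r, s = [:: z, p & r] -> shifted s [set p; z] = None;
  sf_out : forall x t, x \notin s -> shifted s [set x; t] = c [set x; t];
  sf_last : forall z p r t, s = [:: z, p & r] -> uniq s -> t != p ->
    shifted s [set z; t] = c [set z; t];
  sf_miss1 : forall z p r f, s = [:: z, p & r] -> uniq s ->
    missing c z f || (c [set p; z] == Some f) -> missing (shifted s) z f;
  sf_miss2 : forall z p r f, s = [:: z, p & r] -> avail p f -> missing (shifted s) p f
}.

Lemma vpath_facts s : vpath s -> shift_facts s.
Proof.
elim=> {s} [|z p q r a H IH U Eq nzq E Av].
  split=> //=.
  - by move=> z p r [<- <-].
  - move=> z p r f [<- <-] _; rewrite cuv orbF //.
  - by move=> z p r f [_ <-]; rewrite /avail paru wf_loop // orbF.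
have npz : p != z by exact: wf_neq E.
have E' : shifted [:: p, q & r] [set p; z] = Some a.
  by rewrite (sf_last IH (erefl _)) // -E.
have N' : shifted [:: p, q & r] [set q; p] = None by exact: (sf_none IH (erefl _)).
have nqp : q != p by move: U => /=; rewrite inE negb_or eq_sym => /andP[/andP[]].
have M' : missing (shifted [:: p, q & r]) q a by exact: (sf_miss2 IH (erefl _)).
have W := sf_wf IH.
have SE : shifted [:: z, p, q & r] = move (shifted [:: p, q & r]) [set q; p] [set p; z] by [].
have NE s t : [set s; t] != [set q; p] -> [set s; t] != [set p; z] ->
   shifted [:: z, p, q & r] [set s; t] = shifted [:: p, q & r] [set s; t].
  by move=> h1 h2; rewrite SE (moveE _ E') (negbTE h1) (negbTE h2).
have nset (s t x y : 'I_n) : s != x -> s != y -> [set s; t] != [set x; y].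
  by move=> h1 h2; apply/negP => /eqP/set2_eq [[h _]|[h _]]; move: h1 h2; rewrite h eqxx.
split.
- by rewrite SE; apply: move_wf W E' M' nqp.
- move=> _ _ _ [<- <- _]; rewrite SE (moveE _ E') eqxx.
  by case: eqP => // /eqP; rewrite [[set q; p]]setUC => /eqP/set2_inj/eqP; rewrite (negbTE nzq).
- move=> x t; rewrite !inE !negb_or => /and4P[h1 h2 h3 h4].
  rewrite NE; try exact: nset.
  by rewrite (sf_out IH) // !inE !negb_or h2 h3.
- move=> _ _ _ t [<- <- _] U' ntp.
  have [h1 h2] : z \notin [:: p, q & r] /\ t != p by move: U' => /= /andP[].
  rewrite NE.
  + by rewrite (sf_out IH).
  + by apply: nset => //; rewrite eq_sym.
  + by apply/negP => /eqP; rewrite [[set p; z]]setUC => /set2_inj /eqP; rewrite (negbTE h2).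
- move=> _ _ _ f [<- <- _] U' h; rewrite /missing SE (nbr_move W N' E' M' nqp).
  have zs : z \notin [:: p, q & r] by move: U' => /= /andP[].
  case: (f =P a) => [Ef|nfa].
    by rewrite [z == p]eq_sym (negbTE npz) (negbTE nzq) eqxx.
  case/orP: h => [|/eqP]; last by rewrite E => -[Ef]; case: nfa.
  move=> /missingP h; apply/missingP => y; rewrite (sf_out IH) //; exact: h.
- move=> _ _ _ f [_ <- _] av; rewrite /missing SE (nbr_move W N' E' M' nqp).
  case: (f =P a) => [Ef|_]; last by apply: (sf_miss1 IH (erefl _) U); rewrite Eq.
  move: av; rewrite Ef /avail (missing_nbr wfc E) /= => /eqP; rewrite -Eq colorC => Eqp.
  by move: nzq; rewrite (wf_inj wfc Eqp E) eqxx.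
Qed.

Section Step.
Variables (z p q : 'I_n) (r : seq 'I_n).
Hypothesis H : vpath [:: z, p, q & r].

Lemma vpath_step : exists a, [/\ vpath [:: p, q & r], uniq [:: p, q & r], q = par p,
  z != q /\ q != p & c [set p; z] = Some a /\ avail q a].
Proof.
inversion H as [|z' p' q' r' a h1 h2 h3 h4 h5 h6]; subst; exists a; split=> //; split=> //.
by move: h2 => /=; rewrite inE negb_or eq_sym => /andP[/andP[]].
Qed.

Lemma vpath_move : exists a,
  [/\ wf_coloring (shifted [:: p, q & r]), shifted [:: p, q & r] [set q; p] = None,
      shifted [:: p, q & r] [set p; z] = Some a, missing (shifted [:: p, q & r]) q a &
      q != p] /\ c [set p; z] = Some a.
Proof.
have [a [h1 h2 h3 [h4 h4'] [h5 h6]]] := vpath_step.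
have F := vpath_facts h1; exists a; split=> //; split=> //.
- exact: sf_wf F.
- exact: (sf_none F (erefl _)).
- by rewrite (sf_last F (erefl _)).
- exact: (sf_miss2 F (erefl _)).
Qed.

End Step.

Lemma use_mem s x : use s x <> None -> x \in behead (behead s).
Proof.
elim: s => [//|z [//|p [//|q r]] IH].
rewrite /= -/(use [:: p, q & r] x); case: (eqVneq x q) => [->|_]; first by rewrite inE eqxx.
by move=> /IH /= h; rewrite inE h orbT.
Qed.

(** A vertex gains a color only in the move in which it is the upper end of the edge receiving it,
    and uniqueness of the path makes this happen once. Hence a shift spoils at most one candidate
    color at [z] and one at its neighbor. *)
Lemma vpath_present s x f : vpath s -> ~~ missing (shifted s) x f ->
  ~~ missing c x f \/ use s x = Some f.
Proof.
elim=> {s} [|z p q r a H IH U Eq nzq E Av]; first by left.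
have HS : vpath [:: z, p, q & r] by exact: vpath_cons E Av.
have [a' [[W N' E' M' nqp] Ea]] := vpath_move HS.
have {Ea} Ea : a' = a by move: Ea; rewrite E => -[].
subst a'.
have step : ~~ missing (shifted [:: p, q & r]) x f ->
    ~~ missing c x f \/ use [:: z, p, q & r] x = Some f.
  move=> /IH [?|h]; [by left|right].
  rewrite /= -/(use [:: p, q & r] x); case: eqP => // xq.
  have : x \in behead (behead [:: p, q & r]) by apply: use_mem; rewrite h.
  by move: U; rewrite /= xq => /and3P[_ /negbTE ->].
rewrite /missing -[shifted _]/(move (shifted [:: p, q & r]) [set q; p] [set p; z]).
rewrite (nbr_move W N' E' M' nqp); case: (eqVneq f a) => [Ef|_]; last exact: step.
subst a; case: (eqVneq x p) => [-> _|_].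
  by left; rewrite -/(missing c p f) (missing_nbr wfc E).
case: (eqVneq x q) => [-> _|_]; first by right; rewrite /= eqxx.
by case: ifP => // _; exact: step.
Qed.

Lemma vpath_edge s x y f : vpath s -> shifted s [set x; y] = Some f ->
  c [set x; y] = Some f \/
  (y = par x /\ use s y = Some f) \/ (x = par y /\ use s x = Some f).
Proof.
elim=> {s} [|z p q r a H IH U Eq nzq E Av]; first by left.
have HS : vpath [:: z, p, q & r] by exact: vpath_cons E Av.
have [a' [[W N' E' M' nqp] Ea]] := vpath_move HS.
have {Ea} Ea : a' = a by move: Ea; rewrite E => -[].
subst a'.
have Huse t : use [:: p, q & r] t = Some f -> use [:: z, p, q & r] t = Some f.
  move=> h; rewrite /= -/(use [:: p, q & r] t); case: eqP => // tq.
  have : t \in behead (behead [:: p, q & r]) by apply: use_mem; rewrite h.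
  by move: U; rewrite /= tq => /and3P[_ /negbTE ->].
rewrite -[shifted _]/(move (shifted [:: p, q & r]) [set q; p] [set p; z]).
rewrite (moveE _ E'); case: ([set x; y] =P [set q; p]) => [Exy [<-]|_].
  by right; have [[-> ->]|[-> ->]] := set2_eq Exy; rewrite /= eqxx E; auto.
case: ifP => // _ /IH [|[[h1 /Huse h2]|[h1 /Huse h2]]]; auto.
Qed.

Lemma chain_sub s e x : e \in chain s -> x \in e -> x \in s.
Proof.
elim: s => [//|z [//|p r] IH].
rewrite [chain _]/= -/(chain (p :: r)) mem_rcons inE => /orP[/eqP ->|h1 h2].
  by rewrite !inE => /orP[] /eqP ->; rewrite eqxx ?orbT.
by rewrite inE IH ?orbT.
Qed.

(** The last conclusion allows a chain to be prolonged although its final vertex may repeat an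
    earlier one: an edge that still has its old color, other than [uv], cannot be in the chain. *)
Lemma vpath_chain s : vpath s ->
  exists s0 z p r, [/\ s = [:: z, p & r], chain s = rcons s0 [set p; z],
    moves c [set u; v] s0 (shifted s) [set p; z], uniq (chain s) &
    forall e, e \in chain s -> e != [set u; v] -> shifted s e != c e].
Proof.
elim=> {s} [|z p q r a H IH U Eq nzq E Av].
  exists [::], v, u, [::]; split=> //; first exact: moves_nil.
  by move=> e; rewrite /= inE => /eqP ->; rewrite eqxx.
have HS : vpath [:: z, p, q & r] by exact: vpath_cons E Av.
have [a' [[W N' E' M' nqp] Ea]] := vpath_move HS.
have {Ea} Ea : a' = a by move: Ea; rewrite E => -[].
subst a'.
have [s0 [p' [q' [r' [[? ? ?] E0 mv un sh]]]]] := IH; subst p' q' r'.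
have nin : [set p; z] \notin chain [:: p, q & r].
  rewrite E0 mem_rcons inE negb_or; apply/andP; split.
    apply/negP => /eqP; rewrite [[set q; p]]setUC => /set2_inj Ezq.
    by rewrite Ezq eqxx in nzq.
  apply/negP => h; have : p \in q :: r.
    apply: (@chain_sub _ [set p; z]); last exact: set21.
    by move: E0; rewrite /= => /rcons_inj [->].
  by move: U => /= /andP[/negbTE ->].
exists (chain [:: p, q & r]), z, p, (q :: r); split=> //.
- rewrite E0 -[shifted _]/(move (shifted [:: p, q & r]) [set q; p] [set p; z]).
  exact: moves_step M' nqp mv.
- by rewrite [chain _]/= -/(chain [:: p, q & r]) rcons_uniq nin un.
move=> e; rewrite [chain _]/= -/(chain [:: p, q & r]) mem_rcons inE.
rewrite -[shifted _]/(move (shifted [:: p, q & r]) [set q; p] [set p; z]) ffunE E'.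
case: (eqVneq e [set q; p]) => [-> _ _|neq].
  apply/eqP => Eqp; have E2 := esym Eqp; rewrite colorC in E2.
  by move: nzq; rewrite (wf_inj wfc E2 E) eqxx.
case: (eqVneq e [set p; z]) => [-> _ _|_ /=]; first by rewrite E.
exact: sh.
Qed.

End Paths.

(** * The counting argument *)

Section SearchTree.
Variables (n k : nat) (c : coloring n k) (u v : 'I_n).
Hypothesis wfc : wf_coloring c.
Hypothesis cuv : c [set u; v] = None.
Hypothesis nuv : u != v.

(** By the default of [head], [u] and the vertices without a path are their own parents. As loops
    are uncolored, the colors available at them are just the missing ones. *)
Definition parent (pth : 'I_n -> seq 'I_n) (x : 'I_n) : 'I_n :=
  head x (behead (pth x)).

Record search_tree (tq : seq 'I_n) (pth : 'I_n -> seq 'I_n) : Prop := SearchTree {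
  st_u : pth u = [:: u];
  st_v : pth v = [:: v; u];
  st_uN : u \notin tq;
  st_vT : v \in tq;
  st_out : forall x, x \notin tq -> x != u -> pth x = [::];
  st_cons : forall x, x \in tq -> pth x = x :: pth (parent pth x);
  st_par : forall x, x \in tq -> x != v -> parent pth x \in tq;
  st_uniq : forall x, x \in tq -> uniq (pth x);
  st_path : forall x, x \in tq -> vpath c u v (parent pth) (pth x);
  st_sub : forall x y, x \in tq -> y \in pth x -> y \in u :: tq
}.

Section Tree.
Variables (tq : seq 'I_n) (pth : 'I_n -> seq 'I_n).
Hypothesis ST : search_tree tq pth.
Notation par := (parent pth).

Lemma par_u : par u = u.
Proof. by rewrite /parent (st_u ST). Qed.

Lemma par_v : par v = u.
Proof. by rewrite /parent (st_v ST). Qed.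

Lemma pth_shape x : x \in tq -> exists r, pth x = [:: x, par x & r].
Proof.
move=> xT; rewrite (st_cons ST xT).
case: (eqVneq x v) => [->|nv]; first by rewrite par_v (st_u ST); exists [::].
by rewrite (st_cons ST (st_par ST xT nv)); eexists.
Qed.

Lemma pth_suffix x a : a \in pth x -> exists s, pth x = s ++ pth a.
Proof.
have [m] := ubnP (size (pth x)); elim: m x => // m IH x.
case: (boolP (x \in tq)) => [xT|nT].
  have [r E] := pth_shape xT; rewrite {1 2}(st_cons ST xT) ltnS inE => h.
  case/orP => [/eqP ->|]; first by exists [::].
  by move=> /(IH _ h) [s Es]; exists (x :: s); rewrite (st_cons ST xT) Es.
case: (eqVneq x u) => [->|nu]; last by rewrite (st_out ST).
by rewrite (st_u ST) inE => _ /eqP ->; exists [::]; rewrite (st_u ST).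
Qed.

Lemma par_color x : x \in tq -> x != v -> exists a, c [set par x; x] = Some a.
Proof.
move=> xT nv; have [r E] := pth_shape xT.
have H := st_path ST xT; rewrite E in H.
inversion H as [E1|z p q s a h1 h2 h3 h4 h5 h6 E1]; last by exists a.
by move: E1 nv => ->; rewrite eqxx.
Qed.

Lemma par_nochild w z a : w \in tq -> c [set w; z] = Some a ->
  avail c par (par w) a -> z != par w.
Proof.
move=> wT E av; apply/eqP => Ez; subst z.
case: (eqVneq w v) => [Ew|nv].
  by move: E; rewrite Ew par_v colorC cuv.
rewrite colorC in E; move: av; rewrite /avail (missing_nbr wfc E) /= colorC => /eqP Epp.
have E2 := wf_inj wfc Epp E.
have := st_uniq ST wT; rewrite (st_cons ST wT) (st_cons ST (st_par ST wT nv)) E2.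
case: (eqVneq (par w) v) => [Ev|nv'].
  by move: E2; rewrite Ev par_v => Eu; move: (st_uN ST); rewrite Eu wT.
by rewrite (st_cons ST wT) /= !inE eqxx !orbT.
Qed.

Lemma vpath_reach w z a : w \in tq -> c [set w; z] = Some a ->
  avail c par (par w) a -> vpath c u v par (z :: pth w).
Proof.
move=> wT E av; have nz := par_nochild wT E av.
have [r Er] := pth_shape wT; rewrite Er.
apply: (vpath_cons (a := a)) => //; rewrite -Er; first exact: (st_path ST wT).
exact: (st_uniq ST wT).
Qed.

(** What a vertex gains is determined by the two vertices listed before it. So two paths with a
    common part toward the root bring the same colors to all its vertices except possibly the first
    two. *)
Lemma use_cat l s a : uniq (behead (l ++ s)) -> a \in behead (behead s) ->
  use c (l ++ s) a = use c s a.
Proof.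
elim: l => [//|x l IH] U h.
have U' : uniq (behead (l ++ s)).
  by move: U; rewrite /=; case: (l ++ s) => //= ? ? /andP[].
rewrite -IH // [(x :: l) ++ s]/=.
have : a \in behead (behead (l ++ s)).
  case: l {IH U U'} => [//|x' l]; case: l => [|x'' l] /=; first exact: mem_behead h.
  by rewrite mem_cat (mem_behead (mem_behead h)) orbT.
case E: (l ++ s) U' => [|p [|q r]] //= /andP[nq _] h'.
by case: eqP => // Ea; move: nq h'; rewrite Ea => /negbTE ->.
Qed.

End Tree.

End SearchTree.

(** [S] will be the number of pairs of a reach and a color blocked at an edge of [z], [P] the number
    of colors present at [z], [B] the number of bad pairs and [Z] the number of paths through [z].
    What remains after using the hypothesis on [b] is [D <= b + 1], against [b <= C <= D - 2]. *)
Lemma root_arith b C D S Z B P :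
  S <= P * (D - C) + B -> P <= D - 1 -> b.+1 * C.+1 <= S + 2 * Z -> B <= 2 * b ->
  Z <= b.+1 -> D * (D - C + 1) < b * (C - 1) + 2 -> C + 2 <= D -> b <= C -> 0 < C ->
  False.
Proof.
case: C => // C; move=> h1 h2 h3 h4 h5 h6 h7 h8 _.
have [E ED] : exists E, D = C.+1 + E.+2 by exists (D - C.+1 - 2); lia.
subst D; have E1 : C.+1 + E.+2 - C.+1 = E.+2 by lia.
have E2 : C.+1 - 1 = C by lia.
rewrite E1 E2 in h1 h6.
have : P * E.+2 <= (C.+1 + E.+2 - 1) * E.+2 by rewrite leq_mul2r h2 orbT.
have -> : C.+1 + E.+2 - 1 = C + E.+2 by lia.
lia.
Qed.

(** [W] will be the number of colors available at the parent of [z]. Here the hypotheses leave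
    [2 * C + 1 <= 2 * b], which [b <= C] only just excludes. *)
Lemma nonroot_arith b C D S Z B P W :
  S + W <= P * (D - C + 1) + B -> P <= D -> b.+1 * C.+1 <= S + 2 * Z -> B <= 2 * b ->
  Z <= b -> C < W -> D * (D - C + 1) < b * (C - 1) + 2 -> C + 2 <= D -> b <= C -> 0 < C ->
  False.
Proof.
case: C => // C; move=> h1 h2 h3 h4 h5 h5' h6 h7 h8 _.
have E2 : C.+1 - 1 = C by lia.
rewrite E2 in h6.
have : P * (D - C.+1 + 1) <= D * (D - C.+1 + 1) by rewrite leq_mul2r h2 orbT.
lia.
Qed.

Section Counting.
Variables (n k Delta C b : nat) (c : coloring n k) (u v : 'I_n).
Hypothesis wfc : wf_coloring c.
Hypothesis cuv : c [set u; v] = None.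
Hypothesis nuv : u != v.
Hypothesis kE : k = Delta + C.
Hypothesis CD : C + 2 <= Delta.
Hypothesis C1 : 1 <= C.
Hypothesis bC : b <= C.
Hypothesis ineq : Delta * (Delta - C + 1) < b * (C - 1) + 2.

Definition present (x : 'I_n) : {set 'I_k} := [set a | ~~ missing c x a].
Definition absent (x : 'I_n) : {set 'I_k} := [set a | missing c x a].

Lemma card_absent x : #|absent x| + #|present x| = k.
Proof.
have -> : present x = ~: absent x by apply/setP=> a; rewrite !inE.
by rewrite cardsC card_ord.
Qed.

Hypothesis degD : forall x, #|present x| <= Delta.
Hypothesis degu : #|present u| < Delta.
Hypothesis degv : #|present v| < Delta.

Variables (tq : seq 'I_n) (pth : 'I_n -> seq 'I_n).
Hypothesis ST : search_tree c u v tq pth.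
Notation par := (parent pth).

Lemma card_avail_tree (w : 'I_n) : w \in tq -> C < #|[set a | avail c par w a]|.
Proof.
move=> wT; case: (eqVneq w v) => [->|nv].
  have : absent v \subset [set a | avail c par v a].
    by apply/subsetP=> a; rewrite !inE /avail => ->.
  move/subset_leq_card; have := card_absent v; move: degv kE.
  by rewrite /reverse_coercion; lia.
have [x E] := par_color ST wT nv.
have xA : x \notin absent w.
  by rewrite inE (@missing_nbr _ _ _ _ _ (par w)) // colorC.
have : x |: absent w \subset [set a | avail c par w a].
  apply/subsetP=> a; rewrite !inE /avail => /orP[/eqP ->|-> //].
  by rewrite E eqxx orbT.
move/subset_leq_card; rewrite cardsU1 xA /=.
have ar (p q r : nat) : p + q = k -> q <= Delta -> 1 + p <= r -> C < r by lia.
exact: ar (card_absent w) (degD w).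
Qed.

Lemma card_avail (w : 'I_n) : w \in u :: tq -> C < #|[set a | avail c par w a]|.
Proof.
rewrite inE => /orP[/eqP ->|]; last exact: card_avail_tree.
have : absent u \subset [set a | avail c par u a].
  by apply/subsetP=> a; rewrite !inE /avail => ->.
move/subset_leq_card; have := card_absent u; move: degu kE.
by rewrite /reverse_coercion; lia.
Qed.

Variables (z : 'I_n) (w : 'I_b.+1 -> 'I_n) (y : 'I_b.+1 -> 'I_k).
Hypothesis w_inj : injective w.
Hypothesis wT : forall j, w j \in tq.
Hypothesis wy : forall j, c [set w j; z] = Some (y j).
Hypothesis avy : forall j, avail c par (par (w j)) (y j).
Hypothesis zroot : z = u \/ z = v \/ exists j1, w j1 = par z /\ z \in tq.

(** Taken in the original coloring, so that one list serves all the reaches of [z]. *)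
Definition common (a : 'I_n) : seq 'I_k :=
  [seq m <- enum 'I_k | missing c z m && missing c a m].

Notation sh j := (shifted c (z :: pth (w j))).
Notation us j := (use c (z :: pth (w j))).

(** There are two ways to fail on the edge [za]: it is a tree edge whose color the shift has
    changed, so that it may already be in the chain, or each candidate color is present at one of
    its ends. *)
Hypothesis fail : forall j al, missing (sh j) (w j) al ->
  exists2 a, sh j [set z; a] = Some al &
    ((a = par z \/ z = par a) /\ c [set z; a] <> Some al) \/
    (forall f, f = y j \/ f \in take 3 (common a) ->
       ~~ missing (sh j) z f \/ ~~ missing (sh j) a f).

Lemma y_inj : injective y.
Proof.
move=> i j E; apply: w_inj; have := wy i; have := wy j.
by rewrite E ![[set _; z]]setUC => h1 h2; exact: wf_inj wfc h2 h1.
Qed.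

Let vp j : vpath c u v par (z :: pth (w j)).
Proof. by apply: (vpath_reach _ _ ST (wT j) (wy j) (avy j)). Qed.

Let facts j := vpath_facts wfc cuv (par_u ST) (vp j).

Lemma us_mem j x : us j x <> None -> x \in pth (par (w j)).
Proof. by move/use_mem; rewrite (st_cons ST (wT j)). Qed.

Lemma us_mem' j x : us j x <> None -> x \in pth (w j).
Proof. by move/us_mem => h; rewrite (st_cons ST (wT j)) inE h orbT. Qed.

(** Translates a failure in the shifted coloring into the original one. If the shift has changed the
    color of [za], then [z] is on the path and [al] is one of two colors; otherwise [a] is the
    original [al]-neighbor of [z]. *)
Lemma fail_cases j al : avail c par (w j) al ->
  (z \in pth (w j) /\ (us j z = Some al \/ us j (par z) = Some al)) \/
  (exists2 a, c [set z; a] = Some al &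
    (~~ missing c a (y j) \/ us j a = Some (y j)) /\
    (forall f, missing c z f -> missing c a f -> us j z = Some f \/ us j a = Some f)).
Proof.
move=> av; have [r Er] := pth_shape ST (wT j).
have M : missing (sh j) (w j) al.
  by apply: (sf_miss2 (facts j)) av; rewrite Er.
have [a Ea H] := fail M.
have vpj := vp j; have fc := facts j; rewrite Er in vpj.
have [x [[W N' E' M' nqp] Ex]] := vpath_move wfc cuv (par_u ST) vpj.
have Exy : x = y j by move: Ex; rewrite wy => -[].
have lost : (a = par z \/ z = par a) -> c [set z; a] <> Some al ->
    z \in pth (w j) /\ (us j z = Some al \/ us j (par z) = Some al).
  move=> _ nE; split.
    apply/negPn/negP => zN; apply: nE; rewrite -Ea.
    rewrite Er -[shifted c _]/(move (shifted c [:: w j, par (w j) & r]) [set par (w j); w j] [set w j; z]).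
    move: Ea; rewrite Er -[shifted c _]/(move (shifted c [:: w j, par (w j) & r]) [set par (w j); w j] [set w j; z]).
    rewrite (moveE _ E'); case: eqP => [E3|_].
      by have [[E4 _]|[E4 _]] := set2_eq E3; move: zN; rewrite Er E4 !inE eqxx ?orbT.
    case: ifP => // _ _; rewrite -Er; symmetry.
    exact: (sf_out (vpath_facts wfc cuv (par_u ST) (st_path ST (wT j)))).
  have [//|[[-> ->]|[_ ->]]] := vpath_edge wfc cuv (par_u ST) (vp j) Ea; auto.
case: H => [[h1 h2]|H]; first by left; exact: lost.
case: (boolP (c [set z; a] == Some al)) => [/eqP Eza|/eqP Eza]; last first.
  left; apply: lost => //.
  by have [//|[[-> _]|[-> _]]] := vpath_edge wfc cuv (par_u ST) (vp j) Ea; auto.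
right; exists a => //.
have pres t f : ~~ missing (sh j) t f -> ~~ missing c t f \/ us j t = Some f.
  exact: (vpath_present wfc cuv (par_u ST)).
split.
  (* The shift has moved [y j] from the edge between [w j] and [z] to the edge before it, so [z]
     lacks it and the obstruction is at [a]. *)
  have [|h|/pres //] := H (y j); first by left.
  move: h; rewrite Er /missing -[shifted c _]/(move (shifted c [:: w j, par (w j) & r]) [set par (w j); w j] [set w j; z]).
  rewrite (nbr_move W N' E' M' nqp) Exy eqxx.
  have nwz : z != w j by rewrite eq_sym; exact: wf_neq (wy j).
  by rewrite (negbTE nwz) (negbTE (par_nochild wfc cuv ST (wT j) (wy j) (avy j))) eqxx.
have small f : f \in common a -> f \in take 3 (common a) -> us j z = Some f \/ us j a = Some f.
  rewrite mem_filter => /andP[/andP[m1 m2] _] ft.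
  have [|/pres [|]|/pres [|]] := H f; first by right.
  - by rewrite m1.
  - by left.
  - by rewrite m2.
  - by right.
move=> f m1 m2; have fC : f \in common a by rewrite mem_filter m1 m2 mem_enum.
case: (boolP (f \in take 3 (common a))) => [|nf]; first exact: small.
(* If [take 3] cuts something off, it has three distinct colors, but all of them must be among the
   two colors that the shift brings to [z] and to [a]. *)
have sz : 2 < size (take 3 (common a)).
  rewrite size_take; case: ifP => // /negbT; rewrite -leqNgt => h.
  by move: nf; rewrite take_oversize // fC.
have U : uniq (take 3 (common a)).
  by rewrite take_uniq // filter_uniq // enum_uniq.
have sub : {subset map Some (take 3 (common a)) <= [:: us j z; us j a]}.
  move=> o /mapP [g gt ->]; rewrite !inE.
  have /= := small g (mem_take gt) gt.
  by case=> ->; rewrite eqxx ?orbT.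
have := uniq_leq_size _ sub; rewrite map_inj_uniq; last by move=> ? ? [].
by move=> /(_ U); rewrite size_map /= => h; have := leq_trans sz h.
Qed.

(* [L j]: colors that the shift for [j] removes from [z].  Any other color of [W j]
   sits on the edge from [z] to [an al], which blocks [j] for [al]; [K al] are
   the reaches blocked in this way and [R3 al] those for which the shift brings
   [y j] to [an al].  The contradiction comes from counting the pairs ([j], [al])
   in two ways. *)
Let W j := [set al | avail c par (w j) al].
Let L j := [set al in W j | (z \in pth (w j)) &&
  ((us j z == Some al) || (us j (par z) == Some al))].
Let K al := [set j | al \in W j :\: L j].
Let an al := odflt z (nbr c z al).
Let R3 al := [set j in K al | us j (an al) == Some (y j)].
Let rr al := #|absent z :&: absent (an al)|.

Lemma K_facts j al : j \in K al -> [/\ c [set z; an al] = Some al,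
    ~~ missing c (an al) (y j) \/ us j (an al) = Some (y j) &
    (forall f, missing c z f -> missing c (an al) f ->
       us j z = Some f \/ us j (an al) = Some f)].
Proof.
rewrite inE inE => /andP[nL Wj]; move: (Wj); rewrite inE => /fail_cases [[h1 h2]|].
  by move: nL; rewrite /L inE Wj h1 /=; case: h2 => /= ->; rewrite eqxx ?orbT.
by move=> [a Ea [h1 h2]]; rewrite /an (some_nbr wfc Ea).
Qed.

Lemma K_present al j : j \in K al -> al \in present z.
Proof. by move=> /K_facts [E _ _]; rewrite inE (missing_nbr wfc E). Qed.

Lemma card_L j : #|L j| <= 2 * (z \in pth (w j)).
Proof.
case: (boolP (z \in pth (w j))) => zp; last first.
  rewrite (_ : L j = set0) ?cards0 //; apply/setP=> a.
  by rewrite !inE (negbTE zp) andbF.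
rewrite muln1; have : L j \subset [set oapp id (y j) (us j z); oapp id (y j) (us j (par z))].
  apply/subsetP=> a; rewrite !inE zp /= => /andP[_].
  by case/orP => /eqP -> /=; rewrite eqxx ?orbT.
by move/subset_leq_card => h; apply: leq_trans h _; rewrite cards2; case: eqP.
Qed.

Lemma card_W j : C < #|W j|. Proof. exact: card_avail_tree. Qed.

Lemma y_absent j : ~~ missing c z (y j).
Proof. by rewrite (@missing_nbr _ _ _ _ _ (w j)) // colorC. Qed.

Lemma y_neq j al : al \in W j -> y j != al.
Proof.
rewrite inE /avail; apply: contraL => /eqP <-.
rewrite (missing_nbr wfc (wy j)) /= colorC; apply/eqP => E.
have := par_nochild wfc cuv ST (wT j) (wy j) (avy j).
by rewrite (wf_inj wfc E (wy j)) eqxx.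
Qed.

(** Three disjoint sets of colors are present at [an al]: [al] itself, the colors missing at [z] but
    not there, and the [y j] for [j] in [K al] outside [R3 al]. The last are distinct and present at
    [z]. Their number is at most the degree bound. *)
Lemma card_K al : K al != set0 ->
  #|K al| + #|absent z| + 1 <= Delta + rr al + #|R3 al|.
Proof.
move=> /set0Pn [j0 j0K]; have [Ea _ _] := K_facts j0K.
set a := an al in Ea *.
set Y := y @: (K al :\: R3 al).
have cY : #|Y| = #|K al| - #|R3 al|.
  rewrite card_imset; last exact: y_inj.
  by rewrite cardsD (setIidPr _) //; apply/subsetP => j; rewrite inE => /andP[].
have sub : [set al] :|: (absent z :\: absent a) :|: Y \subset present a.
  apply/subsetP=> f; rewrite !inE -orbA => /or3P[/eqP ->|/andP[h _] //|].
    by rewrite (@missing_nbr _ _ _ _ _ z) // colorC.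
  case/imsetP => j; rewrite inE => /andP[nR jK] ->.
  have [_ [//|h] _] := K_facts jK.
  by move: nR; rewrite inE jK -/a h eqxx.
have d1 : [disjoint [set al] & absent z :\: absent a].
  by rewrite disjoints1 !inE (missing_nbr wfc Ea) andbF.
have d2 : [disjoint [set al] :|: (absent z :\: absent a) & Y].
  rewrite disjoint_sym disjoints_subset; apply/subsetP => f /imsetP [j jKR ->].
  have jK : j \in K al by move: jKR; rewrite inE => /andP[].
  have jW : al \in W j by move: jK; rewrite inE inE => /andP[].
  by rewrite !inE (negbTE (y_absent j)) andbF orbF y_neq.
have := subset_leq_card sub.
rewrite cardsU (disjoint_setI0 d2) cards0 subn0 cardsU (disjoint_setI0 d1) cards0 subn0.
rewrite cards1 cY cardsD -/(rr al).
have : rr al <= #|absent z| by apply: subset_leq_card; exact: subsetIl.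
have : #|R3 al| <= #|K al| by apply: subset_leq_card; apply/subsetP => j; rewrite inE => /andP[].
by have := degD a; rewrite /rr -/a /reverse_coercion; lia.
Qed.

Lemma rr_le2 al : K al != set0 -> rr al <= 2.
Proof.
move=> /set0Pn [j jK]; have [_ _ h] := K_facts jK.
have : absent z :&: absent (an al) \subset
   [set oapp id (y j) (us j z); oapp id (y j) (us j (an al))].
  apply/subsetP=> f; rewrite !inE => /andP[/h h1 /h1].
  by case=> -> /=; rewrite eqxx ?orbT.
by move/subset_leq_card => h2; apply: leq_trans h2 _; rewrite cards2; case: eqP.
Qed.

(** For [j] in [R3 al] the one color gained by [an al] is [y j], which is present at [z]. So a
    common missing color can only be spoiled by what [z] gains. *)
Lemma rr_le1 al : R3 al != set0 -> rr al <= 1.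
Proof.
move=> /set0Pn [j]; rewrite inE => /andP[jK /eqP Eu].
have [_ _ h] := K_facts jK.
have : absent z :&: absent (an al) \subset [set oapp id (y j) (us j z)].
  apply/subsetP=> f; rewrite !inE => /andP[h0]; move: (h0) => /h h1 /h1.
  case=> [-> /=|]; first by rewrite eqxx.
  by rewrite Eu => -[Ef]; move: h0; rewrite -Ef (negbTE (y_absent j)).
by move/subset_leq_card; rewrite cards1.
Qed.

Section NonRoot.
Variable j1 : 'I_b.+1.
Hypothesis Ej1 : w j1 = par z.
Hypothesis zT : z \in tq.

Lemma z_fresh : z \notin pth (w j1).
Proof. by have := st_uniq ST zT; rewrite (st_cons ST zT) Ej1 => /= /andP[]. Qed.

Lemma us1_z : us j1 z = None.
Proof.
case E: (us j1 z) => [x|//]; have := @us_mem' j1 z; rewrite E => /(_ _).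
by rewrite (negbTE z_fresh) => h; have : false by exact: h.
Qed.

Lemma W_K1 al : al \in W j1 -> j1 \in K al.
Proof. by move=> h; rewrite inE in_setD h andbT inE (negbTE z_fresh) andbF. Qed.

Lemma rr_j1 al : al \in W j1 -> rr al <= 1.
Proof.
move=> /W_K1 jK; have [_ _ h] := K_facts jK.
have : absent z :&: absent (an al) \subset [set oapp id (y j1) (us j1 (an al))].
  apply/subsetP=> f; rewrite !inE => /andP[/h h1 /h1]; rewrite us1_z.
  by case=> [//|-> /=]; rewrite eqxx.
by move/subset_leq_card; rewrite cards1.
Qed.

(** As the shift for [j1] brings nothing to [z], a common missing color [m] is brought to [an al].
    For [j] in [R3 al] that vertex gains [y j] instead, so [z] gains [m] and lies on the path of
    [j]. That path then contains the one of [j1], and both bring the same color to [an al]. *)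
Lemma R3_j1 al : al \in W j1 -> 0 < rr al -> R3 al = set0.
Proof.
move=> Wal; have [_ _ h1] := K_facts (W_K1 Wal).
case/card_gt0P => m; rewrite !inE => /andP[mz ma].
have [|E1] := h1 m mz ma; first by rewrite us1_z.
apply/setP => j; rewrite inE [RHS]inE; apply/negP => /andP[jK /eqP Eu].
have [_ _ h] := K_facts jK.
have nm : y j != m by apply: contraL mz => /eqP <-; exact: y_absent.
case: (h m mz ma) => [Ez|]; last by rewrite Eu => -[Em]; rewrite Em eqxx in nm.
have zp : z \in pth (w j) by apply: us_mem'; rewrite Ez.
have [s Es] := pth_suffix ST zp.
have Ep : pth z = z :: pth (w j1) by rewrite (st_cons ST zT) Ej1.
have : us j (an al) = us j1 (an al).
  rewrite Es Ep -cat_cons; apply: use_cat.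
    by rewrite /= -Ep -Es; exact: (st_uniq ST (wT j)).
  rewrite (st_cons ST (wT j1)) [behead _]/=; apply: us_mem; by rewrite E1.
by rewrite Eu E1 => -[Em]; rewrite Em eqxx in nm.
Qed.

End NonRoot.

(* The shift for [j] brings to [a] a color that no earlier shift brings, although
   [a] lies on an earlier path.  This happens for at most two [a] per [j]: the
   place where the path of [j] joins the earlier ones, and its parent. *)
Let bad j a := [&& us j a != None,
  [forall j' : 'I_b.+1, (j' < j) ==> (us j' a != us j a)] &
  [exists j' : 'I_b.+1, (j' < j) && (us j' a != None)]].

(** The reaches in [R3 al] bring distinct colors to [an al]. Replace each by the first reach that
    brings the same color; among the reaches that are first for their color, all but the very first
    are bad. *)
Lemma card_R3 al : #|R3 al| <= 1 + #|[set j | bad j (an al)]|.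
Proof.
set a := an al.
pose NB := [set j | (us j a != None) &&
  [forall j' : 'I_b.+1, (j' < j) ==> (us j' a != us j a)]].
pose phi j := [arg min_(i < j | us i a == us j a) (i : nat)].
have phiP j : us (phi j) a = us j a /\ forall i, us i a = us j a -> phi j <= i.
  rewrite /phi; case: arg_minnP => [|i /eqP Ei mi]; first exact: eqxx.
  by split=> // i' Ei'; apply: mi; rewrite Ei'.
have sub : phi @: R3 al \subset NB.
  apply/subsetP => i /imsetP [j jR ->]; have [E mi] := phiP j.
  rewrite inE E; apply/andP; split.
    by move: jR; rewrite inE => /andP[_ /eqP ->].
  apply/forallP => i'; apply/implyP => lt; apply/negP => /eqP E'.
  by have := mi i' E'; rewrite leqNgt lt.
have inj : {in R3 al &, injective phi}.
  move=> i j; rewrite inE => /andP[_ /eqP Ei]; rewrite inE => /andP[_ /eqP Ej] E.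
  have [h1 _] := phiP i; have [h2 _] := phiP j.
  by apply: y_inj; move: h1 h2; rewrite E => ->; rewrite Ei Ej => -[].
have := subset_leq_card sub; rewrite card_in_imset // => h; apply: leq_trans h _.
have : NB \subset (NB :\: [set j | bad j a]) :|: [set j | bad j a].
  by apply/subsetP => j; rewrite !inE => ->; rewrite andbT orNb.
move/subset_leq_card => h; apply: leq_trans h _.
rewrite cardsU; apply: leq_trans (leq_subr _ _) _; rewrite leq_add2r.
apply/card_le1_eqP => i j; rewrite !inE /bad => /andP[h1 /andP[h2 h3]] /andP[h4 /andP[h5 h6]].
have aux i' j' : us i' a != None ->
  ~~ [&& us j' a != None, [forall j0 : 'I_b.+1, (j0 < j') ==> (us j0 a != us j' a)] &
   [exists j0 : 'I_b.+1, (j0 < j') && (us j0 a != None)]] -> us j' a != None ->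
   [forall j0 : 'I_b.+1, (j0 < j') ==> (us j0 a != us j' a)] -> j' <= i'.
  move=> g1 g2 g3 g4; rewrite leqNgt; apply: contra g2 => lt; rewrite g3 g4 /=.
  by apply/existsP; exists i'; rewrite lt.
by apply/val_inj/eqP; rewrite eqn_leq (aux j i) // (aux i j).
Qed.

Lemma bad_le2 (j : 'I_b.+1) (A : {set 'I_n}) :
  #|[set a in A | bad j a]| <= 2 * (0 < j).
Proof.
case: (posnP j) => [j0|jp].
  rewrite (_ : [set a in A | bad j a] = set0) ?cards0 //.
  apply/setP => a; rewrite !inE /bad; apply/negP => /and4P[_ _ _ /existsP [i]].
  by rewrite j0.
rewrite muln1.
pose old a := [exists j' : 'I_b.+1, (j' < j) && (a \in pth (par (w j')))].
pose t := pth (par (w j)).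
case: (boolP (has old t)) => [hs|/hasPn hn]; last first.
  rewrite (_ : [set a in A | bad j a] = set0) ?cards0 //.
  apply/setP => a; rewrite !inE; apply/negP => /andP[_ /and3P[h1 h2 /existsP [i /andP[ij ia]]]].
  have at_ : a \in t by apply: us_mem; exact/eqP.
  move: (hn a at_); rewrite /old; case/existsP; exists i; rewrite ij /=.
  by apply: us_mem; exact/eqP.
(* Going from the end of the path toward the root, [a0] is the first vertex that lies on an earlier
   path. From there the two paths coincide, and [use_cat] rules out everything beyond [a0] and its
   parent. *)
pose a0 := nth (w j) t (find old t).
have a0t : a0 \in t by rewrite mem_nth // -has_find.
have /existsP [i /andP[ij a0i]] : old a0 by exact: nth_find.
suff sub : [set a in A | bad j a] \subset [set a0; par a0].
  by apply: leq_trans (subset_leq_card sub) _; rewrite cards2; case: eqP.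
apply/subsetP => a; rewrite !inE => /andP[_ /and3P[/eqP h1 /forallP h2 /existsP [i' /andP[i'j /eqP i'a]]]].
have at_ : a \in t by exact: us_mem.
have [s1 Es1] := pth_suffix ST a0t.
have [s2 Es2] := pth_suffix ST a0i.
have Es3 : us j = use c ((z :: w j :: s1) ++ pth a0).
  by rewrite (st_cons ST (wT j)) -/t /t Es1.
have Es4 : us i = use c ((z :: w i :: s2) ++ pth a0).
  by rewrite (st_cons ST (wT i)) Es2.
case: (boolP (a \in behead (behead (pth a0)))) => h.
  move: (h2 i); rewrite ij implyTb Es3 Es4 !use_cat ?eqxx //.
  - have := st_uniq ST (wT j); rewrite (st_cons ST (wT j)) Es1 //.
  - have := st_uniq ST (wT i); rewrite (st_cons ST (wT i)) Es2 //.
have a_old : old a by apply/existsP; exists i'; rewrite i'j us_mem.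
have Ut : uniq t.
  by have := st_uniq ST (wT j); rewrite (st_cons ST (wT j)) /= => /andP[].
have ap : a \in pth a0.
  move: (at_); rewrite {1}/t Es1 mem_cat => /orP[as1|//].
  have a0s : a0 \in pth a0.
    have : a0 \in pth (w j) by rewrite (st_cons ST (wT j)) inE a0t orbT.
    move/(st_sub ST (wT j)); rewrite inE => /orP[/eqP ->|h0].
      by rewrite (st_u ST) inE.
    by rewrite (st_cons ST h0) inE eqxx.
  have a0n : a0 \notin s1.
    by move: Ut; rewrite /t Es1 cat_uniq => /and3P[_ /hasPn /(_ _ a0s)].
  have lt : index a t < find old t.
    have <- : index a0 t = find old t by rewrite /a0 index_uniq // -has_find.
    rewrite /t Es1 !index_cat as1 (negbTE a0n); apply: leq_trans (leq_addr _ _).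
    by rewrite index_mem.
  have := before_find (w j) lt; rewrite nth_index // => hf.
  have : false by rewrite -hf; exact: a_old.
  by [].
have : a0 \in pth (w j) by rewrite (st_cons ST (wT j)) inE a0t orbT.
move/(st_sub ST (wT j)); rewrite inE => /orP[/eqP a0u|h0].
  by move: ap; rewrite a0u (st_u ST) inE => ->.
have [r Er] := pth_shape ST h0.
by move: ap h; rewrite Er !inE /= => /or3P[->|->|->] //; rewrite orbT.
Qed.

Lemma present_card_le : #|present z| <= Delta - (z \in [:: u; v]).
Proof.
have ar (p : nat) : p < Delta -> p <= Delta - 1 by lia.
rewrite !inE; case: eqP => [->|_] /=; first exact: ar degu.
case: eqP => [->|_] /=; first exact: ar degv.
by rewrite subn0.
Qed.

Lemma sum_WL : \sum_(j < b.+1) #|W j :\: L j| = \sum_(al in present z) #|K al|.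
Proof.
transitivity (\sum_(al : 'I_k) #|K al|).
  under eq_bigr do rewrite -sum1_card.
  under [RHS]eq_bigr do rewrite -sum1_card.
  rewrite (exchange_big_dep predT) //=; apply: eq_bigr => al _.
  by apply: eq_bigl => j; rewrite [in RHS]inE.
rewrite (bigID (mem (present z))) /= [X in _ + X]big1 ?addn0 //.
move=> al nP; apply/eqP; rewrite cards_eq0; apply/negPn/negP => /set0Pn [j jK].
by rewrite (K_present jK) in nP.
Qed.

Lemma sum_bad : \sum_(al in present z) #|[set j | bad j (an al)]| <= 2 * b.
Proof.
have -> : \sum_(al in present z) #|[set j | bad j (an al)]| =
   \sum_(j < b.+1) #|[set al in present z | bad j (an al)]|.
  under eq_bigr do rewrite -sum1_card.
  under [RHS]eq_bigr do rewrite -sum1_card.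
  rewrite (exchange_big_dep predT) //=; apply: eq_bigr => j _.
  by apply: eq_bigl => al; rewrite !inE.
apply: (@leq_trans (\sum_(j < b.+1) 2 * (0 < j))).
  apply: leq_sum => j _; apply: leq_trans (bad_le2 j (an @: present z)).
  rewrite -(card_in_imset (f := an)).
    apply: subset_leq_card; apply/subsetP => a /imsetP [al]; rewrite inE => /andP[h1 h2] ->.
    by rewrite inE h2 andbT; apply: imset_f.
  move=> al al'; rewrite !inE => /andP[/notmissingP [a Ea] _] /andP[/notmissingP [a' Ea'] _].
  rewrite /an (some_nbr wfc Ea) (some_nbr wfc Ea') /= => E.
  by move: Ea; rewrite E Ea' => -[].
rewrite big_ord_recl muln0 add0n.
under eq_bigr do rewrite /= muln1.
by rewrite sum_nat_const card_ord mulnC.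
Qed.

Lemma sum_W : (b.+1) * C.+1 <=
  \sum_(j < b.+1) #|W j :\: L j| + 2 * \sum_(j < b.+1) (z \in pth (w j)).
Proof.
rewrite big_distrr /= -big_split /= -[X in X * _]card_ord -sum_nat_const.
apply: leq_sum => j _; have h1 := card_W j; have h2 := card_L j.
have h3 : L j \subset W j by apply/subsetP => a; rewrite inE => /andP[].
have := cardsD (W j) (L j); rewrite (setIidPr h3) => ->.
have ar (p q r e : nat) : e < p -> q <= 2 * r -> q <= p -> e < p - q + 2 * r by lia.
exact: ar h1 h2 (subset_leq_card h3).
Qed.

Lemma contradiction_root : z \in [:: u; v] -> False.
Proof.
move=> zr; have Pz := present_card_le; rewrite zr in Pz.
have Az := card_absent z.
have bound al : al \in present z -> #|K al| <= Delta - C + #|[set j | bad j (an al)]|.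
  move=> _; case: (boolP (K al == set0)) => [/eqP ->|K0]; first by rewrite cards0.
  have h1 := card_K K0; have h2 := rr_le2 K0; have h3 := card_R3 al.
  case: (boolP (R3 al == set0)) => [/eqP R0|/rr_le1 h4].
    by move: h1 h2 h3 Pz Az; rewrite R0 cards0 /reverse_coercion; lia.
  by move: h1 h2 h3 h4 Pz Az; rewrite /reverse_coercion; lia.
have : \sum_(al in present z) #|K al| <=
    \sum_(al in present z) (Delta - C + #|[set j | bad j (an al)]|) by exact: leq_sum.
rewrite -sum_WL big_split /= sum_nat_const.
have sD : \sum_(j < b.+1) (z \in pth (w j)) <= b.+1.
  rewrite -[X in _ <= X]card_ord -sum1_card; apply: leq_sum => j _; exact: leq_b1.
move=> h; exact: root_arith h Pz sum_W sum_bad sD ineq CD bC C1.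
Qed.

(** Here [z] is only guaranteed [C] missing colors, one less than [u] and [v], which weakens the
    bound on each [K al] by one. For the more than [C] colors available at [w j1] the sharper bounds
    [rr_j1] and [R3_j1] win this unit back. *)
Lemma contradiction_nonroot j1 : w j1 = par z -> z \in tq -> False.
Proof.
move=> Ej1 zT; have Pz : #|present z| <= Delta by exact: degD.
have Az := card_absent z.
have bound al : al \in present z ->
    #|K al| + (al \in W j1) <= Delta - C + 1 + #|[set j | bad j (an al)]|.
  move=> _; case: (boolP (al \in W j1)) => [h|h].
    have K0 : K al != set0 by apply/set0Pn; exists j1; exact: (W_K1 Ej1 zT h).
    have h1 := card_K K0; have h2 := rr_j1 Ej1 zT h; have h3 := card_R3 al.
    case: (posnP (rr al)) => [r0|rp].
      by move: h1 h2 h3 Pz Az; rewrite r0 /reverse_coercion; lia.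
    by move: h1 h2 h3 Pz Az; rewrite (R3_j1 Ej1 zT h rp) cards0 /reverse_coercion; lia.
  case: (boolP (K al == set0)) => [/eqP ->|K0]; first by rewrite cards0.
  have h1 := card_K K0; have h2 := rr_le2 K0; have h3 := card_R3 al.
  case: (boolP (R3 al == set0)) => [/eqP R0|/rr_le1 h4].
    by move: h1 h2 h3 Pz Az; rewrite R0 cards0 /reverse_coercion; lia.
  by move: h1 h2 h3 h4 Pz Az; rewrite /reverse_coercion; lia.
have : \sum_(al in present z) (#|K al| + (al \in W j1)) <=
    \sum_(al in present z) (Delta - C + 1 + #|[set j | bad j (an al)]|) by exact: leq_sum.
rewrite big_split [X in _ <= X]big_split /= -sum_WL sum_nat_const.
have -> : \sum_(al in present z) (al \in W j1) = #|W j1|.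
  rewrite -sum1_card [RHS]big_mkcond [LHS]big_mkcond /=; apply: eq_bigr => al _.
  case: (boolP (al \in W j1)) => [h|_]; last by case: ifP.
  by rewrite (K_present (W_K1 Ej1 zT h)).
have sD : \sum_(j < b.+1) (z \in pth (w j)) <= b.
  rewrite (bigD1 j1) //= (negbTE (z_fresh Ej1 zT)) add0n.
  apply: (@leq_trans (\sum_(j < b.+1 | j != j1) 1)).
    by apply: leq_sum => j _; exact: leq_b1.
  rewrite sum1_card; apply: eq_leq.
  have E := cardC1 j1; rewrite card_ord in E; apply: (etrans _ E); exact: eq_card.
move=> h; exact: nonroot_arith h Pz sum_W sum_bad sD (card_W j1) ineq CD bC C1.
Qed.

Lemma fail_absurd : False.
Proof.
case: zroot => [zu|[zv|[j1 [Ej1 zT]]]]; last exact: contradiction_nonroot Ej1 zT.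
  by apply: contradiction_root; rewrite zu inE eqxx.
by apply: contradiction_root; rewrite zv !inE eqxx orbT.
Qed.

End Counting.

(** * A program logic and the program *)

Section ProgramLogic.

Definition wp (p : program) (s : state) (Q : nat -> state -> Prop) : Prop :=
  exists t s', exec p s t s' /\ Q t s'.

Implicit Types (Q : nat -> state -> Prop) (s : state) (p q : program).

Lemma wp_const x m s Q : Q 1 (set_reg s x m) -> wp (Const x m) s Q.
Proof. by move=> h; do 2!eexists; split; [exact: exec_const|]. Qed.

Lemma wp_copy x y s Q : Q 1 (set_reg s x (regs s y)) -> wp (Copy x y) s Q.
Proof. by move=> h; do 2!eexists; split; [exact: exec_copy|]. Qed.

Lemma wp_succ x y s Q : Q 1 (set_reg s x (regs s y).+1) -> wp (Succ x y) s Q.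
Proof. by move=> h; do 2!eexists; split; [exact: exec_succ|]. Qed.

Lemma wp_pred x y s Q : Q 1 (set_reg s x (regs s y).-1) -> wp (Pred x y) s Q.
Proof. by move=> h; do 2!eexists; split; [exact: exec_pred|]. Qed.

Lemma wp_read x A y z s Q :
  Q 1 (set_reg s x (arrs s A (regs s y) (regs s z))) -> wp (Read x A y z) s Q.
Proof. by move=> h; do 2!eexists; split; [exact: exec_read|]. Qed.

Lemma wp_write A y z x s Q :
  Q 1 (set_cell s A (regs s y) (regs s z) (regs s x)) -> wp (Write A y z x) s Q.
Proof. by move=> h; do 2!eexists; split; [exact: exec_write|]. Qed.

Lemma wp_seq p q s Q :
  wp p s (fun t s' => wp q s' (fun t' => Q (t + t'))) -> wp (Seq p q) s Q.
Proof.
move=> [t [s' [h1 [t' [s'' [h2 h3]]]]]].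
by exists (t + t'), s''; split=> //; exact: exec_seq h1 h2.
Qed.

Lemma wp_if b p q s Q :
  (holds s b -> wp p s (fun t => Q t.+1)) ->
  (~~ holds s b -> wp q s (fun t => Q t.+1)) -> wp (If b p q) s Q.
Proof.
move=> h1 h2; case: (boolP (holds s b)) => hb.
  have [t [s' [e h]]] := h1 hb.
  by exists t.+1, s'; split=> //; exact: exec_if_true.
have [t [s' [e h]]] := h2 hb.
by exists t.+1, s'; split=> //; exact: exec_if_false.
Qed.

Lemma wp_conseq p s Q Q' : (forall t s', Q t s' -> Q' t s') -> wp p s Q -> wp p s Q'.
Proof. by move=> h [t [s' [h1 h2]]]; exists t, s'; split=> //; exact: h. Qed.

Fixpoint wregs p : seq reg :=
  match p with
  | Const x _ | Copy x _ | Succ x _ | Pred x _ | Read x _ _ _ => [:: x]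
  | Write _ _ _ _ => [::]
  | Seq p q | If _ p q => wregs p ++ wregs q
  | While _ p => wregs p
  end.

Definition agree p s s' : Prop := forall r, r \notin wregs p -> regs s' r = regs s r.

Lemma exec_agree p s t s' : exec p s t s' -> agree p s s'.
Proof.
elim=> {p s t s'}.
- by move=> x m s r /=; rewrite inE => /negbTE ->.
- by move=> x y s r /=; rewrite inE => /negbTE ->.
- by move=> x y s r /=; rewrite inE => /negbTE ->.
- by move=> x y s r /=; rewrite inE => /negbTE ->.
- by move=> x A y z s r /=; rewrite inE => /negbTE ->.
- by [].
- move=> p q s t1 s1 t2 s2 _ h1 _ h2 r /=; rewrite mem_cat negb_or => /andP[h h'].
  by rewrite h2 // h1.
- by move=> b p q s t s' _ _ h r /=; rewrite mem_cat negb_or => /andP[h1 h2]; apply: h.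
- by move=> b p q s t s' _ _ h r /=; rewrite mem_cat negb_or => /andP[h1 h2]; apply: h.
- by [].
- by move=> b p s t1 s1 t2 s2 _ _ h1 _ h2 r /= h; rewrite h2 // h1.
Qed.

Lemma wp_frame p s Q : wp p s Q -> wp p s (fun t s' => Q t s' /\ agree p s s').
Proof.
move=> [t [s' [h1 h2]]]; exists t, s'; split=> //; split=> //.
exact: exec_agree h1.
Qed.

(* [I i t s]: after [i] iterations, taking time [t] in total, the state is [s]. *)
Lemma wp_while (I : nat -> nat -> state -> Prop) N b p s :
  I 0 0 s ->
  (forall i t s', I i t s' -> agree p s s' -> holds s' b ->
     i < N /\ wp p s' (fun t' => I i.+1 (t + t'.+1))) ->
  wp (While b p) s (fun t s' => exists i t0,
     [/\ I i t0 s', ~~ holds s' b, agree p s s' & t = t0.+1]).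
Proof.
move=> I0 step.
suff H m : forall i t s', i + m = N.+1 -> I i t s' -> agree p s s' ->
    exists t' s'', exec (While b p) s' t' s'' /\ exists i t0,
     [/\ I i t0 s'', ~~ holds s'' b, agree p s s'' & t + t' = t0.+1].
  have [t [s' [h1 h2]]] := H N.+1 0 0 s (erefl _) I0 (fun _ _ => erefl _).
  by exists t, s'; split.
elim: m => [|m IH] i t s' Em Ii ag.
  case: (boolP (holds s' b)) => hb.
    by have [+ _] := step _ _ _ Ii ag hb; lia.
  exists 1, s'; split; first exact: exec_while_false.
  by exists i, t; split=> //; lia.
case: (boolP (holds s' b)) => hb; last first.
  exists 1, s'; split; first exact: exec_while_false.
  by exists i, t; split=> //; lia.
have [lt [t1 [s1 [e1 I1]]]] := step _ _ _ Ii ag hb.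
have ag1 : agree p s s1 by move=> r hr; rewrite (exec_agree e1) // ag.
have [|t' [s'' [e2 [i' [t0 [h1 h2 h3 h4]]]]]] := IH i.+1 (t + t1.+1) s1 _ I1 ag1.
  by lia.
exists (t1 + t').+1, s''; split; first exact: exec_while_true e2.
by exists i', t0; split=> //; lia.
Qed.

End ProgramLogic.

Notation "p ;; q" := (Seq p q) (at level 75, right associativity).

(** Register 29 is never read. *)
Definition skip := Const 29 0.

(* Matching on the head symbol keeps named pieces of code folded. *)
Ltac wstep := lazymatch goal with
  | |- wp (Seq _ _) _ _ => apply: wp_seq
  | |- wp (Const _ _) _ _ => apply: wp_const
  | |- wp skip _ _ => apply: wp_const
  | |- wp (Copy _ _) _ _ => apply: wp_copy
  | |- wp (Succ _ _) _ _ => apply: wp_succ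
  | |- wp (Pred _ _) _ _ => apply: wp_pred
  | |- wp (Read _ _ _ _) _ _ => apply: wp_read
  | |- wp (Write _ _ _ _) _ _ => apply: wp_write
  end; cbv beta.
Ltac wsteps := repeat wstep.

(* Registers: 6 holds [k], and 7, 8, 9 the constants 0, 1, 2; 10 and 11 are the
   head and the length of the queue; 12 is 0 during the search, 1 if the path to
   the vertex in 13 can be completed with the color in 22, 2 if the vertex in 23
   has been reached [b + 1] times, and 3 when the coloring is complete.
   Arrays: row [x] of 1 holds the parent of [x] plus 1, the code of the color of
   the edge to it, and the number of reaches of [x]; 2 is the queue; rows [x] of
   3 and 4 list the vertices and the colors of the reaches of [x]; row [a] of 5
   lists the colors missing at both [z] and its [a]-neighbor; 6 is a stack. *)
Definition move_code x y z a :=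
  Succ 19 x ;; Write 0 y a 19 ;; Succ 19 y ;; Write 0 x a 19 ;; Write 0 z a 7.

Definition assign_code x y a :=
  Succ 19 x ;; Write 0 y a 19 ;; Succ 19 y ;; Write 0 x a 19.

Definition init_code :=
  Const 7 0 ;; Const 8 1 ;; Const 9 2 ;; Copy 6 1 ;; Const 17 0 ;;
  While (Tlt 17 2) (Succ 6 6 ;; Succ 17 17) ;;
  Succ 19 4 ;; Write 1 4 7 19 ;; Write 1 5 7 19 ;; Write 2 7 7 5 ;;
  Const 10 0 ;; Const 11 1 ;; Const 12 0.

(** The count compared with [b] is the one before this reach. Register 18 holds the next color of
    the scan, so setting it to [k] ends the scan. *)
Definition reach_code :=
  Pred 20 19 ;; Read 21 1 20 9 ;; Write 3 20 21 13 ;; Write 4 20 21 17 ;;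
  Succ 19 21 ;; Write 1 20 9 19 ;; Read 19 1 20 7 ;;
  If (Teq 19 7)
    (Succ 19 13 ;; Write 1 20 7 19 ;; Write 1 20 8 18 ;; Write 2 11 7 20 ;;
     Succ 11 11)
    skip ;;
  If (Teq 21 3) (Const 12 2 ;; Copy 23 20 ;; Copy 18 6) skip.

Definition stop_code := Copy 22 17 ;; Const 12 1 ;; Copy 18 6.

(** Since cells hold colors plus 1, register 18 serves both as the code of the current color in
    comparisons and as the next value of the counter. *)
Definition scan_code :=
  Succ 18 17 ;; Read 19 0 14 17 ;;
  If (Teq 19 7) (Const 39 1) (If (Teq 18 16) (Const 39 1) (Const 39 0)) ;;
  If (Teq 39 8)
    (Read 19 0 13 17 ;;
     If (Teq 19 7) stop_code (If (Teq 18 15) stop_code reach_code))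
    skip ;;
  Copy 17 18.

Definition expand_code :=
  Read 13 2 10 7 ;; Read 14 1 13 7 ;; Pred 14 14 ;; Read 15 1 13 8 ;;
  Read 16 1 14 8 ;; Const 17 0 ;; While (Tlt 17 6) scan_code ;; Succ 10 10.

Definition search_code := While (Teq 12 7) expand_code.

Definition push_code :=
  Write 6 24 7 25 ;; Succ 24 24 ;; Read 25 1 25 7 ;; Pred 25 25 ;; Read 28 1 25 8.

Definition pop_code :=
  Pred 24 24 ;; Read 25 6 24 7 ;; Write 6 24 7 7 ;; Read 28 1 25 8 ;;
  Pred 28 28 ;; move_code 26 27 25 28 ;; Copy 26 27 ;; Copy 27 25.

(** A shift starts at the root, but parents are followed from the other end; hence the stack.
    Popping also resets its cells to 0. *)
Definition path_code :=
  Const 24 0 ;; Copy 25 13 ;; Read 28 1 25 8 ;; While (Tlt 7 28) push_code ;;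
  Copy 26 4 ;; Copy 27 5 ;; While (Tlt 7 24) pop_code.

Definition unshift_step :=
  Pred 28 28 ;; Read 27 1 25 7 ;; Pred 27 27 ;; Read 26 1 27 7 ;; Pred 26 26 ;;
  move_code 25 27 26 28 ;; Copy 25 27 ;; Read 28 1 25 8.

(** Undoing starts at the end of the path, so following the parents suffices; array 1 still has the
    original colors. *)
Definition unshift_code :=
  Copy 25 13 ;; Read 28 1 25 8 ;; While (Tlt 7 28) unshift_step.

Definition common_step :=
  Succ 38 34 ;; Read 19 0 23 34 ;;
  If (Teq 19 7)
    (Read 19 0 32 34 ;;
     If (Teq 19 7) (Write 5 30 33 38 ;; Succ 33 33) skip)
    skip ;;
  Copy 34 38.

Definition common_row :=
  Read 32 0 23 30 ;;
  If (Tlt 7 32)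
    (Pred 32 32 ;; Const 33 0 ;; Const 34 0 ;; While (Tlt 34 6) common_step)
    skip ;;
  Succ 30 30.

(** The table costs a quadratic time in [k] once; afterwards every pair of a reach and a color is
    tested in constant time. *)
Definition common_code := Const 30 0 ;; While (Tlt 30 6) common_row.

(** The first test skips the remaining candidates after a success, and register 31, the next color,
    is then set to [k] to end the loop over the colors. *)
Definition try_code g :=
  If (Teq 12 9)
    (Read 19 0 23 g ;;
     If (Teq 19 7)
       (Read 19 0 32 g ;;
        If (Teq 19 7)
          (move_code 13 23 32 30 ;; assign_code 23 32 g ;; Const 12 3 ;; Copy 31 6)
          skip)
       skip)
    skip.

Definition candidate_code i :=
  Read 38 5 30 i ;; If (Tlt 7 38) (Pred 38 38 ;; try_code 38) skip.

Definition check_code x y :=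
  Read 19 1 x 7 ;; Succ 38 y ;;
  If (Teq 19 38) (Read 19 1 x 8 ;; If (Teq 19 31) skip (Const 37 0)) skip.

(* Skips the edge between [z] and its neighbor if it is a tree edge whose color
   has been changed by the shift. *)
Definition offpath_code := Const 37 1 ;; check_code 32 23 ;; check_code 23 32.

Definition test_code :=
  Read 32 0 23 30 ;;
  If (Teq 32 7)
    (assign_code 13 23 30 ;; Const 12 3 ;; Copy 31 6)
    (Pred 32 32 ;; offpath_code ;;
     If (Teq 37 8)
       (try_code 36 ;; candidate_code 7 ;; candidate_code 8 ;; candidate_code 9)
       skip).

Definition color_step :=
  Succ 31 30 ;; Read 19 0 13 30 ;; If (Teq 19 7) test_code skip ;; Copy 30 31.

Definition attempt_code :=
  Read 13 3 23 35 ;; Read 36 4 23 35 ;; path_code ;; move_code 26 13 23 36 ;;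
  Const 30 0 ;; While (Tlt 30 6) color_step ;;
  If (Teq 12 9) (move_code 23 13 26 36 ;; unshift_code) skip ;;
  Succ 35 35.

Definition finish_code :=
  common_code ;; Const 35 0 ;; While (Teq 12 9) attempt_code.

Definition clear_step :=
  Pred 21 21 ;; Write 1 40 9 21 ;; Write 3 40 21 7 ;; Write 4 40 21 7.

Definition clear_vertex :=
  Read 21 1 40 9 ;; While (Tlt 7 21) clear_step ;;
  Write 1 40 7 7 ;; Write 1 40 8 7.

Definition clear_tree_step :=
  Pred 11 11 ;; Read 40 2 11 7 ;; Write 2 11 7 7 ;; clear_vertex.

Definition clear_row :=
  Const 34 0 ;; While (Tlt 34 6) (Write 5 30 34 7 ;; Succ 34 34) ;; Succ 30 30.

(** [u] has a row in the arrays and may have been reached, but it is never in the queue. *)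
Definition cleanup_code :=
  Copy 40 4 ;; clear_vertex ;; While (Tlt 7 11) clear_tree_step ;;
  Const 30 0 ;; While (Tlt 30 6) clear_row.

Definition insertion_program :=
  init_code ;; search_code ;;
  If (Teq 12 8) (path_code ;; assign_code 26 27 22) finish_code ;;
  cleanup_code.

(** * Contents of the memory during an insertion *)

Section Memory.
Variables (n k : nat) (c : coloring n k).

(** Array 0 follows the current coloring [cc], whereas the stored tree refers to the original [c]:
    shifting leaves the tree intact. Every other cell is specified as zero, which is what makes the
    final cleanup provable. *)
Definition memory (cc : coloring n k) (tq : seq 'I_n) (pth : 'I_n -> seq 'I_n)
    (trch : 'I_n -> seq ('I_n * 'I_k)) (F : nat -> nat -> nat) (S : seq nat)
    (A i j : nat) : nat :=
  match A with
  | 0 => incidence_table cc i j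
  | 1 => if (insub i : option 'I_n) is Some x then
           match j with
           | 0 => if pth x is [::] then 0 else (parent pth x).+1
           | 1 => ocode (c [set parent pth x; x])
           | 2 => size (trch x)
           | _ => 0
           end
         else 0
  | 2 => if j == 0 then nth 0 [seq val x | x <- tq] i else 0
  | 3 => if (insub i : option 'I_n) is Some x
         then nth 0 [seq val p.1 | p <- trch x] j else 0
  | 4 => if (insub i : option 'I_n) is Some x
         then nth 0 [seq val p.2 | p <- trch x] j else 0
  | 5 => F i j
  | 6 => if j == 0 then nth 0 S i else 0
  | _ => 0
  end.

Definition has_memory cc tq pth trch F S (s : state) : Prop :=
  forall A i j, arrs s A i j = memory cc tq pth trch F S A i j.

Section Read.
Variables (cc : coloring n k) (tq : seq 'I_n) (pth : 'I_n -> seq 'I_n)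
  (trch : 'I_n -> seq ('I_n * 'I_k)) (F : nat -> nat -> nat) (S : seq nat) (s : state).
Hypothesis H : has_memory cc tq pth trch F S s.

Lemma mem_table (x : 'I_n) (a : 'I_k) : arrs s 0 x a = ocode (nbr cc x a).
Proof. by rewrite H /= incidence_tableE. Qed.

Lemma mem_parent (x : 'I_n) :
  arrs s 1 x 0 = if pth x is [::] then 0 else (parent pth x).+1.
Proof. by rewrite H /= valK. Qed.

Lemma mem_pcolor (x : 'I_n) : arrs s 1 x 1 = ocode (c [set parent pth x; x]).
Proof. by rewrite H /= valK. Qed.

Lemma mem_count (x : 'I_n) : arrs s 1 x 2 = size (trch x).
Proof. by rewrite H /= valK. Qed.

Lemma mem_queue i : arrs s 2 i 0 = nth 0 [seq val x | x <- tq] i.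
Proof. by rewrite H. Qed.

Lemma mem_reach (x : 'I_n) j : arrs s 3 x j = nth 0 [seq val p.1 | p <- trch x] j.
Proof. by rewrite H /= valK. Qed.

Lemma mem_reachc (x : 'I_n) j : arrs s 4 x j = nth 0 [seq val p.2 | p <- trch x] j.
Proof. by rewrite H /= valK. Qed.

Lemma mem_stack i : arrs s 6 i 0 = nth 0 S i.
Proof. by rewrite H. Qed.

End Read.

Lemma cell_table cc (f : nat -> nat -> nat) :
  (forall (x : 'I_n) (a : 'I_k), f x a = ocode (nbr cc x a)) ->
  (forall i j, n <= i -> f i j = 0) -> (forall i j, k <= j -> f i j = 0) ->
  forall i j, f i j = incidence_table cc i j.
Proof.
move=> h1 h2 h3 i j; case: (ltnP i n) => ni; last by rewrite h2 // incidence_table_out1.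
case: (ltnP j k) => nj; last by rewrite h3 // incidence_table_out2.
by rewrite -[i]/(nat_of_ord (Ordinal ni)) -[j]/(nat_of_ord (Ordinal nj)) h1 incidence_tableE.
Qed.

End Memory.

(** * Invariants of the search *)

Section SearchInvariant.
Variables (n k : nat) (c : coloring n k) (u v : 'I_n).
Hypothesis wfc : wf_coloring c.
Hypothesis cuv : c [set u; v] = None.
Hypothesis nuv : u != v.

Lemma vpath_ext (par par' : 'I_n -> 'I_n) s :
  (forall x, x \in behead s -> par' x = par x) ->
  vpath c u v par s -> vpath c u v par' s.
Proof.
move=> h H; elim: H h => {s} [|z p q r a H IH U Eq nzq E Av] h; first exact: vpath_root.
apply: (vpath_cons (a := a)) => //.
- by apply: IH => x hx; apply: h; rewrite /= inE hx orbT.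
- by rewrite h //= inE eqxx.
- by rewrite /avail h //= !inE eqxx orbT.
Qed.

Definition visit (tq : seq 'I_n) (z : 'I_n) : seq 'I_n :=
  if z \in u :: tq then tq else rcons tq z.

Definition visit_path (tq : seq 'I_n) (pth : 'I_n -> seq 'I_n) (w z : 'I_n) :=
  if z \in u :: tq then pth else fun x => if x == z then z :: pth w else pth x.

Definition add_reach (trch : 'I_n -> seq ('I_n * 'I_k)) (w : 'I_n) (f : 'I_k) (z : 'I_n) :=
  fun x => if x == z then rcons (trch z) (w, f) else trch x.

Section Visit.
Variables (tq : seq 'I_n) (pth : 'I_n -> seq 'I_n) (w z : 'I_n) (f : 'I_k).
Hypothesis ST : search_tree c u v tq pth.
Hypothesis wT : w \in tq.
Hypothesis cwz : c [set w; z] = Some f.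
Hypothesis av : avail c (parent pth) (parent pth w) f.

Let pth' := visit_path tq pth w z.
Let tq' := visit tq z.

Lemma visit_pathE x : x \in u :: tq -> pth' x = pth x.
Proof.
move=> xT; rewrite /pth' /visit_path; case: (boolP (z \in u :: tq)) => // zN.
by case: eqP => // E; rewrite -E xT in zN.
Qed.

Lemma visit_parentE x : x \in u :: tq -> parent pth' x = parent pth x.
Proof. by move=> xT; rewrite /parent visit_pathE. Qed.

Lemma visit_new : z \notin u :: tq -> pth' z = z :: pth w /\ parent pth' z = w.
Proof.
move=> zN; have [r E] := pth_shape ST wT.
by rewrite /parent /pth' /visit_path (negbTE zN) eqxx E.
Qed.

Lemma mem_visit x : (x \in tq') = (x \in tq) || ((x == z) && (z \notin u :: tq)).
Proof.
rewrite /tq' /visit; case: ifP => h; first by rewrite andbF orbF.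
by rewrite mem_rcons inE andbT orbC.
Qed.

Lemma visit_avail x : x \in u :: tq -> avail c (parent pth') x =1 avail c (parent pth) x.
Proof. by move=> xT a; rewrite /avail visit_parentE. Qed.

Lemma parent_in x : x \in u :: tq -> parent pth x \in u :: tq.
Proof.
rewrite inE => /orP[/eqP ->|xT]; first by rewrite (par_u ST) inE eqxx.
case: (eqVneq x v) => [->|nv]; first by rewrite (par_v ST) inE eqxx.
by rewrite inE (st_par ST xT nv) orbT.
Qed.

Lemma pth_in x y : x \in u :: tq -> y \in pth x -> y \in u :: tq.
Proof.
rewrite inE => /orP[/eqP ->|]; last exact: (st_sub ST).
by rewrite (st_u ST) !inE => ->.
Qed.

Lemma visit_tree : search_tree c u v tq' pth'.
Proof.
case: (boolP (z \in u :: tq)) => zV.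
  by rewrite /tq' /pth' /visit /visit_path zV.
have [Ez Pz] := visit_new zV.
have uT : u \in u :: tq by rewrite inE eqxx.
have vT : v \in u :: tq by rewrite inE (st_vT ST) orbT.
have wV : w \in u :: tq by rewrite inE wT orbT.
have tq'P x : x \in tq' -> x \in tq \/ x = z.
  by rewrite mem_visit => /orP[|/andP[/eqP]]; auto.
have tqV x : x \in tq -> x \in u :: tq by rewrite inE => ->; rewrite orbT.
have zw : z \notin pth w by apply: contra zV; exact: pth_in.
have pz x : x \in u :: tq -> x != z by apply: contraTneq => ->.
split.
- by rewrite visit_pathE // (st_u ST).
- by rewrite visit_pathE // (st_v ST).
- by rewrite mem_visit (negbTE (st_uN ST)) /= (negbTE (pz _ uT)).
- by rewrite mem_visit (st_vT ST).
- move=> x; rewrite mem_visit negb_or zV andbT => /andP[h1 h2] nu.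
  by rewrite /pth' /visit_path (negbTE zV) (negbTE h2) (st_out ST).
- move=> x /tq'P [xT|->].
    by rewrite visit_parentE ?tqV // !visit_pathE ?parent_in ?tqV // (st_cons ST xT).
  by rewrite Pz Ez visit_pathE ?tqV.
- move=> x /tq'P [xT nv|-> _].
    by rewrite visit_parentE ?tqV // mem_visit (st_par ST).
  by rewrite Pz mem_visit wT.
- move=> x /tq'P [xT|->]; first by rewrite visit_pathE ?tqV // (st_uniq ST).
  by rewrite Ez /= zw (st_uniq ST wT).
- move=> x /tq'P [xT|->].
    rewrite visit_pathE ?tqV //; apply: vpath_ext (st_path ST xT) => y hy.
    apply: visit_parentE; apply: pth_in (mem_behead hy); exact: tqV.
  rewrite Ez; apply: vpath_ext (vpath_reach wfc cuv ST wT cwz av) => y /= hy.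
  by apply: visit_parentE; apply: pth_in hy.
- move=> x y /tq'P [xT|->].
    rewrite visit_pathE ?tqV // => /(st_sub ST xT); rewrite !inE mem_visit.
    by case/orP => ->; rewrite ?orbT.
  rewrite Ez !inE mem_visit zV andbT => /orP[->|]; first by rewrite !orbT.
  by move/(st_sub ST wT); rewrite inE => /orP[] ->; rewrite ?orbT.
Qed.

End Visit.

(** The first [hd] vertices of the queue have been expanded, and for the next one the colors below
    [f0] have been scanned. [si_exp] is the completeness behind the growth of the levels,
    [si_sorted] to [si_dmax] say that the search is breadth-first, and the last two fields bound the
    cost of the cleanup. *)
Record search_inv (tq : seq 'I_n) (pth : 'I_n -> seq 'I_n)
    (trch : 'I_n -> seq ('I_n * 'I_k)) (hd f0 : nat) : Prop := SearchInv {
  si_tree : search_tree c u v tq pth;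
  si_tq : uniq tq /\ index v tq = 0;
  si_reach : forall z w f, (w, f) \in trch z -> [/\ w \in tq, c [set w; z] = Some f,
     avail c (parent pth) (parent pth w) f &
     index w tq < hd \/ (index w tq = hd /\ f < f0)];
  si_vis : forall z w f, (w, f) \in trch z -> z \in u :: tq;
  si_uniq : forall z, uniq [seq p.1 | p <- trch z];
  si_first : forall z, z \in tq -> z != v -> exists f, (parent pth z, f) \in trch z;
  si_exp : forall w f, w \in tq -> avail c (parent pth) (parent pth w) f ->
     index w tq < hd \/ (index w tq = hd /\ f < f0) -> exists z, (w, f) \in trch z;
  si_sorted : sorted leq [seq size (pth x) | x <- tq];
  si_pidx : forall y, y \in tq -> y != v -> index (parent pth y) tq <= hd;
  si_depth : forall z w f, (w, f) \in trch z -> size (pth z) <= (size (pth w)).+1;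
  si_dmax : forall y w, y \in tq -> w \in tq -> hd <= index w tq ->
     size (pth y) <= (size (pth w)).+1;
  si_count : \sum_(z : 'I_n) size (trch z) <= hd * k + f0;
  si_size : size tq <= (hd * k + f0).+1
}.

Lemma init_inv :
  search_inv [:: v] (fun x => if x == v then [:: v; u] else if x == u then [:: u] else [::])
    (fun _ => [::]) 0 0.
Proof.
have nvu : (v == u) = false by rewrite eq_sym (negbTE nuv).
have nuv' : (u == v) = false by rewrite (negbTE nuv).
split=> //.
- split; rewrite ?eqxx ?nuv' ?inE //.
  + by move=> x; rewrite inE => /negbTE -> /negbTE ->.
  + by move=> x; rewrite inE => /eqP ->; rewrite /parent eqxx /= nuv' eqxx.
  + by move=> x; rewrite inE => /eqP ->; rewrite eqxx.
  + by move=> x; rewrite inE => /eqP ->; rewrite eqxx /= inE nvu.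
  + move=> x; rewrite inE => /eqP ->; rewrite eqxx; exact: vpath_root.
  + move=> x y; rewrite inE => /eqP ->; rewrite eqxx !inE orbC //.
- by rewrite /= eqxx.
- by move=> z; rewrite inE => /eqP ->; rewrite eqxx.
- by move=> w f; rewrite inE => /eqP -> _ /=; rewrite eqxx; case=> // -[_].
- by move=> y; rewrite inE => /eqP ->; rewrite eqxx.
- by move=> y w; rewrite !inE => /eqP -> /eqP -> _; rewrite eqxx.
- by rewrite big1.
Qed.

Section Steps.
Variables (tq : seq 'I_n) (pth : 'I_n -> seq 'I_n) (trch : 'I_n -> seq ('I_n * 'I_k)).
Variables (hd f0 : nat).
Hypothesis SI : search_inv tq pth trch hd f0.

Lemma next_inv : f0 = k -> search_inv tq pth trch hd.+1 0.
Proof.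
move=> Ef; case: SI => h1 h2 h3 h4 h5 h6 h7 h8 h9 h10 h11 h12 h13; split=> //.
- move=> z w f /h3 [g1 g2 g3 g4]; split=> //; left.
  by case: g4 => [g|[-> _]] //; rewrite ltnS ltnW.
- move=> w f wT av hw; apply: h7 => //.
  case: hw => [|[_ //]]; rewrite ltnS leq_eqVlt => /orP[/eqP ->|]; [right|by left].
  by rewrite Ef.
- by move=> y yT nv; apply: leqW; exact: h9.
- by move=> y w yT wT hw; apply: h11 => //; exact: ltnW.
- by rewrite mulSn addn0 addnC; move: h12; rewrite Ef.
- by rewrite mulSn addn0 addnC; move: h13; rewrite Ef.
Qed.

Variables (w : 'I_n) (f : 'I_k).
Hypothesis wT : w \in tq.
Hypothesis Ew : index w tq = hd.
Hypothesis Ef : f0 = f :> nat.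

Let index_inj x : x \in tq -> index x tq = hd -> x = w.
Proof. by move=> xT E; rewrite -(nth_index u xT) E -Ew nth_index. Qed.

Lemma skip_inv : ~~ avail c (parent pth) (parent pth w) f -> search_inv tq pth trch hd f0.+1.
Proof.
move=> nav; case: SI => h1 h2 h3 h4 h5 h6 h7 h8 h9 h10 h11 h12 h13; split=> //.
- move=> z x g /h3 [g1 g2 g3 g4]; split=> //.
  by case: g4 => [|[g5 g6]]; [left|right; split=> //; exact: ltnW].
- move=> x g xT av; case=> [|[g5]]; first by move=> g5; apply: h7 => //; left.
  rewrite ltnS leq_eqVlt => /orP[/eqP Eg|g6]; last by apply: h7 => //; right.
  have Egf : g = f by apply: val_inj; rewrite /= Eg Ef.
  by move: nav; rewrite -(index_inj xT g5) -Egf av.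
- by rewrite addnS leqW.
- by rewrite addnS leqW.
Qed.

Variable z : 'I_n.
Hypothesis cwz : c [set w; z] = Some f.
Hypothesis av : avail c (parent pth) (parent pth w) f.

Lemma reach_inv : search_inv (visit tq z) (visit_path tq pth w z) (add_reach trch w f z) hd f0.+1.
Proof.
case: (SI) => h1 [h2 h2'] h3 h4 h5 h6 h7 h8 h9 h10 h11 h12 h13.
have tqV x : x \in tq -> x \in u :: tq by rewrite inE => ->; rewrite orbT.
have PE x : x \in u :: tq -> visit_path tq pth w z x = pth x by exact: visit_pathE.
have RE x : x \in u :: tq -> parent (visit_path tq pth w z) x = parent pth x.
  exact: visit_parentE.
have idx x : x \in tq -> index x (visit tq z) = index x tq.
  by move=> xT; rewrite /visit; case: ifP => // _; rewrite -cats1 index_cat xT.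
have memv x : x \in tq -> x \in visit tq z by rewrite mem_visit => ->.
have av' x a : x \in u :: tq ->
    avail c (parent (visit_path tq pth w z)) (parent (visit_path tq pth w z) x) a =
    avail c (parent pth) (parent pth x) a.
  by move=> xT; rewrite RE //; apply: visit_avail; exact: (parent_in h1).
have rin x g y : ((x, g) \in add_reach trch w f z y) =
    ((x, g) \in trch y) || [&& y == z, x == w & g == f].
  rewrite /add_reach; case: (eqVneq y z) => [->|_]; last by rewrite orbF.
  by rewrite mem_rcons inE orbC.
have newin x : x \in visit tq z -> x \in tq \/ (x = z /\ z \notin u :: tq).
  by rewrite mem_visit => /orP[|/andP[/eqP]]; auto.
have wd (zN : z \notin u :: tq) := visit_new h1 wT zN.
split.
- exact: (visit_tree h1 wT cwz av).
- split; last by rewrite idx ?(st_vT h1).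
  rewrite /visit; case: ifP => // zN; rewrite rcons_uniq h2 andbT.
  by move: zN; rewrite inE => /negbT; rewrite negb_or => /andP[].
- move=> y x g; rewrite rin => /orP[/h3 [g1 g2 g3 g4]|/and3P[/eqP -> /eqP -> /eqP ->]].
    split=> //; [exact: memv|by rewrite av' ?tqV|rewrite idx //].
    by case: g4 => [|[g5 g6]]; [left|right; split=> //; exact: ltnW].
  split=> //; [exact: memv|by rewrite av' ?tqV|rewrite idx //; right].
  by rewrite Ew Ef.
- move=> y x g; rewrite rin => /orP[/h4|/and3P[/eqP -> _ _]].
    by rewrite !inE mem_visit => /orP[] ->; rewrite ?orbT.
  rewrite inE mem_visit eqxx /= inE negb_or orbA.
  by case: (z == u); case: (z \in tq).
(* A second reach of [z] from [w] would have the same color [f], that of the edge [wz], and only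
   colors before [f] have been scanned. *)
- move=> y; rewrite /add_reach; case: eqP => [_|//].
  rewrite map_rcons rcons_uniq h5 andbT; apply/negP => /mapP [[x g] xg /= Ex].
  have [g1 g2 g3 g4] := h3 _ _ _ xg.
  rewrite -Ex in g2 g4; have := cwz; rewrite g2 => -[Eg].
  by rewrite Ew Ef Eg in g4; case: g4 => [|[_]]; rewrite ltnn.
- move=> y /newin [yT nv|[-> zN] nv].
    have [g hg] := h6 y yT nv; exists g; rewrite RE ?tqV // rin hg //.
  exists f; rewrite (wd zN).2 rin !eqxx orbT //.
(* A new vertex stands at the end of the queue, after position [hd], so nothing is claimed about its
   reaches yet. *)
- move=> x g /newin [xT|[-> zN]]; last first.
    rewrite (wd zN).2 => _; rewrite /visit (negbTE zN) -cats1 index_cat.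
    have -> : z \in tq = false by move: zN; rewrite inE negb_or => /andP[_ /negbTE].
    rewrite /= eqxx addn0 => hz; move: (wT); rewrite -index_mem Ew => lt.
    exfalso; case: hz => [h|[h _]]; first by move: (ltn_trans lt h); rewrite ltnn.
    by move: (leq_trans lt (eq_leq h)); rewrite ltnn.
  rewrite av' ?tqV // idx // => ava; case=> [g1|[g1]].
    by have [y hy] := h7 x g xT ava (or_introl g1); exists y; rewrite rin hy.
  rewrite ltnS leq_eqVlt => /orP[/eqP Eg|g2].
    have Egf : g = f by apply: val_inj; rewrite /= Eg Ef.
    by exists z; rewrite rin (index_inj xT g1) Egf !eqxx orbT.
  by have [y hy] := h7 x g xT ava (or_intror (conj g1 g2)); exists y; rewrite rin hy.
- rewrite /visit; case: (boolP (z \in u :: tq)) => zN.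
    by rewrite /visit_path zN.
  rewrite map_rcons (eq_in_map _ (fun x => size (pth x)) tq).1; last first.
    by move=> x xT; rewrite PE ?tqV.
  rewrite (wd zN).1 /=.
  have h11' y : y \in tq -> size (pth y) <= (size (pth w)).+1.
    by move=> yT; apply: h11; rewrite ?Ew.
  move: h8 h11'; case: (tq) => // x0 q h8 h11'.
  rewrite /= rcons_path; move: h8 => /= -> /=.
  have -> : last (size (pth x0)) [seq size (pth x) | x <- q] = size (pth (last x0 q)).
    exact: (last_map (fun x => size (pth x)) q x0).
  by apply: h11'; exact: mem_last.
- move=> y /newin [yT nv|[-> zN] nv].
    by rewrite RE ?tqV // idx ?h9 // (st_par h1).
  by rewrite (wd zN).2 idx // Ew.
- move=> y x g; rewrite rin => /orP[h|/and3P[/eqP -> /eqP -> _]].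
    have [g1 _ _ _] := h3 _ _ _ h; rewrite (PE y (h4 _ _ _ h)) (PE x (tqV _ g1)).
    exact: h10 h.
  rewrite (PE w (tqV _ wT)).
  case: (boolP (z \in u :: tq)) => zN; last by rewrite (wd zN).1.
  rewrite PE //; move: zN; rewrite inE => /orP[/eqP ->|zT]; last by apply: h11; rewrite ?Ew.
  by rewrite (st_u h1).
- move=> y x /newin [yT|[-> zN]] /newin [xT|[-> zN']].
  + by rewrite (PE y (tqV _ yT)) (PE x (tqV _ xT)) idx //; exact: h11.
  + rewrite (PE y (tqV _ yT)) (wd zN').1 => _ /=; apply: leqW; apply: h11 => //; by rewrite Ew.
  + rewrite idx // => hx; rewrite (wd zN).1 (PE x (tqV _ xT)) /= ltnS.
    have : size (pth (nth u tq hd)) <= size (pth (nth u tq (index x tq))).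
      have srt : sorted leq [seq size (pth t) | t <- tq] by [].
      have ix : index x tq < size tq by rewrite index_mem.
      have := sorted_leq_nth leq_trans leqnn 0 srt hd (index x tq).
      rewrite !inE !size_map => /(_ (leq_ltn_trans hx ix) ix hx).
      by rewrite !(nth_map u) // (leq_ltn_trans hx ix).
    by rewrite -{1}Ew !nth_index.
  + by move=> _; rewrite leqnSn.
- rewrite addnS (bigD1 z) //= {1}/add_reach eqxx size_rcons addSn ltnS.
  apply: leq_trans h12; rewrite [X in _ <= X](bigD1 z) //= leq_add2l.
  by apply: leq_sum => y /negbTE ny; rewrite /add_reach ny.
- rewrite addnS /visit; case: ifP => _; first exact: leqW.
  by rewrite size_rcons.
Qed.

End Steps.

(** * Growth of the levels and depth of the tree *)

Section Growth.
Variables (tq : seq 'I_n) (pth : 'I_n -> seq 'I_n) (trch : 'I_n -> seq ('I_n * 'I_k)).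
Variables (hd f0 b C : nat).
Hypothesis SI : search_inv tq pth trch hd f0.
Hypothesis bC : b <= C.
Hypothesis hav : forall x, x \in u :: tq -> C < #|[set a | avail c (parent pth) x a]|.
Notation par := (parent pth).

Lemma tree_in x : x \in tq -> x \in u :: tq.
Proof. by rewrite inE => ->; rewrite orbT. Qed.

(** Double counting of reaches: an expanded vertex makes one for each color available at its parent,
    hence more than [C], and each target receives at most [b]. *)
Lemma card_expanded (X Z : {set 'I_n}) :
  (forall w, w \in X -> w \in tq /\ index w tq < hd) ->
  (forall w f z, w \in X -> (w, f) \in trch z -> z \in Z) ->
  (forall z, size (trch z) <= b) -> #|X| * C.+1 <= #|Z| * b.
Proof.
move=> hX hZ hb.
apply: (@leq_trans (\sum_(w in X) \sum_(f | avail c par (par w) f) 1)).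
  rewrite -sum_nat_const; apply: leq_sum => w /hX [wT _].
  have := hav (parent_in (si_tree SI) (tree_in wT)); rewrite -sum1_card => h.
  by apply: leq_trans h _; apply: eq_leq; apply: eq_bigl => f; rewrite inE.
rewrite pair_big_dep /=.
apply: (@leq_trans (\sum_(p | (p.1 \in X) && avail c par (par p.1) p.2)
    \sum_(z in Z) (p \in trch z))).
  apply: leq_sum => -[w f] /= /andP[wX av].
  have [wT wi] := hX w wX.
  have [z hz] := si_exp SI wT av (or_introl wi).
  by rewrite (bigD1 z) ?(hZ w f) //= hz.
rewrite exchange_big /= -sum_nat_const; apply: leq_sum => z _.
apply: leq_trans (hb z); apply: leq_trans (card_size (trch z)).
rewrite -sum1_card [X in _ <= X]big_mkcond [X in X <= _]big_mkcond /=.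
apply: leq_sum => p _; by case: ifP => // _; case: (p \in trch z).
Qed.

(** A path contains [v] and [u], so a size of at most [i.+2] means a distance of at most [i] from
    [v] in the tree. *)
Definition level i : nat := #|[set x in tq | size (pth x) <= i.+2]|.

(** Once [v] is expanded, the more than [C] colors available at [u] lead from [v] to distinct
    vertices, none of which is [u] because [uv] is uncolored. *)
Lemma level1 : 0 < hd -> C.+2 <= level 1.
Proof.
move=> h; have ST := si_tree SI.
have vT := st_vT ST; have uV : u \in u :: tq by rewrite inE eqxx.
pose nb f := odflt v (nbr c v f).
pose A := [set a | avail c par u a].
have nbA f : f \in A -> exists z, [/\ nb f = z, (v, f) \in trch z & c [set v; z] = Some f].
  rewrite inE => av; have [||z hz] := si_exp SI vT (f := f); rewrite ?(par_v ST) //.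
    by left; rewrite (si_tq SI).2.
  have [_ E _ _] := si_reach SI hz.
  by exists z; rewrite /nb (some_nbr wfc E).
have sub : v |: nb @: A \subset [set x in tq | size (pth x) <= 3].
  apply/subsetP => x; rewrite in_setU1 => /orP[/eqP ->|/imsetP [f /nbA [z [E1 E2 E3]] ->]].
    by rewrite inE vT (st_v ST).
  rewrite inE E1; have := si_depth SI E2; rewrite (st_v ST) => ->; rewrite andbT.
  have := si_vis SI E2; rewrite inE => /orP[/eqP Eu|//].
  by move: E3; rewrite Eu colorC cuv.
apply: leq_trans (subset_leq_card sub).
rewrite cardsU1 card_in_imset; last first.
  move=> f g /nbA [z [E1 _ E2]] /nbA [z' [E1' _ E2']].
  by rewrite E1 E1' => Ez; move: E2; rewrite Ez E2' => -[].
have -> : v \notin nb @: A.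
  apply/imsetP => -[f /nbA [z [E1 _ E2]] E]; move: E2.
  by rewrite -E1 -E wf_loop.
by have := hav uV; rewrite -/A ltnS.
Qed.

Lemma level_n i : level i <= n.
Proof. by rewrite -[X in _ <= X](card_ord n); exact: max_card. Qed.

(** If all of the visited set [X] were expanded, the reaches would give
    [#|X| * C.+1 <= #|X|.+1 * b], the extra target being [u]. As [b <= C], this forces [#|X| <= C],
    against [level1]. *)
Lemma not_exhausted : (forall z, size (trch z) <= b) -> hd < size tq \/ size tq < hd.
Proof.
move=> hb; case: (ltngtP hd (size tq)) => [h|h|E]; [by left|by right|exfalso].
have ST := si_tree SI.
have hd0 : 0 < hd by rewrite E; case: tq (st_vT ST).
have h1 := level1 hd0.
pose X := [set x in tq].
have h2 : level 1 <= #|X|.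
  by apply: subset_leq_card; apply/subsetP => x; rewrite !inE => /andP[].
have h3 : #|X| * C.+1 <= #|u |: X| * b.
  apply: card_expanded => //.
    by move=> w; rewrite inE => wT; split=> //; rewrite E index_mem.
  move=> w f z _ /(si_vis SI); rewrite !inE //.
have h4 : #|u |: X| <= #|X|.+1 by rewrite cardsU1; case: (u \notin X).
have h5 : #|u |: X| * b <= #|X|.+1 * C by exact: leq_mul.
by move: (leq_trans h3 h5) (leq_trans h1 h2); move: #|X|; lia.
Qed.

Lemma index_lt x y : x \in tq -> y \in tq -> size (pth x) < size (pth y) ->
  index x tq < index y tq.
Proof.
move=> xT yT; apply: contraTT; rewrite -!leqNgt => h.
have ix : index x tq < size tq by rewrite index_mem.
have := sorted_leq_nth leq_trans leqnn 0 (si_sorted SI) (index y tq) (index x tq).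
rewrite !inE !size_map => /(_ (leq_ltn_trans h ix) ix h).
by rewrite !(nth_map u) ?(leq_ltn_trans h ix) // !nth_index.
Qed.

Section Deep.
Variables (y : 'I_n) (d : nat).
Hypothesis yT : y \in tq.
Hypothesis yd : size (pth y) = d.+2.

Lemma expanded_below x : x \in tq -> size (pth x) <= d -> index x tq < hd.
Proof.
move=> xT xd; have ST := si_tree SI.
have xs : 1 < size (pth x) by have [r ->] := pth_shape ST xT.
have nv : y != v by apply/eqP => Ev; move: yd; rewrite Ev (st_v ST) => -[]; lia.
apply: leq_trans (si_pidx SI yT nv); apply: index_lt => //; first exact: (st_par ST).
by move: yd; rewrite (st_cons ST yT) /= => -[->].
Qed.

Lemma level_step i : (forall z, size (trch z) <= b) -> i.+2 <= d ->
  level i * C.+1 <= (level i.+1).+1 * b.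
Proof.
move=> hb' hi; apply: leq_trans (_ : #|u |: [set x in tq | size (pth x) <= i.+3]| * b <= _).
  apply: card_expanded => //.
    move=> w; rewrite inE => /andP[wT wd]; split=> //; apply: expanded_below => //.
    exact: leq_trans wd hi.
  move=> w f z; rewrite !inE => /andP[wT wd] hz.
  have := si_vis SI hz; rewrite inE => /orP[->//|->]; rewrite orbC /=.
  by rewrite (leq_trans (si_depth SI hz)) // ltnS.
by rewrite leq_mul2r cardsU1; case: (u \notin _); rewrite ?leqnn ?leqnSn orbT.
Qed.

(** The vertex [y] is at distance [d] from [v]. Its parent is at or before the head of the queue, so
    everything at distance at most [d - 2] has been expanded; starting from level 1 this gives
    [d - 2] growth factors. *)
Lemma depth_bound : (forall z, size (trch z) <= b) -> C.+1 ^ (d - 2) <= n * b ^ (d - 2).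
Proof.
move=> hb'; case: (leqP 2 d) => hd2; last first.
  have -> : d - 2 = 0 by lia.
  by rewrite !expn0 muln1; case: n y => [[]|].
have hd0 : 0 < hd.
  have ST := si_tree SI; have := @expanded_below v (st_vT ST).
  by rewrite (st_v ST) (si_tq SI).2; apply.
(* With [beta = C.+1 / b], [level_step] reads [level i.+1 >= beta * level i - 1], whose fixed point
   is [b / (C.+1 - b)]. The claim, cleared of denominators, is that [level i.+1] exceeds it by at
   least [beta ^ i]. The induction starts at level 1, since the single vertex of level 0 need not
   exceed the fixed point. *)
suff H i : i.+1 < d -> C.+1 ^ i * (C.+1 - b) + b ^ i * b <= b ^ i * (level i.+1 * (C.+1 - b)).
  have := H (d - 2); have -> : (d - 2).+1 < d by lia.
  move=> /(_ isT); have := level_n (d - 2).+1.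
  have : 0 < C.+1 - b by lia.
  move: (level _) (C.+1 - b) (C.+1 ^ _) (b ^ _) => l e p q e0 ln h.
  have : p * e <= (q * l) * e by rewrite -mulnA; apply: leq_trans h; exact: leq_addr.
  rewrite leq_pmul2r // => h2; apply: leq_trans h2 _.
  by rewrite mulnC leq_mul2r ln orbT.
elim: i => [_|i IH hi].
  rewrite !expn0 !mul1n; have := level1 hd0; move: (level 1) => l h.
  have : C.+2 * (C.+1 - b) <= l * (C.+1 - b) by rewrite leq_mul2r h orbT.
  have : C.+1 * 1 <= C.+1 * (C.+1 - b) by rewrite leq_mul2l; lia.
  rewrite muln1 => g1; rewrite [C.+2]lock -lock [in C.+2 * _]mulSn; lia.
have := level_step hb' hi; have := IH (ltnW hi).
rewrite !expnS; move: (level i.+1) (level i.+2) (C.+1 ^ i) (b ^ i) => l l' p q h1 h2.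
have [e Ee] : exists e, C.+1 = b + e by exists (C.+1 - b); lia.
rewrite Ee addKn in h1 h2 *.
have h3 : (b + e) * (p * e + q * b) <= (b + e) * (q * (l * e)) by rewrite leq_mul2l h1 orbT.
have h4 : (q * e) * (l * (b + e)) <= (q * e) * (l'.+1 * b) by rewrite leq_mul2l h2 orbT.
have E3 : (b + e) * (q * (l * e)) = (q * e) * (l * (b + e)) by lia.
rewrite E3 in h3; have h5 := leq_trans h3 h4.
have E4 : (b + e) * (p * e + q * b) = (b + e) * p * e + b * q * b + e * q * b by lia.
have E5 : q * e * (l'.+1 * b) = b * q * (l' * e) + e * q * b by lia.
by move: h5; rewrite E4 E5 leq_add2r.
Qed.

End Deep.
End Growth.
End SearchInvariant.

(** * Correctness of the search *)

Lemma has_memory_regs n k (c : coloring n k) cc tq pth trch F S s s' :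
  arrs s' = arrs s -> has_memory c cc tq pth trch F S s ->
  has_memory c cc tq pth trch F S s'.
Proof. by move=> E h A i j; rewrite E h. Qed.

Lemma insub_ordE n i (x : 'I_n) : ((insub i : option 'I_n) == Some x) = (i == x :> nat).
Proof.
case: insubP => [y _ <-|]; first by rewrite (inj_eq Some_inj).
by rewrite -leqNgt => h; symmetry; apply/negP => /eqP E; move: (ltn_ord x); rewrite -E ltnNge h.
Qed.

Lemma nth_codeE (T : Type) (g : T -> nat) (s : seq T) p j :
  nth 0 [seq g q | q <- rcons s p] j =
  if j == size s then g p else nth 0 [seq g q | q <- s] j.
Proof.
rewrite map_rcons nth_rcons size_map; case: ltngtP => // h.
by rewrite nth_default // size_map ltnW.
Qed.

Section Refinement.
Variables (n k : nat) (c : coloring n k) (u v : 'I_n).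
Variables (Delta C b : nat).
Hypothesis wfc : wf_coloring c.
Hypothesis cuv : c [set u; v] = None.
Hypothesis nuv : u != v.
Hypothesis kE : k = Delta + C.
Hypothesis bC : b <= C.
Hypothesis hav : forall tq pth x, search_tree c u v tq pth -> x \in u :: tq ->
  C < #|[set a | avail c (parent pth) x a]|.

Notation mem tq pth trch := (has_memory c c tq pth trch (fun _ _ => 0) [::]).

Definition env (s : state) : Prop :=
  [/\ regs s 3 = b, regs s 4 = u & regs s 5 = v] /\
  [/\ regs s 6 = k, regs s 7 = 0, regs s 8 = 1 & regs s 9 = 2].

Lemma reach_memory tq pth trch s s' (w z : 'I_n) (f : 'I_k) :
  search_tree c u v tq pth -> w \in tq -> c [set w; z] = Some f ->
  mem tq pth trch s ->
  (forall A i j, arrs s' A i j =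
     if (z \notin u :: tq) && [&& A == 2, i == size tq & j == 0] then z : nat else
     if (z \notin u :: tq) && [&& A == 1, i == z & j == 1] then f.+1 else
     if (z \notin u :: tq) && [&& A == 1, i == z & j == 0] then w.+1 else
     if [&& A == 1, i == z & j == 2] then (size (trch z)).+1 else
     if [&& A == 4, i == z & j == size (trch z)] then f : nat else
     if [&& A == 3, i == z & j == size (trch z)] then w : nat else
     arrs s A i j) ->
  mem (visit u tq z) (visit_path u tq pth w z) (add_reach trch w f z) s'.
Proof.
move=> ST wT cwz H E A i j; rewrite {}E.
have [r Er] := pth_shape ST wT.
case: A => [|[|[|[|[|[|[|A]]]]]]]; rewrite ?H /= ?andbF //.
- rewrite -insub_ordE; case: (insub i) => [x|] //; rewrite ?andbF //.
  rewrite (inj_eq Some_inj) /add_reach; case: (eqVneq x z) => [->|nx] /=; last first.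
    rewrite !andbF /parent /visit_path.
    by case: (z \in u :: tq) => //=; rewrite (negbTE nx).
  case: j => [|[|[|j]]] //=; rewrite ?andbF ?andbT ?size_rcons //.
    rewrite /visit_path; case: (boolP (z \in u :: tq)) => //= _.
    by rewrite eqxx /parent eqxx Er.
  rewrite /visit_path; case: (boolP (z \in u :: tq)) => //= _.
  by rewrite /parent eqxx Er /= cwz.
- rewrite /visit; case: (z \in u :: tq) => //=.
  rewrite nth_codeE; case: (j =P 0) => _; last by rewrite andbF.
  by rewrite andbT.
- rewrite -insub_ordE; case: (insub i) => [x|] //.
  rewrite (inj_eq Some_inj) /add_reach; case: (eqVneq x z) => [->|nx] //=.
  by rewrite nth_codeE.
- rewrite -insub_ordE; case: (insub i) => [x|] //.
  rewrite (inj_eq Some_inj) /add_reach; case: (eqVneq x z) => [->|nx] //=.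
  by rewrite nth_codeE.
Qed.

Lemma wp_reach tq pth trch s (w z : 'I_n) (f : 'I_k) :
  search_tree c u v tq pth -> w \in tq -> c [set w; z] = Some f ->
  mem tq pth trch s -> env s -> regs s 11 = size tq ->
  regs s 13 = w -> regs s 17 = f -> regs s 18 = f.+1 -> regs s 19 = z.+1 ->
  wp reach_code s (fun t s' =>
    [/\ mem (visit u tq z) (visit_path u tq pth w z) (add_reach trch w f z) s', t <= 20,
      regs s' 11 = size (visit u tq z) &
      if size (trch z) == b then [/\ regs s' 12 = 2, regs s' 23 = z & regs s' 18 = k]
      else regs s' 12 = regs s 12 /\ regs s' 18 = f.+1]).
Proof.
move=> ST wT cwz H [[E3 E4 E5] [E6 E7 E8 E9]] E11 E13 E17 E18 E19.
rewrite /reach_code; wsteps; rewrite /= E19 /= ?E7 ?E8 ?E9.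
have ns : pth z = [::] <-> z \notin u :: tq.
  rewrite inE negb_or; split=> [h|/andP[h1 h2]]; last exact: (st_out ST).
  apply/andP; split; first by apply/eqP => Ez; move: h; rewrite Ez (st_u ST).
  by apply/negP => zT; move: h; rewrite (st_cons ST zT).
rewrite (mem_count H) (mem_parent H) E13 E17.
apply: wp_if => /= hz; wsteps.
  have zN : z \notin u :: tq.
    by apply/ns; move: hz; rewrite andbF E7; case: (pth z).
  rewrite /=; apply: wp_if => /= hb; wsteps; rewrite /=.
    have -> : (size (trch z) == b) by rewrite -E3.
    split; [|by []|by rewrite /= E11 /visit (negbTE zN) size_rcons|by rewrite /= ?E6 ?E18].
    apply: (reach_memory ST wT cwz H) => A i j /=.
    by rewrite ?E7 ?E8 ?E9 ?E11 ?E13 ?E18 zN /=.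
  have -> : (size (trch z) == b) = false by apply/negbTE; rewrite -E3.
  split; [|by []|by rewrite /= E11 /visit (negbTE zN) size_rcons|by rewrite /= ?E6 ?E18].
  apply: (reach_memory ST wT cwz H) => A i j /=.
  by rewrite ?E7 ?E8 ?E9 ?E11 ?E13 ?E18 zN /=.
have zV : z \in u :: tq.
  by apply/negPn/negP => /ns h; move: hz; rewrite andbF h E7.
rewrite /=; apply: wp_if => /= hb; wsteps; rewrite /=.
  have -> : (size (trch z) == b) by rewrite -E3.
  split; [|by []|by rewrite /= E11 /visit zV|by rewrite /= ?E6 ?E18].
  apply: (reach_memory ST wT cwz H) => A i j /=.
  by rewrite zV /=.
have -> : (size (trch z) == b) = false by apply/negbTE; rewrite -E3.
split; [|by []|by rewrite /= E11 /visit zV|by rewrite /= ?E6 ?E18].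
apply: (reach_memory ST wT cwz H) => A i j /=.
by rewrite zV /=.
Qed.

(* The result of the search: either the edge to [w] can be colored with [f]
   after shifting along the path to [w], or [z] has been reached [b + 1] times. *)
Definition search_ok tq pth trch hd f0 : Prop :=
  search_inv c u v tq pth trch hd f0 /\ forall z, size (trch z) <= b.

Definition found_color tq pth trch hd f0 (w : 'I_n) (f : 'I_k) : Prop :=
  [/\ search_ok tq pth trch hd f0, f0 <= k, w \in tq, index w tq = hd &
      avail c (parent pth) (parent pth w) f && avail c (parent pth) w f].

(** The depth bound requires all counts to be at most [b], so the reaches [trch0] before the last
    one are kept. The last reach hits a vertex already visited, hence [tq] and [pth] are the same
    for both. *)
Definition found_vertex tq pth trch hd f0 (z : 'I_n) : Prop :=
  exists trch0 f1, [/\ search_ok tq pth trch0 hd f1, f0 <= k,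
    search_inv c u v tq pth trch hd f0, hd < size tq & size (trch z) = b.+1].

Definition found tq pth trch hd (s : state) : Prop :=
  exists f0,
  (regs s 12 = 1 /\ exists w f, [/\ found_color tq pth trch hd f0 w f,
     regs s 13 = w & regs s 22 = f]) \/
  (regs s 12 = 2 /\ exists z, found_vertex tq pth trch hd f0 z /\ regs s 23 = z).

Definition scan_post tq pth trch hd f0 (s : state) : Prop :=
  [/\ mem tq pth trch s, regs s 11 = size tq &
   (regs s 12 = 0 /\ regs s 17 = f0 /\ search_ok tq pth trch hd f0) \/
   (k <= regs s 17 /\ found tq pth trch hd s)].

Lemma wp_scan tq pth trch hd s (w : 'I_n) (f : 'I_k) :
  0 < b -> search_ok tq pth trch hd f -> w \in tq -> index w tq = hd ->
  mem tq pth trch s -> env s -> regs s 11 = size tq -> regs s 12 = 0 ->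
  regs s 13 = w -> regs s 14 = parent pth w ->
  regs s 15 = ocode (c [set parent pth w; w]) ->
  regs s 16 = ocode (c [set parent pth (parent pth w); parent pth w]) ->
  regs s 17 = f ->
  wp scan_code s (fun t s' => t <= 50 /\ exists tq' pth' trch',
    [/\ scan_post tq' pth' trch' hd f.+1 s', w \in tq', index w tq' = hd,
     parent pth' w = parent pth w &
     parent pth' (parent pth w) = parent pth (parent pth w)]).
Proof.
move=> b0 [SI sb] wT Ew H E E11 E12 E13 E14 E15 E16 E17.
have [[E3 E4 E5] [E6 E7 E8 E9]] := E.
have ST := si_tree SI.
have code_eq (o : option 'I_k) : (f.+1 == ocode o) = (o == Some f).
  by case: o => [g|] //=; rewrite eqSS eq_sym (inj_eq Some_inj).
rewrite /scan_code; wsteps; rewrite /= E14 E17 (mem_table H).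
set av := avail c (parent pth) (parent pth w) f.
have Eav : av = (ocode (nbr c (parent pth w) f) == 0) ||
    (f.+1 == ocode (c [set parent pth (parent pth w); parent pth w])).
  rewrite code_eq /av /avail /missing; congr orb.
  by case: (nbr c (parent pth w) f).
pose Q1 (t : nat) (s1 : state) := t <= 3 /\ [/\ mem tq pth trch s1, env s1,
   (forall r, r \notin [:: 18; 19; 39] -> regs s1 r = regs s r), regs s1 18 = f.+1 &
   regs s1 39 = av].
apply: (@wp_conseq _ _ Q1).
  move=> t1 s1 [t13 [H1 En1 R E18 E39]]; wsteps.
  have [[F3 F4 F5] [F6 F7 F8 F9]] := En1.
  apply: wp_if => /=.
    rewrite E39 F8 => /eqP avt; have avT : av by case: (av) avt.
    wsteps; rewrite /= !R // E13 E17 (mem_table H1).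
    pose Q2 (t : nat) (s2 : state) := t <= 40 /\ exists tq' pth' trch',
      [/\ mem tq' pth' trch' s2, regs s2 11 = size tq',
       (regs s2 12 = 0 /\ regs s2 18 = f.+1 /\ search_ok tq' pth' trch' hd f.+1) \/
       (k <= regs s2 18 /\ found tq' pth' trch' hd s2) &
       [/\ w \in tq', index w tq' = hd, parent pth' w = parent pth w &
        parent pth' (parent pth w) = parent pth (parent pth w)]].
    apply: (@wp_conseq _ _ Q2).
      move=> t2 s2 [t2b [tq' [pth' [trch' [g1 g2 g3 [g4 g5 g6 g7]]]]]].
      wsteps; split; first by lia.
      exists tq', pth', trch'; split; [|exact: g4|exact: g5|exact: g6|exact: g7].
      split; [by apply: has_memory_regs g1|exact: g2|].
      case: g3 => [[h1 [h2 h3]]|[h1 [f0 h2]]]; [left|right]; rewrite /=; first by split.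
      by split=> //; exists f0.
    have stop (s2 : state) : avail c (parent pth) w f -> arrs s2 = arrs s1 ->
        (forall r, r \notin [:: 18; 19; 39] -> regs s2 r = regs s r) ->
        wp stop_code s2 (fun t s' => Q2 t.+2 s').
      move=> avw Ea R2; rewrite /stop_code; wsteps; split=> //=.
      exists tq, pth, trch; split=> //=.
      - by apply: has_memory_regs H1; rewrite /= Ea.
      - by rewrite R2.
      right; rewrite R2 // E6; split=> //; exists f; left; split=> //=.
      exists w, f; split; [|by rewrite /= R2|by rewrite /= R2].
      split; [by split|exact: ltnW (ltn_ord f)|exact: wT|exact: Ew|exact/andP].
    have Eaw : avail c (parent pth) w f = (ocode (nbr c w f) == 0) ||
        (f.+1 == ocode (c [set parent pth w; w])).
      by rewrite code_eq /avail /missing; congr orb; case: (nbr c w f).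
    have frame x : forall r, r \notin [:: 18; 19; 39] -> regs (set_reg s1 19 x) r = regs s r.
      by move=> r hr /=; case: eqP => [Er|_]; [rewrite Er in hr|rewrite R].
    have stop' x : avail c (parent pth) w f -> wp stop_code (set_reg s1 19 x) (fun t s' => Q2 t.+2 s').
      by move=> h; apply: stop => //; exact: frame.
    apply: wp_if => /=.
      rewrite F7 => hz; apply: (@wp_conseq _ _ (fun t s' => Q2 t.+2 s')); last first.
        by apply: stop'; rewrite Eaw hz.
      by move=> t2 s2 [g0 g]; split=> //; exact: ltnW.
    rewrite F7 => hz; apply: wp_if => /=.
      by rewrite E18 R // E15 => hz'; apply: stop'; rewrite Eaw hz' orbT.
    rewrite E18 R // E15 => hz'.
    have navw : ~~ avail c (parent pth) w f by rewrite Eaw negb_or hz hz'.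
    case Ez: (nbr c w f) hz => [z|] //= _.
    have cwz := nbr_some Ez.
    apply: wp_conseq (wp_frame (@wp_reach tq pth trch _ w z f ST wT cwz _ _ _ _ _ _ _)).
    + move=> t2 s2 [[g1 g2 g3 g4] ag]; split; first by lia.
      have SI' := reach_inv wfc cuv SI wT Ew (erefl _) cwz avT.
      exists (visit u tq z), (visit_path u tq pth w z), (add_reach trch w f z).
      have wV : w \in u :: tq by rewrite inE wT orbT.
      split=> //; last first.
        split; rewrite ?visit_parentE ?(parent_in ST) //; first by rewrite mem_visit wT.
        by rewrite /visit; case: ifP => // _; rewrite -cats1 index_cat wT.
      case: eqP g4 => [Eb [h1 h2 h3]|nb [h1 h2]]; [right|left].
        rewrite h3; split=> //; exists f.+1; right; split=> //; exists z; split=> //.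
        have zV : z \in u :: tq.
          have : 0 < size (trch z) by rewrite Eb.
          case E0: (trch z) => [|[x g] l] // _.
          by apply: (si_vis SI (w := x) (f := g)); rewrite E0 inE eqxx.
        exists trch, f; split=> //.
        * by split=> //; rewrite /visit /visit_path zV.
        * by rewrite /visit zV -Ew index_mem.
        * by rewrite /add_reach eqxx size_rcons Eb.
      rewrite h1 /= R // E12; split=> //; split=> //; split=> // x.
      rewrite /add_reach; case: eqP => // _; rewrite size_rcons ltn_neqAle sb andbT.
      exact/eqP.
    + by apply: has_memory_regs H1.
    + by [].
    + by rewrite /= R.
    + by rewrite /= R.
    + by rewrite /= R.
    + by [].
    + by [].
  rewrite E39 F8; case: (boolP av) => // nav _; rewrite /skip; wsteps; split; first by lia.
  exists tq, pth, trch; split=> //; split; [by apply: has_memory_regs H1|by rewrite /= R|].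
  left; rewrite /= R // E18; split=> //; split=> //; split=> //.
  exact: (skip_inv SI wT Ew (erefl _)).
have setQ x y : y = nat_of_bool av -> Q1 1 (set_reg (set_reg (set_reg s 18 f.+1) 19 x) 39 y).
  move=> ->; split=> //; split; [by apply: has_memory_regs H|by []| |by []|by []].
  by move=> r; rewrite /= !inE !negb_or => /and3P[/negbTE -> /negbTE -> /negbTE ->].
have setQ' x y : y = nat_of_bool av -> forall t, t <= 3 ->
    Q1 t (set_reg (set_reg (set_reg s 18 f.+1) 19 x) 39 y).
  by move=> /setQ h t ht; have [_ h'] := h x; split.
apply: wp_if => /=; rewrite E7.
  by move=> hz; wsteps; apply: setQ' => //; rewrite Eav hz.
move=> hz; apply: wp_if => /=; rewrite E16 => hz'; wsteps; apply: setQ' => //.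
  by rewrite Eav hz' orbT.
by rewrite Eav (negbTE hz) (negbTE hz').
Qed.

Lemma wp_expand tq pth trch hd s :
  0 < b -> search_ok tq pth trch hd 0 -> hd < size tq ->
  mem tq pth trch s -> env s -> regs s 10 = hd -> regs s 11 = size tq -> regs s 12 = 0 ->
  wp expand_code s (fun t s' => t <= 51 * k + 10 /\ exists tq' pth' trch',
    [/\ mem tq' pth' trch' s', regs s' 10 = hd.+1, regs s' 11 = size tq', hd < size tq' &
     (regs s' 12 = 0 /\ search_ok tq' pth' trch' hd.+1 0) \/
     found tq' pth' trch' hd s']).
Proof.
move=> b0 [SI sb] lt H E E10 E11 E12.
have [[E3 E4 E5] [E6 E7 E8 E9]] := E.
have ST := si_tree SI; have [Utq _] := si_tq SI.
pose w := nth u tq hd.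
have wT : w \in tq by exact: mem_nth.
have Ew : index w tq = hd by exact: index_uniq.
have Eq : nth 0 [seq val x | x <- tq] hd = w by rewrite (nth_map u).
have Ep : pth w = w :: pth (parent pth w) by exact: (st_cons ST).
rewrite /expand_code; wsteps; rewrite /= E10 E7 (mem_queue H) Eq ?E7 ?E8.
have Ew0 : arrs s 1 w 0 = (parent pth w).+1 by rewrite (mem_parent H) Ep.
rewrite Ew0 /= ?E8 !(mem_pcolor H).
set s1 := (X in wp _ X _).
pose I i t (s' : state) := [/\ t <= i * 51, i <= k & exists tq' pth' trch',
    [/\ scan_post tq' pth' trch' hd i s', w \in tq', index w tq' = hd,
     parent pth' w = parent pth w &
     parent pth' (parent pth w) = parent pth (parent pth w)]].
apply: wp_conseq (wp_while (I := I) (N := k) _ _).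
- move=> t s' [i [t0 [[h1 h2 [tq' [pth' [trch' [h3 h4 h5 h6 h7]]]]] h8 ag Et]]]; wsteps.
  split; first by rewrite Et; nia.
  exists tq', pth', trch'; have [g1 g2 g3] := h3; split.
  + by apply: has_memory_regs g1.
  + by rewrite /= ag //= E10.
  + exact: g2.
  + by rewrite -h5 index_mem.
  case: g3 => [[g4 [g5 [g6 g7]]]|[_ [f0 g4]]]; [left|by right; exists f0].
  split=> //; split=> //; apply: next_inv g6 _; apply/eqP; rewrite eqn_leq h2 /=.
  by move: h8; rewrite /= -leqNgt g5 ag //= E6.
- split=> //; exists tq, pth, trch; split=> //; split=> //; left; split=> //.
- move=> i t s' [h1 h2 [tq' [pth' [trch' [[g1 g2 g3] h4 h5 h6 h7]]]]] ag hb.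
  have E6' : regs s' 6 = k by rewrite ag //= E6.
  case: g3 => [[g4 [g5 g6]]|[g4 _]]; last by move: hb; rewrite /= E6' ltnNge g4.
  have ik : i < k by move: hb; rewrite /= g5 E6'.
  split=> //; apply: wp_conseq (@wp_scan tq' pth' trch' hd s' w (Ordinal ik) b0 g6 h4 h5 g1 _ g2 g4 _ _ _ _ _) => //.
  + move=> t' s'' [t50 [tq2 [pth2 [trch2 [k1 k2 k3 k4 k5]]]]]; split; rewrite ?mulSn; try lia.
    exists tq2, pth2, trch2; split=> //; first by rewrite k4 h6.
    by move: k5; rewrite h6 h7.
  + by split; split; rewrite ag.
  + by rewrite ag.
  + by rewrite ag //= h6.
  + by rewrite ag //= h6.
  + by rewrite ag //= h6 h7.
Qed.

Lemma wp_search s tq pth :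
  0 < b -> search_ok tq pth (fun _ => [::]) 0 0 ->
  mem tq pth (fun _ => [::]) s -> env s -> regs s 10 = 0 -> regs s 11 = size tq -> regs s 12 = 0 ->
  wp search_code s (fun t s' => exists tq' pth' trch' hd,
    [/\ mem tq' pth' trch' s', t <= hd.+1 * (51 * k + 11) + 1, regs s' 11 = size tq' &
     found tq' pth' trch' hd s']).
Proof.
move=> b0 SI H E E10 E11 E12.
pose I i t (s' : state) := t <= i * (51 * k + 11) /\ exists tq' pth' trch',
    [/\ mem tq' pth' trch' s', regs s' 10 = i, regs s' 11 = size tq', i <= size tq' &
     (regs s' 12 = 0 /\ search_ok tq' pth' trch' i 0) \/
     (0 < i /\ found tq' pth' trch' i.-1 s')].
apply: wp_conseq (wp_while (I := I) (N := n) _ _).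
- move=> t s' [i [t0 [[h1 [tq' [pth' [trch' [h2 h3 h4 h5 h6]]]]] h7 ag Et]]].
  case: h6 => [[h6 _]|[ip h6]]; first by move: h7; rewrite /= h6 ag //; case: E => _ [_ E7 _ _]; rewrite E7.
  by exists tq', pth', trch', i.-1; split=> //; rewrite prednK // Et; lia.
- by split=> //; exists tq, pth, (fun _ => [::]); split=> //; left.
- move=> i t s' [h1 [tq' [pth' [trch' [h2 h3 h4 h5 h6]]]]] ag hb.
  have En : env s' by case: E => [[? ? ?] [? ? ? ?]]; split; split; rewrite ag.
  have [h7 h8] : regs s' 12 = 0 /\ search_ok tq' pth' trch' i 0.
    case: h6 => [//|[_ [f0 [[h6 _]|[h6 _]]]]]; move: hb; rewrite /= h6.
      by case: En => _ [_ E7 _ _]; rewrite E7.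
    by case: En => _ [_ E7 _ _]; rewrite E7.
  (* The program does not test whether the queue is empty; the counting of reaches guarantees a next
     vertex. *)
  have lt : i < size tq'.
    have [//|] := not_exhausted wfc cuv nuv h8.1 bC (fun x => hav (si_tree h8.1)) h8.2.
    by rewrite ltnNge h5.
  split.
    apply: leq_trans lt _; rewrite -[X in _ <= X](card_ord n).
    by have [U _] := si_tq h8.1; rewrite -(card_uniqP U); exact: max_card.
  apply: wp_conseq (wp_expand b0 h8 lt h2 En h3 h4 h7) => t' s'' [ht [tq2 [pth2 [trch2 [k1 k2 k3 k4 k5]]]]].
  split; first by rewrite mulSn; lia.
  exists tq2, pth2, trch2; split=> //; case: k5; [by left|by right; split].
Qed.

Definition pth0 (x : 'I_n) : seq 'I_n :=
  if x == v then [:: v; u] else if x == u then [:: u] else [::].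

Lemma wp_init s : stores s c -> insertion_input s Delta C b u v ->
  wp init_code s (fun t s' => [/\ t <= 3 * C + 20, mem [:: v] pth0 (fun _ => [::]) s',
    env s' & [/\ regs s' 10 = 0, regs s' 11 = 1 & regs s' 12 = 0]]).
Proof.
move=> H [[E0 E1 E2 E3] [E4 E5]].
rewrite /init_code; wsteps; rewrite /= E1.
set s1 := (X in wp _ X _).
pose I i t (s' : state) := [/\ t = i * 3, i <= C, regs s' 6 = Delta + i, regs s' 17 = i &
   arrs s' = arrs s].
apply: wp_conseq (wp_while (I := I) (N := C) _ _).
- move=> t s' [i [t0 [[h1 h2 h3 h4 h5] h6 ag Et]]].
  have Ei : i = C.
    apply/eqP; rewrite eqn_leq h2 leqNgt; apply: contra h6 => /=.
    by rewrite h4 ag //= E2.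
  have F r : r \in [:: 2; 3; 4; 5; 7; 8; 9] -> regs s' r = regs s1 r.
    by rewrite !inE => /or4P[/eqP->|/eqP->|/eqP->|/or4P[/eqP->|/eqP->|/eqP->|/eqP->]]; rewrite ag.
  have [F4 F5 F7] : [/\ regs s' 4 = u, regs s' 5 = v & regs s' 7 = 0] by rewrite !F //= E4 E5.
  wsteps; split.
  + by rewrite Et h1 Ei; lia.
  + move=> A i' j' /=; rewrite F4 F5 F7 h5 H /pth0.
    have vE (i0 : nat) (x : 'I_n) : (i0 == x) = ((insub i0 : option 'I_n) == Some x).
      by rewrite insub_ordE.
    case: A => [|[|[|[|[|[|[|A]]]]]]] //=; rewrite ?andbF ?nth_nil //.
    * rewrite !vE; case: (insub i') => [x|] //=; rewrite ?(inj_eq Some_inj).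
      rewrite /parent; case: (eqVneq x v) => [->|nv] /=.
        by case: j' => [|[|[|j']]] //=; rewrite ?andbF ?cuv.
      case: (eqVneq x u) => [->|nu] /=; case: j' => [|[|[|j']]] //=; rewrite ?andbF ?wf_loop //.
    * by case: i' => [|i'] /=; case: j' => [|j'] //=; rewrite ?nth_nil.
    * by case: (insub i') => [x|] //=; rewrite nth_nil.
    * by case: (insub i') => [x|] //=; rewrite nth_nil.
    * by case: (j' == 0); rewrite ?nth_nil.
  + have [F3 F8 F9] : [/\ regs s' 3 = b, regs s' 8 = 1 & regs s' 9 = 2] by rewrite !F //= E3.
    by split; split; rewrite /= ?F3 ?F4 ?F5 ?F7 ?F8 ?F9 ?h3 ?Ei -?kE.
  + by [].
- by split=> //; rewrite /= ?addn0.
- move=> i t s' [h1 h2 h3 h4 h5] ag hb.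
  have ltC : i < C by move: hb; rewrite /= h4 ag //= E2.
  split=> //; wsteps; split=> /=; rewrite ?h3 ?h4 ?addnS //.
  by rewrite h1 mulSn; lia.
Qed.

End Refinement.

(** * Shifting colors in memory *)

Section Shifting.
Variables (n k : nat) (c : coloring n k) (u v : 'I_n).
Hypothesis wfc : wf_coloring c.
Hypothesis cuv : c [set u; v] = None.
Hypothesis nuv : u != v.
Variables (tq : seq 'I_n) (pth : 'I_n -> seq 'I_n) (trch : 'I_n -> seq ('I_n * 'I_k)).
Hypothesis ST : search_tree c u v tq pth.
Variable F : nat -> nat -> nat.

Notation par := (parent pth).
Notation memc cc S := (has_memory c cc tq pth trch F S).

Lemma wp_move s S cc rx ry rz ra (x y z : 'I_n) (a : 'I_k) :
  all (fun r => r != 19) [:: rx; ry; rz; ra] ->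
  regs s rx = x -> regs s ry = y -> regs s rz = z -> regs s ra = a -> regs s 7 = 0 ->
  wf_coloring cc -> cc [set x; y] = None -> cc [set y; z] = Some a ->
  missing cc x a -> x != y -> memc cc S s ->
  wp (move_code rx ry rz ra) s (fun t s' =>
    t = 5 /\ memc (move cc [set x; y] [set y; z]) S s').
Proof.
move=> /and5P[/negbTE n1 /negbTE n2 /negbTE n3 /negbTE n4 _] E1 E2 E3 E4 E7 W cxy cyz mxa nxy H.
rewrite /move_code; wsteps; split=> // A i j /=; rewrite n1 n2 n3 n4 E1 E2 E3 E4 E7.
case: A => [|A]; last by rewrite /= H.
rewrite /=; pose f (i j : nat) : nat := if (i == z) && (j == a) then 0
  else if (i == x) && (j == a) then y.+1
  else if (i == y) && (j == a) then x.+1 else incidence_table cc i j.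
rewrite H /= -/(f i j); apply: cell_table => {i j} [x' a'|i j ni|i j kj]; rewrite /f.
- rewrite !(inj_eq val_inj) incidence_tableE (nbr_move W cxy cyz mxa nxy).
  case: (eqVneq a' a) => [->|_]; rewrite ?andbF // !andbT.
  have nyz : y != z by exact: wf_neq cyz.
  have nxz : x != z by apply: contra_eq_neq cyz => <-; rewrite colorC cxy.
  case: (eqVneq x' z) => [->|_]; first by rewrite eq_sym (negbTE nyz) eq_sym (negbTE nxz).
  case: (eqVneq x' x) => [->|_]; first by rewrite (negbTE nxy).
  by case: (x' == y).
- have h (p : 'I_n) : (i == p) = false by apply/negP => /eqP Ep; move: (ltn_ord p); rewrite -Ep ltnNge ni.
  by rewrite !h incidence_table_out1.
- have h : (j == a) = false by apply/negP => /eqP Ep; move: (ltn_ord a); rewrite -Ep ltnNge kj.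
  by rewrite h !andbF incidence_table_out2.
Qed.

Lemma wp_assign s S cc rx ry ra (x y : 'I_n) (a : 'I_k) :
  all (fun r => r != 19) [:: rx; ry; ra] ->
  regs s rx = x -> regs s ry = y -> regs s ra = a ->
  wf_coloring cc -> cc [set x; y] = None -> missing cc x a -> missing cc y a ->
  x != y -> memc cc S s ->
  wp (assign_code rx ry ra) s (fun t s' =>
    t = 4 /\ memc (assign cc [set x; y] a) S s').
Proof.
move=> /and4P[/negbTE n1 /negbTE n2 /negbTE n3 _] E1 E2 E3 W cxy mxa mya nxy H.
rewrite /assign_code; wsteps; split=> // A i j /=; rewrite n1 n2 n3 E1 E2 E3.
case: A => [|A]; last by rewrite /= H.
rewrite /=; pose f (i j : nat) : nat := if (i == x) && (j == a) then y.+1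
  else if (i == y) && (j == a) then x.+1 else incidence_table cc i j.
rewrite H /= -/(f i j); apply: cell_table => {i j} [x' a'|i j ni|i j kj]; rewrite /f.
- rewrite !(inj_eq val_inj) incidence_tableE (nbr_assign W cxy mxa mya nxy).
  case: (eqVneq a' a) => [->|_]; rewrite ?andbF // !andbT.
  case: (eqVneq x' x) => [->|_]; first by rewrite (negbTE nxy).
  by case: (x' == y).
- have h (p : 'I_n) : (i == p) = false by apply/negP => /eqP Ep; move: (ltn_ord p); rewrite -Ep ltnNge ni.
  by rewrite !h incidence_table_out1.
- have h : (j == a) = false by apply/negP => /eqP Ep; move: (ltn_ord a); rewrite -Ep ltnNge kj.
  by rewrite h !andbF incidence_table_out2.
Qed.

Lemma pth_suffixE w s x t : w \in u :: tq -> pth w = s ++ x :: t -> pth x = x :: t.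
Proof.
elim: s w => [|y s IH] w wV; rewrite inE in wV; case/orP: wV => [/eqP Ew|wT].
- by rewrite Ew (st_u ST) /= => -[<- <-]; rewrite (st_u ST).
- by move=> /= E; move: (E); rewrite {1}(st_cons ST wT) => -[Ex _]; rewrite -{1}Ex.
- by rewrite Ew (st_u ST) => -[_]; case: s {IH}.
- rewrite (st_cons ST wT) => -[_]; apply: IH.
  by apply: (parent_in ST); rewrite inE wT orbT.
Qed.

Lemma pcolor_pos x : x \in tq -> 0 < ocode (c [set par x; x]) = (x != v).
Proof.
move=> xT; case: (eqVneq x v) => [->|nv]; first by rewrite (par_v ST) cuv.
by have [a ->] := par_color ST xT nv.
Qed.

Lemma wp_path s (w : 'I_n) : w \in tq -> memc c [::] s ->
  regs s 13 = w -> regs s 4 = u -> regs s 5 = v -> regs s 7 = 0 -> regs s 8 = 1 ->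
  wp path_code s (fun t s' => [/\ t <= 30 * size (pth w) + 10,
    memc (shifted c (pth w)) [::] s', regs s' 26 = par w & regs s' 27 = w]).
Proof.
move=> wT H E13 E4 E5 E7 E8; rewrite /path_code; wsteps; rewrite /= E13 E8 (mem_pcolor H).
set s1 := (X in wp _ X _).
pose I i t (s' : state) := t = i * 6 /\ exists x s0,
  [/\ [/\ pth w = s0 ++ pth x, size s0 = i & x \in tq], memc c [seq val y | y <- s0] s',
   regs s' 24 = i, regs s' 25 = x & regs s' 28 = ocode (c [set par x; x])].
apply: wp_conseq (wp_while (I := I) (N := size (pth w)) _ _).
- move=> t s2 [i [t0 [[Et0 [x [s0 [[h1 h2 h3] h4 h5 h6 h7]]]] hn ag Et]]]; wsteps.
  rewrite /= (ag 4) // (ag 5) // /s1 /= E4 E5.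
  have Ex : x = v.
    by apply/eqP; move: hn; rewrite /= h7 (ag 7) // /s1 /= E7 pcolor_pos // negbK.
  subst x; set s3 := (X in wp _ X _).
  have si : i <= size (pth w) by rewrite -h2 h1 size_cat leq_addr.
  (* The path is rebuilt from the root: the coloring is shifted along the path to [y], and the stack
     holds the rest of the path to [w]. *)
  pose J j t (s' : state) := t = j * 13 /\ exists y s1,
    [/\ [/\ pth w = s1 ++ pth y, size s1 + j = i & y \in tq],
     memc (shifted c (pth y)) [seq val y | y <- s1] s',
     regs s' 24 = size s1, regs s' 27 = y & regs s' 26 = par y].
  apply: wp_conseq (wp_while (I := J) (N := i) _ _).
  + move=> t2 s4 [j [t3 [[Et3 [y [s5 [[g1 g2 g3] g4 g5 g6 g7]]]] gn ag2 Et2]]].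
    have s50 : s5 = [::].
      apply: size0nil; apply/eqP; move: gn.
      by rewrite /= g5 (ag2 7) // /s3 /= (ag 7) // /s1 /= E7 lt0n negbK.
    have Ey : y = w.
      by move: g1; rewrite s50 /= (st_cons ST wT) (st_cons ST g3) => -[].
    split; rewrite ?g6 ?g7 ?Ey //; first by rewrite Et Et2 Et0 Et3; lia.
    by move: g4; rewrite s50 Ey.
  + split=> //; exists v, s0; split=> //; rewrite /s3 /= ?(par_v ST) //.
    * by split=> //; rewrite addn0.
    * rewrite (st_v ST) /=; exact: h4.
    * by rewrite h5.
  + move=> j t2 s4 [Et2 [y [s5 [[g1 g2 g3] g4 g5 g6 g7]]]] ag2 gb.
    have F7 : regs s4 7 = 0 by rewrite (ag2 7) // /s3 /= (ag 7) // /s1 /= E7.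
    have F8 : regs s4 8 = 1 by rewrite (ag2 8) // /s3 /= (ag 8) // /s1 /= E8.
    have : 0 < size s5 by move: gb; rewrite /= g5 F7.
    case/lastP: s5 g1 g2 g4 g5 => [//|s5 x] g1 g2 g4 g5 _.
    rewrite size_rcons in g2 g5.
    have wV : w \in u :: tq by rewrite inE wT orbT.
    have Epx : pth x = x :: pth y by apply: (pth_suffixE (s := s5) wV); rewrite -cat_rcons.
    have xT : x \in tq.
      have : x \in pth w by rewrite g1 cat_rcons mem_cat inE eqxx orbT.
      move/(st_sub ST wT); rewrite inE => /orP[/eqP Exu|//].
      by move: Epx; rewrite Exu (st_u ST) (st_cons ST g3).
    have Py : par x = y by rewrite /parent Epx (st_cons ST g3).
    have nxv : x != v.
      apply/eqP => Exv; move: Epx; rewrite Exv (st_v ST) => -[Ey].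
      have := st_cons ST g3; rewrite -Ey => -[Eu].
      by move: (st_uN ST); rewrite Eu g3.
    have [a Ea] := par_color ST xT nxv; rewrite Py in Ea.
    split; first by rewrite -g2 addSn ltnS leq_addl.
    rewrite /pop_code; wsteps; rewrite /= g5 F7 F8 /= (mem_stack g4).
    have -> : nth 0 [seq val y0 | y0 <- rcons s5 x] (size s5) = x.
      by rewrite nth_codeE eqxx.
    rewrite (mem_pcolor g4) Py Ea /=.
    set s6 := (X in wp _ X _).
    have M6 : memc (shifted c (pth y)) [seq val y0 | y0 <- s5] s6.
      move=> A i' j'; rewrite /s6 /=; case: (A =P 6) => [->|nA]; last first.
        by rewrite g4; case: A nA => [|[|[|[|[|[|[|A]]]]]]].
      rewrite g4 /= nth_codeE; case: (j' == 0); rewrite ?andbF // andbT.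
      by case: eqP => // ->; rewrite nth_default // size_map.
    have [r Er] := pth_shape ST g3.
    have vp : vpath c u v par [:: x, y, par y & r] by rewrite -Er -Epx; exact: (st_path ST).
    have [a' [[W N' E' M' nqp] Ea']] := vpath_move wfc cuv (par_u ST) vp.
    have Eaa : a' = a by move: Ea'; rewrite Ea => -[].
    subst a'; rewrite -Er in W N' E' M'.
    apply: wp_conseq (wp_frame (@wp_move s6 _ _ 26 27 25 28 (par y) y x a _ _ _ _ _ _ W N' E' M' nqp M6)) => //.
    move=> t3 s7 [[-> M7] ag7]; wsteps; split; first by rewrite Et2 mulSn; lia.
    exists x, s5; split.
    + split=> //; last by rewrite addnS -addSn.
      by rewrite Epx -cat_rcons.
    + have -> : shifted c (pth x) = move (shifted c (pth y)) [set par y; y] [set y; x].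
        by rewrite Epx Er.
      by apply: has_memory_regs M7.
    + by rewrite /= (ag7 24).
    + by rewrite /= (ag7 25).
    + by rewrite Py /= (ag7 27) // /s6 /= g6.
- by split=> //; exists w, [::]; split.
- move=> i t s2 [Et [x [s0 [[h1 h2 h3] h4 h5 h6 h7]]]] ag hb.
  have F7 : regs s2 7 = 0 by rewrite (ag 7) // /s1 /= E7.
  have F8 : regs s2 8 = 1 by rewrite (ag 8) // /s1 /= E8.
  have nv : x != v by move: hb; rewrite /= h7 F7 pcolor_pos.
  have Px := st_par ST h3 nv.
  split; first by rewrite h1 size_cat h2 (st_cons ST h3) /= addnS ltnS leq_addr.
  rewrite /push_code; wsteps; rewrite /= h6 h5 F7 F8 /=.
  have Ep : arrs s2 1 x 0 = (par x).+1 by rewrite (mem_parent h4) (st_cons ST h3).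
  rewrite Ep /= (mem_pcolor h4).
  split; first by rewrite Et mulSn; lia.
  exists (par x), (rcons s0 x); split=> //=.
  + split=> //; last by rewrite size_rcons h2.
    by rewrite cat_rcons -(st_cons ST h3).
  + move=> A i' j' /=; case: (A =P 6) => [->|nA]; last first.
      by rewrite h4; case: A nA => [|[|[|[|[|[|[|A]]]]]]].
    rewrite h4 /= nth_codeE h2; case: (j' == 0); rewrite ?andbF ?andbT //.
Qed.

Lemma wp_unshift s (w : 'I_n) : w \in tq -> memc (shifted c (pth w)) [::] s ->
  regs s 13 = w -> regs s 7 = 0 -> regs s 8 = 1 ->
  wp unshift_code s (fun t s' => t <= 20 * size (pth w) + 10 /\ memc c [::] s').
Proof.
move=> wT H E13 E7 E8; rewrite /unshift_code; wsteps; rewrite /= E13 E8 (mem_pcolor H).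
set s1 := (X in wp _ X _).
pose I i t (s' : state) := t = i * 13 /\ exists x s0,
  [/\ [/\ pth w = s0 ++ pth x, size s0 = i & x \in tq], memc (shifted c (pth x)) [::] s',
   regs s' 25 = x & regs s' 28 = ocode (c [set par x; x])].
apply: wp_conseq (wp_while (I := I) (N := size (pth w)) _ _).
- move=> t s2 [i [t0 [[Et0 [x [s0 [[h1 h2 h3] h4 h5 h6]]]] hn ag Et]]].
  have Ex : x = v.
    by apply/eqP; move: hn; rewrite /= h6 (ag 7) // /s1 /= E7 pcolor_pos // negbK.
  have si : i <= size (pth w) by rewrite -h2 h1 size_cat leq_addr.
  split; first by rewrite Et Et0; lia.
  by move: h4; rewrite Ex (st_v ST).
- by split=> //; exists w, [::].
- move=> i t s2 [Et [x [s0 [[h1 h2 h3] h4 h5 h6]]]] ag hb.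
  have F7 : regs s2 7 = 0 by rewrite (ag 7) // /s1 /= E7.
  have F8 : regs s2 8 = 1 by rewrite (ag 8) // /s1 /= E8.
  have nv : x != v by move: hb; rewrite /= h6 F7 pcolor_pos.
  have Px := st_par ST h3 nv.
  split; first by rewrite h1 size_cat h2 (st_cons ST h3) /= addnS ltnS leq_addr.
  have [a Ea] := par_color ST h3 nv.
  rewrite /unshift_step; wsteps; rewrite /= h5 h6 Ea F7 /=.
  have Ep : arrs s2 1 x 0 = (par x).+1 by rewrite (mem_parent h4) (st_cons ST h3).
  have Epp : arrs s2 1 (par x) 0 = (par (par x)).+1 by rewrite (mem_parent h4) (st_cons ST Px).
  rewrite Ep /= Epp /=.
  set s3 := (X in wp _ X _).
  have [r Er] := pth_shape ST Px.
  have Ex : pth x = [:: x, par x, par (par x) & r] by rewrite (st_cons ST h3) Er.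
  have vp : vpath c u v par [:: x, par x, par (par x) & r] by rewrite -Ex; exact: (st_path ST).
  have [a' [[W N' E' M' nqp] Ea']] := vpath_move wfc cuv (par_u ST) vp.
  have Eaa : a' = a by move: Ea'; rewrite Ea => -[].
  subst a'; rewrite -Er in W N' E' M'.
  have Sh : shifted c (pth x) = move (shifted c (pth (par x))) [set par (par x); par x] [set par x; x].
    by rewrite Ex Er.
  have W2 : wf_coloring (shifted c (pth x)) by rewrite Sh; exact: move_wf W E' M' nqp.
  have npx : par x != x by exact: wf_neq Ea.
  have nppx : par (par x) != x.
    by have := st_uniq ST h3; rewrite Ex /= !inE !negb_or eq_sym => /andP[/and3P[]] _; rewrite eq_sym.
  have C1 : shifted c (pth x) [set x; par x] = None.
    rewrite Sh (moveE _ E') [[set x; _]]setUC eqxx; case: eqP => // /eqP.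
    by rewrite [[set par (par x); _]]setUC => /eqP/set2_inj/eqP; rewrite eq_sym (negbTE nppx).
  have C2 : shifted c (pth x) [set par x; par (par x)] = Some a.
    by rewrite Sh (moveE _ E') [[set par x; par (par x)]]setUC eqxx.
  have C3 : missing (shifted c (pth x)) x a.
    rewrite /missing Sh (nbr_move W N' E' M' nqp) eqxx.
    have -> : (x == par x) = false by rewrite eq_sym (negbTE npx).
    by rewrite [x == par (par x)]eq_sym (negbTE nppx) !eqxx.
  have M3 : memc (shifted c (pth x)) [::] s3 by apply: has_memory_regs h4.
  apply: wp_conseq (wp_frame (@wp_move s3 _ _ 25 27 26 28 x (par x) (par (par x)) a _ _ _ _ _ _ W2 C1 C2 C3 _ M3)) => //.
    move=> t3 s7 [[-> M7] ag7]; wsteps; split; first by rewrite Et mulSn; lia.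
    have K8 : regs s7 8 = 1 by rewrite ag7.
    have K27 : regs s7 27 = par x by rewrite ag7.
    rewrite /= K8 K27 (mem_pcolor M7).
    exists (par x), (rcons s0 x); split=> //=.
    + split=> //; last by rewrite size_rcons h2.
      by rewrite cat_rcons -(st_cons ST h3).
    + move: M7; rewrite {1}Sh (move_moveK N' E') => M7; by apply: has_memory_regs M7.
  rewrite eq_sym //.
Qed.

End Shifting.

(** * Completing a shift *)

Section Solutions.
Variables (n k : nat) (c : coloring n k) (u v : 'I_n).
Hypothesis wfc : wf_coloring c.
Hypothesis cuv : c [set u; v] = None.
Hypothesis nuv : u != v.
Variables (tq : seq 'I_n) (pth : 'I_n -> seq 'I_n).
Hypothesis ST : search_tree c u v tq pth.
Notation par := (parent pth).

Definition solution (m : nat) (c' : coloring n k) : Prop :=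
  exists ch, [/\ shift_extension c [set u; v] ch c', wf_coloring c',
    colored c' = [set u; v] |: colored c & size ch <= m].

Lemma moves_colored e s c1 f : moves c e s c1 f -> c e = None ->
  c1 f = None /\ f |: colored c1 = e |: colored c.
Proof.
move=> H ce; elim: H => {s c1 f} [|s c1 f g _ [h1 h2] h3 h4 h5 h6]; first by [].
have h4' : c1 g != None by exact/eqP.
have nfg : f != g by apply: contra_notN h4 => /eqP <-.
split; first by rewrite ffunE eq_sym (negbTE nfg) eqxx.
rewrite -h2; apply/setP => x; rewrite !inE ffunE.
case: (eqVneq x f) => [->|_] /=; first by rewrite h4' orbT.
by case: (eqVneq x g) => [->|_] //=; rewrite h4'.
Qed.

Lemma colored_assign (c1 : coloring n k) f a :
  colored (assign c1 f a) = f |: colored c1.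
Proof.
apply/setP => x; rewrite !inE ffunE.
by case: (x == f).
Qed.

Lemma size_chain (s : seq 'I_n) : size (chain s) = (size s).-1.
Proof.
elim: s => [//|z [//|p r] IH].
by rewrite [chain _]/= -/(chain (p :: r)) size_rcons IH.
Qed.

Lemma solution_assign (z p : 'I_n) r (a : 'I_k) :
  vpath c u v par [:: z, p & r] ->
  missing (shifted c [:: z, p & r]) p a -> missing (shifted c [:: z, p & r]) z a ->
  solution (size r).+1 (assign (shifted c [:: z, p & r]) [set p; z] a).
Proof.
move=> H m1 m2; have F := vpath_facts wfc cuv (par_u ST) H.
have W := sf_wf F; have N := sf_none F (erefl _).
have [z' [p' [r' [[E1 E2 _] npz]]]] : exists z' p' r', [:: z, p & r] = [:: z', p' & r'] /\ p' != z'.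
  by apply: vpath_shape H.
subst z' p'.
have [s0 [z' [p' [r2 [[E3 E4 _] Ech mv un sh]]]]] := vpath_chain wfc cuv (par_u ST) H.
subst z' p'.
have [_ Ecol] := moves_colored mv cuv.
exists (s0 ++ [:: [set p; z]]); split.
- split; first by rewrite cats1 -Ech.
  by apply: moves_shift mv _; apply: assign_shift.
- exact: assign_wf.
- by rewrite colored_assign.
- by rewrite cats1 -Ech size_chain.
Qed.

(** It matters that [za] has the color [al] both before and after the shift: the edges of the chain
    other than [uv] have changed their colors, so [za] is not among them and can be appended. *)
Lemma solution_move (z p a : 'I_n) r (al f : 'I_k) :
  vpath c u v par [:: z, p & r] ->
  let cc := shifted c [:: z, p & r] in
  missing cc p al -> cc [set z; a] = Some al -> c [set z; a] = Some al ->
  missing cc z f -> missing cc a f ->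
  [/\ wf_coloring (move cc [set p; z] [set z; a]),
      move cc [set p; z] [set z; a] [set z; a] = None,
      missing (move cc [set p; z] [set z; a]) z f,
      missing (move cc [set p; z] [set z; a]) a f &
      solution (size r).+2 (assign (move cc [set p; z] [set z; a]) [set z; a] f)].
Proof.
move=> H cc m1 E1 E0 m2 m3; have F := vpath_facts wfc cuv (par_u ST) H.
have W := sf_wf F; have N := sf_none F (erefl _).
have [z' [p' [r' [[E3 E4 _] npz]]]] : exists z' p' r', [:: z, p & r] = [:: z', p' & r'] /\ p' != z'.
  by apply: vpath_shape H.
subst z' p'.
have [s0 [z' [p' [r2 [[E3 E4 _] Ech mv un sh]]]]] := vpath_chain wfc cuv (par_u ST) H.
subst z' p'.
have W2 : wf_coloring (move cc [set p; z] [set z; a]) by exact: move_wf W E1 m1 npz.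
have nfal : f != al by apply: contraTneq m2 => ->; rewrite (missing_nbr W E1).
have N2 : move cc [set p; z] [set z; a] [set z; a] = None.
  rewrite (moveE _ E1) eqxx; case: eqP => // Eza.
  by move: E1; rewrite Eza /cc N.
have nb x : nbr (move cc [set p; z] [set z; a]) x f = nbr cc x f.
  by rewrite (nbr_move W N E1 m1 npz) (negbTE nfal).
have nza : z != a by exact: wf_neq E1.
have m2' : missing (move cc [set p; z] [set z; a]) z f by rewrite /missing nb.
have m3' : missing (move cc [set p; z] [set z; a]) a f by rewrite /missing nb.
split=> //.
have mv2 := moves_step W N E1 m1 npz mv.
have [_ Ecol] := moves_colored mv2 cuv.
exists (rcons s0 [set p; z] ++ [:: [set z; a]]); split.
- split; last by apply: moves_shift mv2 _; apply: assign_shift.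
  rewrite cats1 -Ech rcons_uniq un andbT; apply/negP => zin.
  have := sh _ zin; rewrite -/cc E1 E0 eqxx; case: (eqVneq [set z; a] [set u; v]) => [Euv|_].
    by move: E0; rewrite Euv cuv.
  by move/(_ isT).
- exact: assign_wf.
- by rewrite colored_assign.
- by rewrite cats1 -Ech size_rcons size_chain.
Qed.

End Solutions.

Lemma shift_out n k (c : coloring n k) e s c' f : shift c e s c' -> f \notin s -> c' f = c f.
Proof.
elim=> {c e s c'} [c e a _ _|c e g s c' ce cg _ _ H IH].
  by rewrite inE ffunE => /negbTE ->.
rewrite inE negb_or => /andP[/negbTE nfe fs]; rewrite IH // ffunE nfe.
case: eqP => // Efg; move: fs; rewrite Efg.
by case: H => [?????|????????]; rewrite inE eqxx.
Qed.

Lemma card_recolored n k (c : coloring n k) e s c' : c e = None ->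
  shift_extension c e s c' -> #|recolored c c'| <= (size s).-1.
Proof.
move=> ce [un H].
have es : e \in s by case: H => [?????|????????]; rewrite inE eqxx.
have -> : (size s).-1 = size (rem e s) by rewrite size_rem.
apply: leq_trans (card_size _); apply: subset_leq_card; apply/subsetP => f.
rewrite !inE mem_rem_uniq // inE => /andP[h1 h2]; apply/andP; split.
  by apply: contra h1 => /eqP ->; rewrite ce.
by apply: contraR h2 => h; rewrite (shift_out H h).
Qed.

(** * The table of common missing colors *)

Section Common.
Variables (n k : nat) (c : coloring n k) (u v : 'I_n).
Variables (tq : seq 'I_n) (pth : 'I_n -> seq 'I_n) (trch : 'I_n -> seq ('I_n * 'I_k)).
Variable z : 'I_n.
Notation memf F := (has_memory c c tq pth trch F [::]).

Definition row (m : nat) (a : 'I_n) : seq 'I_k :=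
  [seq x <- take m (enum 'I_k) | missing c z x && missing c a x].

Definition row_code (m i j : nat) : nat :=
  if (insub i : option 'I_k) is Some al then
    if nbr c z al is Some a then nth 0 [seq (nat_of_ord x).+1 | x <- row m a] j else 0
  else 0.

(** The invariant of both loops: rows below [al] are complete, and row [al] takes the colors below
    [m] into account. *)
Definition table_part (al m i j : nat) : nat :=
  if i < al then row_code k i j else if i == al then row_code m i j else 0.

Definition common_table : nat -> nat -> nat := row_code k.

Lemma row_k a : row k a = common c z a.
Proof. by rewrite /row take_oversize // size_enum_ord. Qed.

Lemma memory_ext cc F F' S s : (forall i j, F i j = F' i j) ->
  has_memory c cc tq pth trch F S s -> has_memory c cc tq pth trch F' S s.
Proof. by move=> E H A i j; rewrite H; case: A => [|[|[|[|[|[|[|A]]]]]]] //=. Qed.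

Lemma row0 i j : row_code 0 i j = 0.
Proof.
rewrite /row_code; case: insub => // al; case: nbr => // a.
by rewrite /row take0 nth_nil.
Qed.

Lemma row_succ m (lt : m < k) a : row m.+1 a =
  if missing c z (Ordinal lt) && missing c a (Ordinal lt)
  then rcons (row m a) (Ordinal lt) else row m a.
Proof.
rewrite /row (take_nth (Ordinal lt)) ?size_enum_ord // filter_rcons.
have -> : nth (Ordinal lt) (enum 'I_k) m = Ordinal lt.
  by apply: val_inj; rewrite /= nth_enum_ord.
by [].
Qed.

Lemma wp_common s : memf (fun _ _ => 0) s ->
  regs s 23 = z -> regs s 6 = k -> regs s 7 = 0 ->
  wp common_code s (fun t s' => t <= k * (20 * k + 20) + 5 /\ memf common_table s').
Proof.
move=> H E23 E6 E7; rewrite /common_code; wsteps; set s1 := (X in wp _ X _).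
pose I i t (s' : state) := [/\ t <= i * (20 * k + 20), i <= k, regs s' 30 = i &
  memf (table_part i 0) s'].
apply: wp_conseq (wp_while (I := I) (N := k) _ _).
- move=> t s' [i [t0 [[h1 h2 h3 h4] hn ag Et]]].
  have Ei : i = k.
    apply/eqP; rewrite eqn_leq h2 leqNgt; apply: contra hn => /=.
    by rewrite h3 ag // /s1 /= E6.
  split; first by move: h1; rewrite Et Ei; lia.
  apply: memory_ext h4 => i' j'; rewrite /table_part Ei row0 /common_table.
  case: (ltnP i' k) => // ki; rewrite if_same /row_code insubF //.
  by rewrite ltnNge ki.
- split=> //; apply: (memory_ext (F := fun _ _ => 0)) => [i j|].
    by rewrite /table_part row0 if_same.
  exact: has_memory_regs H.
move=> al t s' [h1 h2 h3 h4] ag hb.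
have F6 : regs s' 6 = k by rewrite ag // /s1 /= E6.
have F7 : regs s' 7 = 0 by rewrite ag // /s1 /= E7.
have F23 : regs s' 23 = z by rewrite ag // /s1 /= E23.
have lt : al < k by move: hb; rewrite /= h3 F6.
split=> //; rewrite /common_row; wsteps; rewrite /= h3 F23 -[al]/(nat_of_ord (Ordinal lt)) (mem_table h4) /=.
have fin : (forall a, nbr c z (Ordinal lt) = Some a -> row k a = row 0 a) ->
    forall i j, table_part al 0 i j = table_part al.+1 0 i j.
  move=> e i j; rewrite /table_part !row0 !if_same ltnS.
  case: (ltngtP i al) => // ->; rewrite /row_code insubT /=.
  case E: (nbr c z _) => [a|] //; rewrite e //.
  by rewrite /row take0 nth_nil.
apply: wp_if; rewrite /= F7; last first.
  move=> hz; wsteps; split.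
  - by rewrite mulSn; lia.
  - by [].
  - by rewrite /= h3.
  apply: memory_ext (has_memory_regs (s' := set_reg (set_reg (set_reg s' 32 _) 29 0) 30 _) _ h4) => //.
  by apply: fin => a Ea; move: hz; rewrite Ea.
case Ea: (nbr c z (Ordinal lt)) => [a|] //= _; wsteps; rewrite /=.
set s2 := (X in wp _ X _).
pose J m t (s3 : state) := [/\ t <= m * 15, m <= k, regs s3 34 = m,
  regs s3 33 = size (row m a) & memf (table_part al m) s3].
apply: wp_conseq (wp_while (I := J) (N := k) _ _).
- move=> t' s3 [m [t0 [[g1 g2 g3 g4 g5] gn ag2 Et]]]; wsteps.
  have Em : m = k.
    apply/eqP; rewrite eqn_leq g2 leqNgt; apply: contra gn => /=.
    by rewrite g3 ag2 // /s2 /= F6.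
  split.
  - by rewrite mulSn Et; move: g1; rewrite Em; lia.
  - by [].
  - by rewrite /= ag2 // /s2 /= h3.
  apply: memory_ext (has_memory_regs (s' := set_reg s3 30 _) _ g5) => // i j.
  rewrite Em /table_part row0 if_same ltnS.
  by case: (ltngtP i al).
- by split=> //; rewrite /row take0.
move=> m t' s3 [g1 g2 g3 g4 g5] ag2 gb.
have G6 : regs s3 6 = k by rewrite ag2 // /s2 /= F6.
have G7 : regs s3 7 = 0 by rewrite ag2 // /s2 /= F7.
have G23 : regs s3 23 = z by rewrite ag2 // /s2 /= F23.
have G32 : regs s3 32 = a by rewrite ag2.
have G30 : regs s3 30 = al by rewrite ag2 // /s2 /= h3.
have ltm : m < k by move: gb; rewrite /= g3 G6.
split=> //; rewrite /common_step; wsteps; rewrite /= g3 G23 -[m]/(nat_of_ord (Ordinal ltm)) (mem_table g5) /=.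
have rE : row m.+1 a = if missing c z (Ordinal ltm) && missing c a (Ordinal ltm)
  then rcons (row m a) (Ordinal ltm) else row m a by exact: row_succ.
have same s4 : row m.+1 a = row m a -> arrs s4 = arrs s3 -> memf (table_part al m.+1) s4.
  move=> e es; apply: memory_ext (has_memory_regs es g5) => i j.
  rewrite /table_part; case: ltnP => // _; case: (eqVneq i al) => // ->.
  by rewrite /row_code insubT Ea e.
apply: wp_if; rewrite /= G7.
  move=> hz; wsteps; rewrite /= G32 g3 -[m]/(nat_of_ord (Ordinal ltm)) (mem_table g5) /=.
  have mz : missing c z (Ordinal ltm) by move: hz; rewrite /missing; case: nbr.
  apply: wp_if; rewrite /= G7 => hz'; wsteps.
    have ma : missing c a (Ordinal ltm) by move: hz'; rewrite /missing; case: nbr.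
    rewrite mz ma /= in rE; split; rewrite /= ?g4 ?rE ?size_rcons //; first by rewrite mulSn; lia.
    move=> A i j /=; rewrite G30 ?g4 ?g3.
    case: (A =P 5) => [->|nA]; last first.
      by rewrite g5; case: A nA => [|[|[|[|[|[|[|A]]]]]]].
    rewrite g5 /= /table_part; case: (ltngtP i al) => //= ->; rewrite ?ltnn ?eqxx /=.
    rewrite /row_code insubT Ea rE nth_codeE.
    by case: eqP.
  have ma : missing c a (Ordinal ltm) = false by move: hz'; rewrite /missing; case: nbr.
  rewrite ma andbF in rE; split; rewrite /= ?g4 ?rE //; first by rewrite mulSn; lia.
  exact: same.
move=> hz; have mz : missing c z (Ordinal ltm) = false by move: hz; rewrite /missing; case: nbr.
rewrite mz in rE; wsteps; split; rewrite /= ?g4 ?rE //; first by rewrite mulSn; lia.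
exact: same.
Qed.

End Common.

(** * One attempt at a vertex *)

Section Attempt.
Variables (n k : nat) (c : coloring n k) (u v : 'I_n).
Hypothesis wfc : wf_coloring c.
Hypothesis cuv : c [set u; v] = None.
Hypothesis nuv : u != v.
Variables (tq : seq 'I_n) (pth : 'I_n -> seq 'I_n) (trch : 'I_n -> seq ('I_n * 'I_k)).
Hypothesis ST : search_tree c u v tq pth.
Notation par := (parent pth).
Variable z : 'I_n.
Notation memz cc := (has_memory c cc tq pth trch (common_table c z) [::]).

Section OneReach.
Variables (w : 'I_n) (y : 'I_k).
Hypothesis wT : w \in tq.
Hypothesis cwz : c [set w; z] = Some y.
Hypothesis avy : avail c par (par w) y.

Notation sh := (shifted c (z :: pth w)).
Notation sol := (solution c u v (size (pth w)).+1).

Definition blocked (a : 'I_n) (f : 'I_k) : Prop :=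
  ~~ missing sh z f \/ ~~ missing sh a f.

Definition fails (al : 'I_k) : Prop := missing sh w al ->
  exists2 a, sh [set z; a] = Some al &
    ((a = par z \/ z = par a) /\ c [set z; a] <> Some al) \/
    (forall f, f = y \/ f \in take 3 (common c z a) -> blocked a f).

Let vp : vpath c u v par (z :: pth w).
Proof. exact: (vpath_reach wfc cuv ST wT cwz avy). Qed.

Let shE : [:: z, w & pth (par w)] = z :: pth w.
Proof. by rewrite -(st_cons ST wT). Qed.

Let sizeE : (size (pth (par w))).+2 = (size (pth w)).+1.
Proof. by rewrite (st_cons ST wT). Qed.

Definition consts (s : state) : Prop :=
  [/\ regs s 6 = k, regs s 7 = 0, regs s 8 = 1 & regs s 9 = 2] /\
  [/\ regs s 13 = w, regs s 23 = z & regs s 36 = y].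

Definition success (s : state) : Prop :=
  regs s 12 = 3 /\ exists2 c', memz c' s & sol c'.

Section OneColor.
Variables (al : 'I_k) (a : 'I_n).
Hypothesis mal : missing sh w al.
Hypothesis sza : sh [set z; a] = Some al.
Hypothesis cza : c [set z; a] = Some al.

Definition tried (fs : seq 'I_k) (s : state) : Prop :=
  (regs s 12 = 2 /\ regs s 31 = al.+1 /\ memz sh s /\
     forall f, f \in fs -> blocked a f) \/
  (success s /\ regs s 31 = k).

Lemma wp_try g s fs (f : 'I_k) : g != 19 ->
  consts s -> regs s 30 = al -> regs s 32 = a -> regs s g = f ->
  tried fs s -> wp (try_code g) s (fun t s' => t <= 30 /\ tried (f :: fs) s').
Proof.
move=> g19 [[E6 E7 E8 E9] [E13 E23 E36]] E30 E32 Eg T; rewrite /try_code.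
apply: wp_if => /= h12; last first.
  wsteps; split=> //; case: T => [[h _]|T]; first by rewrite h E9 in h12.
  by right; move: T => [[T1 [c' T2 T3]] T4]; split=> //; split=> //; exists c'.
case: T => [[_ [T2 [T3 T4]]]|[[T1 _] _]]; last by rewrite T1 E9 in h12.
wsteps; rewrite /= E23 Eg (mem_table T3).
have H3 x : memz sh (set_reg s 19 x) by apply: has_memory_regs T3.
have blk : blocked a f -> forall s', arrs s' = arrs s -> regs s' 12 = regs s 12 ->
    regs s' 31 = regs s 31 -> tried (f :: fs) s'.
  move=> B s' h1 h2 h3; left; rewrite h2 h3 (eqP h12) E9; split=> //; split=> //.
  split; first by apply: has_memory_regs T3.
  by move=> f'; rewrite inE => /orP[/eqP ->|/T4].
apply: wp_if; rewrite /= E7 => hz; last first.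
  wsteps; split=> //; apply: blk => //; left.
  by apply: contra hz; rewrite /missing => /eqP ->.
wsteps; rewrite /= (negbTE g19) E32 Eg (mem_table T3).
apply: wp_if; rewrite /= E7 => ha; last first.
  wsteps; split=> //; apply: blk => //; right.
  by apply: contra ha; rewrite /missing => /eqP ->.
have mz : missing sh z f by move: hz; rewrite /missing; case: nbr.
have ma : missing sh a f by move: ha; rewrite /missing; case: nbr.
have vp' := vp; rewrite -shE in vp'.
have F := vpath_facts wfc cuv (par_u ST) vp'.
have N := sf_none F (erefl _); have W := sf_wf F.
have nwz : w != z by exact: wf_neq cwz.
have := @solution_move n k c u v wfc cuv nuv tq pth ST z w a (pth (par w)) al f vp'.
rewrite shE => /(_ mal sza cza mz ma) [W2 N2 m2z m2a SOL].
rewrite sizeE in SOL; rewrite shE in N W.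
set s2 := set_reg _ _ _.
wsteps.
have M2 : memz sh s2 by apply: has_memory_regs T3.
apply: wp_conseq (wp_frame (@wp_move n k c tq pth trch _ s2 [::] sh 13 23 32 30 w z a al _ _ _ _ _ _ W N sza mal nwz M2)) => //.
move=> t3 s3 [[-> M3] ag3]; wsteps.
have R3 r : r != 19 -> regs s3 r = regs s2 r by move=> /negbTE hr; apply: ag3; rewrite /= !inE hr.
apply: wp_conseq (wp_frame (@wp_assign n k c tq pth trch _ s3 [::] _ 23 32 g z a f _ _ _ _ W2 N2 m2z m2a (wf_neq wfc cza) M3)) => //.
- move=> t4 s4 [[-> M4] ag4]; wsteps; split=> //; right; split.
    split=> //; exists (assign (move sh [set w; z] [set z; a]) [set z; a] f) => //.
  rewrite /= ag4 // R3 //.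
- by rewrite /= g19.
- by rewrite R3.
- by rewrite R3.
- by rewrite R3 // /s2 /= (negbTE g19).
Qed.

Lemma common_read s cc i : memz cc s ->
  arrs s 5 al i = nth 0 [seq (nat_of_ord x).+1 | x <- common c z a] i.
Proof.
move=> ->; rewrite /= /common_table /row_code valK.
by rewrite (some_nbr wfc cza) row_k.
Qed.

Lemma wp_candidate s ri i fs : consts s -> regs s 30 = al -> regs s 32 = a ->
  regs s ri = i -> tried fs s ->
  wp (candidate_code ri) s (fun t s' => t <= 40 /\
    tried (take 1 (drop i (common c z a)) ++ fs) s').
Proof.
move=> K E30 E32 Ei T; have [[E6 E7 E8 E9] [E13 E23 E36]] := K.
have [cc M] : exists cc, memz cc s.
  by case: T => [[_ [_ [T _]]]|[[_ [c' T _]] _]]; [exists sh|exists c'].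
rewrite /candidate_code; wsteps; rewrite /= E30 Ei (common_read i M).
have Tr s' : arrs s' = arrs s -> (forall r, r != 38 -> r != 29 -> regs s' r = regs s r) -> tried fs s'.
  move=> Ha Hr; case: T => [[h1 [h2 [h3 h4]]]|[[h1 [c' h2 h3]] h4]]; [left|right]; rewrite /success !Hr //.
    by split=> //; split=> //; split=> //; apply: has_memory_regs h3.
  by split=> //; split=> //; exists c' => //; apply: has_memory_regs h2.
case: (ltnP i (size (common c z a))) => hi; last first.
  rewrite nth_default ?size_map // drop_oversize //=.
  apply: wp_if => /= h; first by move: h; rewrite E7.
  wsteps; split; first by [].
  by apply: Tr => [//|r /negbTE h1 /negbTE h2]; rewrite /= h1 h2.
have [f Ef] : exists f : 'I_k, nth 0 [seq (nat_of_ord x).+1 | x <- common c z a] i = f.+1 /\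
   take 1 (drop i (common c z a)) = [:: f].
  have [f0] : exists f0 : 'I_k, True by case: (common c z a) hi => // x; exists x.
  move=> _; exists (nth f0 (common c z a) i); split; first by rewrite (nth_map f0).
  by rewrite (drop_nth f0 hi) /= take0.
rewrite Ef.1 Ef.2; apply: wp_if; rewrite /= ?E7 // => _; wsteps.
apply: wp_conseq (wp_try (fs := fs) (f := f) (g := 38) _ _ _ _ _ _) => //.
- by move=> t s' [h1 h2]; split=> //; lia.
Qed.

Lemma take3 (T : eqType) (l : seq T) x : x \in take 3 l ->
  x \in take 1 (drop 2 l) ++ take 1 (drop 1 l) ++ take 1 (drop 0 l).
Proof.
case: l => [|x0 [|x1 [|x2 l]]] //=; rewrite ?take0 //= !inE.
- by case/orP => ->; rewrite ?orbT.
- by case/or3P => ->; rewrite ?orbT.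
Qed.

End OneColor.

(** Only the stored tree has to be consulted: by [vpath_edge] a shift changes the color of [za] to
    [al] only if [za] is a tree edge, and for these the original color is in array 1. *)
Lemma wp_offpath s (al : 'I_k) (a : 'I_n) : sh [set z; a] = Some al ->
  consts s -> memz sh s -> regs s 32 = a -> regs s 31 = al.+1 ->
  wp offpath_code s (fun t s' => [/\ t <= 30, memz sh s' &
    if regs s' 37 == 1 then c [set z; a] = Some al
    else (a = par z \/ z = par a) /\ c [set z; a] <> Some al]).
Proof.
move=> sza [[E6 E7 E8 E9] [E13 E23 E36]] M E32 E31.
have nza : z != a.
  have F := vpath_facts wfc cuv (par_u ST) vp.
  exact: wf_neq (sf_wf F) sza.
have code (x y' : 'I_n) : x != y' -> (arrs s 1 x 0 == y'.+1) = (par x == y').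
  move=> nxy; rewrite (mem_parent M); case E: (pth x) => [|x0 r].
    by rewrite /parent E /= (negbTE nxy).
  by rewrite eqSS.
have code2 (x : 'I_n) : (arrs s 1 x 1 == al.+1) = (c [set par x; x] == Some al).
  rewrite (mem_pcolor M); case: (c _) => [g|]; last by [].
  by rewrite [ocode _]/= eqSS (inj_eq Some_inj).
pose ok := ~~ ((par a == z) && (c [set par a; a] != Some al)) &&
           ~~ ((par z == a) && (c [set par z; z] != Some al)).
have okP : if ok then c [set z; a] = Some al
    else (a = par z \/ z = par a) /\ c [set z; a] <> Some al.
  rewrite /ok; case: (eqVneq (par a) z) => [Ez|nz] /=.
    rewrite Ez negbK; case: eqP => [Ec|Ec] //=; last by split; [right|].
    case: (eqVneq (par z) a) => [Ea|na] //=.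
    by rewrite Ea [[set a; z]]setUC Ec eqxx.
  case: (eqVneq (par z) a) => [Ea|na] /=.
    rewrite Ea [[set a; z]]setUC negbK; case: eqP => // Ec.
    by split; [left|].
  have [//|[[h _]|[h _]]] := vpath_edge wfc cuv (par_u ST) vp sza.
    by rewrite h eqxx in na.
  by rewrite -h eqxx in nz.
have check s1 rx ry (x y' : 'I_n) : arrs s1 = arrs s -> x != y' ->
    rx \notin [:: 19; 29; 37; 38] -> ry \notin [:: 19; 29; 37; 38] ->
    regs s1 rx = x -> regs s1 ry = y' -> regs s1 7 = 0 -> regs s1 8 = 1 -> regs s1 31 = al.+1 ->
    wp (check_code rx ry) s1 (fun t s' => [/\ t <= 10, arrs s' = arrs s &
      regs s' 37 = if (par x == y') && (c [set par x; x] != Some al) then 0 else regs s1 37]).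
  move=> Ea nxy; rewrite !inE !negb_or.
  move=> /and4P[/negbTE n1 /negbTE n2 /negbTE n3 /negbTE n4].
  move=> /and4P[/negbTE n5 /negbTE n6 /negbTE n7 /negbTE n8] Ex Ey F7 F8 F31.
  rewrite /check_code; wsteps; rewrite /= n5 Ex Ey F7 Ea.
  apply: wp_if; rewrite /= code // => hz; last first.
    by rewrite (negbTE hz); wsteps; split.
  rewrite hz; wsteps; rewrite /= n1 n4 Ex F8 Ea.
  apply: wp_if; rewrite /= F31 code2 => hc; wsteps; split=> //=.
    by rewrite hc.
  by rewrite hc.
rewrite /offpath_code; wsteps.
apply: wp_conseq (wp_frame (check _ 32 23 a z _ _ _ _ _ _ _ _ _)) => //; last by rewrite eq_sym.
move=> t1 s1 [[t1b Ea R37] ag1].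
apply: wp_conseq (check s1 23 32 z a _ _ _ _ _ _ _ _ _) => //; try by rewrite ag1.
move=> t2 s2 [t2b Ea2 R372]; split; first by lia.
  by apply: has_memory_regs M.
rewrite R372 R37 /=; move: okP; rewrite /ok.
by case: ((par a == z) && _); case: ((par z == a) && _).
Qed.

Lemma sol_le m c' : m <= (size (pth w)).+1 -> solution c u v m c' -> sol c'.
Proof. by move=> h [ch [h1 h2 h3 h4]]; exists ch; split=> //; exact: leq_trans h. Qed.

Lemma wp_color s (al : 'I_k) : consts s -> regs s 30 = al -> regs s 12 = 2 ->
  memz sh s ->
  wp color_step s (fun t s' => t <= 260 /\
    ([/\ regs s' 12 = 2, regs s' 30 = al.+1, memz sh s' & fails al] \/
     (success s' /\ regs s' 30 = k))).
Proof.
move=> K E30 E12 M; have [[E6 E7 E8 E9] [E13 E23 E36]] := K.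
have F := vpath_facts wfc cuv (par_u ST) vp.
have W := sf_wf F.
have vp' := vp; rewrite -shE in vp'.
have N : sh [set w; z] = None.
  by have := sf_none (vpath_facts wfc cuv (par_u ST) vp') (erefl _); rewrite shE.
have nwz : w != z by exact: wf_neq cwz.
rewrite /color_step; wsteps; rewrite /= E13 E30 (mem_table M).
pose Q (t : nat) (s' : state) := t <= 250 /\
    ([/\ regs s' 12 = 2, regs s' 31 = al.+1, memz sh s' & fails al] \/
     (success s' /\ regs s' 31 = k)).
apply: (@wp_conseq _ _ Q).
  move=> t s1 [tb H]; wsteps; split; first by lia.
  case: H => [[h1 h2 h3 h4]|[[h1 [c' h2 h3]] h4]]; [left|right].
    by split=> //; apply: has_memory_regs h3.
  by split=> //; split=> //; exists c' => //; apply: has_memory_regs h2.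
apply: wp_if; rewrite /= E7 => hm; last first.
  wsteps; split=> //; left; split=> //.
  by rewrite /fails /missing => /eqP hn; move: hm; rewrite hn.
have mal : missing sh w al by move: hm; rewrite /missing; case: nbr.
rewrite /test_code; wsteps; rewrite /= E23 E30 (mem_table M).
apply: wp_if; rewrite /= E7 => hz.
  have mz : missing sh z al by move: hz; rewrite /missing; case: nbr.
  wsteps; set s1 := set_reg _ _ _.
  have M1 : memz sh s1 by apply: has_memory_regs M.
  apply: wp_conseq (wp_frame (@wp_assign n k c tq pth trch _ s1 [::] sh 13 23 30 w z al _ _ _ _ W N mal mz nwz M1)) => //.
  move=> t2 s2 [[-> M2] ag2]; wsteps; split=> //; right; split.
    split=> //; exists (assign sh [set w; z] al).
      by apply: has_memory_regs M2.
    apply: (@sol_le (size (pth (par w))).+1); first by rewrite -sizeE.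
    have := @solution_assign n k c u v wfc cuv nuv tq pth ST z w (pth (par w)) al vp'.
    by rewrite shE; apply.
  by rewrite /= ag2.
case Ea: (nbr sh z al) hz => [a|] //= _; wsteps; rewrite /=.
have sza := nbr_some Ea.
set s1 := set_reg _ 32 _.
have M1 : memz sh s1 by apply: has_memory_regs M.
apply: wp_conseq (wp_frame (@wp_offpath s1 al a sza _ M1 _ _)) => //.
  move=> t2 s2 [[t2b M2 H2] ag2].
  have R2 r : r \notin wregs offpath_code -> regs s2 r = regs s1 r by exact: ag2.
  have K2 : consts s2 by split; split; rewrite R2.
  have E82 : regs s2 8 = 1 by case: K2 => [[]].
  wsteps; apply: wp_if => /=; rewrite E82 => h37; last first.
    rewrite (negbTE h37) in H2.
    wsteps; split; first by lia.
    left; split; rewrite /= ?R2 //.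
    by move=> _; exists a => //; left.
  rewrite h37 in H2; have T0 : tried al a [::] s2 by left; rewrite !R2.
  wsteps.
  apply: wp_conseq (wp_frame (wp_try mal sza H2 _ K2 _ _ _ T0)) => //; last 3 first.
  - by rewrite R2.
  - by rewrite R2.
  - by case: K2 => _ [_ _ ->].
  move=> t3 s3 [[t3b T3] ag3].
  have R3 r : r \notin wregs (try_code 36) -> r \notin wregs offpath_code -> regs s3 r = regs s1 r.
    by move=> h1 h2; rewrite ag3 // R2.
  have K3 : consts s3 by split; split; rewrite R3.
  wsteps; apply: wp_conseq (wp_frame (wp_candidate mal sza H2 (i := 0) K3 _ _ _ T3)); rewrite ?R3 //.
  move=> t4 s4 [[t4b T4] ag4].
  have R4 r : r \notin wregs (candidate_code 7) -> r \notin wregs (try_code 36) ->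
      r \notin wregs offpath_code -> regs s4 r = regs s1 r.
    by move=> h1 h2 h3; rewrite ag4 // R3.
  have K4 : consts s4 by split; split; rewrite R4.
  wsteps; apply: wp_conseq (wp_frame (wp_candidate mal sza H2 (i := 1) K4 _ _ _ T4)); rewrite ?R4 //.
  move=> t5 s5 [[t5b T5] ag5].
  have R5 r : r \notin wregs (candidate_code 8) -> r \notin wregs (candidate_code 7) ->
      r \notin wregs (try_code 36) -> r \notin wregs offpath_code -> regs s5 r = regs s1 r.
    by move=> h1 h2 h3 h4; rewrite ag5 // R4.
  have K5 : consts s5 by split; split; rewrite R5.
  wsteps; apply: wp_conseq (wp_candidate mal sza H2 (i := 2) K5 _ _ _ T5); rewrite ?R5 //.
  move=> t6 s6 [t6b T6]; split; first by lia.
  case: T6 => [[h1 [h2 [h3 h4]]]|[h1 h2]]; [left|by right].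
  split=> // _; exists a => //; right => f [->|/take3 hf]; apply: h4.
    by rewrite !mem_cat inE eqxx !orbT.
  move: hf; rewrite !mem_cat => /orP[->//|/orP[->|->]]; rewrite ?orbT //.
Qed.

Definition base (s : state) : Prop :=
  [/\ regs s 4 = u, regs s 5 = v & regs s 23 = z] /\
  [/\ regs s 6 = k, regs s 7 = 0, regs s 8 = 1 & regs s 9 = 2].

Lemma wp_attempt s j : base s -> regs s 12 = 2 -> regs s 35 = j ->
  j < size (trch z) -> nth (w, y) (trch z) j = (w, y) -> memz c s ->
  wp attempt_code s (fun t s' => t <= 60 * size (pth w) + 261 * k + 100 /\
    (success s' \/ [/\ regs s' 12 = 2, regs s' 35 = j.+1, memz c s' & forall al, fails al])).
Proof.
move=> [[E4 E5 E23] [E6 E7 E8 E9]] E12 E35 js Ej M.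
rewrite /attempt_code; wsteps; rewrite /= E23 E35 (mem_reach M) (mem_reachc M).
rewrite !(nth_map (w, y)) // Ej /=; set s1 := set_reg _ 36 _.
have M1 : memz c s1 by apply: has_memory_regs M.
apply: wp_conseq (wp_frame (wp_path wfc cuv nuv ST wT M1 _ _ _ _ _)) => //.
move=> t2 s2 [[t2b M2 E26 _] ag2]; wsteps.
have R2 r : r \notin wregs path_code -> regs s2 r = regs s1 r by exact: ag2.
have [r Er] := pth_shape ST wT.
have vp2 : vpath c u v par [:: z, w, par w & r] by rewrite -Er.
have [a' [[W N E' M' nqp] Ea']] := vpath_move wfc cuv (par_u ST) vp2.
have Eaa : a' = y by move: Ea'; rewrite cwz => -[].
subst a'; rewrite -Er in W N E' M'.
have Sh : sh = move (shifted c (pth w)) [set par w; w] [set w; z] by rewrite {1}Er Er.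
apply: wp_conseq (wp_frame (@wp_move n k c tq pth trch _ s2 [::] _ 26 13 23 36 (par w) w z y _ _ _ _ _ _ W N E' M' nqp M2)) => //; try by rewrite R2.
move=> t3 s3 [[-> M3] ag3]; rewrite -Sh in M3.
have R3 r' : r' \notin wregs path_code -> r' != 19 -> regs s3 r' = regs s1 r'.
  move=> h1 /negbTE h2; rewrite ag3 ?R2 //= !inE h2 //.
have E263 : regs s3 26 = par w by rewrite ag3.
wsteps; set s4 := set_reg s3 30 0.
have K4 : consts s4 by split; split; rewrite /= R3.
pose I i t (s' : state) := (t <= i * 261 /\ i <= k) /\
    ([/\ regs s' 12 = 2, regs s' 30 = i, i <= k, memz sh s' &
        forall al : 'I_k, al < i -> fails al] \/
     (success s' /\ regs s' 30 = k)).
apply: wp_conseq (wp_while (I := I) (N := k) _ _).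
- move=> t5 s5 [i [t0 [[[ti tik] H5] hn ag5 Et5]]]; wsteps.
  have R5 r' : r' \notin wregs color_step -> regs s5 r' = regs s4 r' by exact: ag5.
  have Eb : holds s5 (Teq 12 9) = (regs s5 12 == 2) by rewrite /= (R5 9) //= R3 //= E9.
  case: H5 => [[h1 h2 h3 h4 h5]|[[h1 [c' h2 h3]] h4]]; last first.
    apply: wp_if; rewrite Eb h1 // => _; wsteps; split.
      by rewrite Et5; move: ti tik t2b; rewrite mulnC [261 * k]mulnC; nia.
    by left; split=> //; exists c' => //; apply: has_memory_regs h2.
  have Ei : i = k.
    apply/eqP; rewrite eqn_leq h3 leqNgt; apply: contra hn => /=.
    by rewrite h2 R5 //= R3 //= E6.
  apply: wp_if; rewrite Eb h1 // => _; wsteps.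
  have nwz : w != z by exact: wf_neq cwz.
  have nzp : z != par w by exact: (par_nochild wfc cuv ST wT cwz avy).
  have W2 : wf_coloring sh by exact: sf_wf (vpath_facts wfc cuv (par_u ST) vp).
  have C1 : sh [set z; w] = None.
    rewrite Sh (moveE _ E') [[set z; w]]setUC eqxx; case: eqP => // /eqP.
    by rewrite [[set par w; w]]setUC => /eqP/set2_inj/eqP; rewrite (negbTE nzp).
  have C2 : sh [set w; par w] = Some y.
    by rewrite Sh (moveE _ E') [[set w; par w]]setUC eqxx.
  have C3 : missing sh z y.
    rewrite /missing Sh (nbr_move W N E' M' nqp) eqxx.
    by rewrite [z == w]eq_sym (negbTE nwz) (negbTE nzp) !eqxx.
  apply: wp_conseq (wp_frame (@wp_move n k c tq pth trch _ s5 [::] _ 23 13 26 36 z w (par w) y _ _ _ _ _ _ W2 C1 C2 C3 _ h4)) => //; try by rewrite R5 //= R3.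
    move=> t6 s6 [[-> M6] ag6]; rewrite {1}Sh (move_moveK N E') in M6.
    have R6 r' : r' \notin wregs color_step -> r' != 19 -> regs s6 r' = regs s4 r'.
      by move=> g1 /negbTE g2; rewrite ag6 ?R5 //= !inE g2.
    apply: wp_conseq (wp_frame (wp_unshift wfc cuv nuv ST wT M6 _ _ _)); try by rewrite R6 //= R3.
    move=> t7 s7 [[t7b M7] ag7]; wsteps; split.
      by rewrite Et5; move: ti; rewrite Ei; lia.
    right; split.
    - by rewrite /= ag7 // ag6.
    - by rewrite /= ag7 // R6 //= R3 //= E35.
    - by apply: has_memory_regs M7.
    - by move=> al; apply: h5; rewrite Ei.
  by rewrite eq_sym.
- by split=> //; left; split=> //; rewrite /= R3.
- move=> i t5 s5 [[ti tik] H5] ag5 hb.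
  have R5 r' : r' \notin wregs color_step -> regs s5 r' = regs s4 r' by exact: ag5.
  have K5 : consts s5 by split; split; rewrite R5 //= R3.
  have F6 : regs s5 6 = k by case: K5 => [[]].
  case: H5 => [[h1 h2 _ h3 h4]|[_ h]]; last by move: hb; rewrite /= h F6 ltnn.
  have ik : i < k by move: hb; rewrite /= h2 F6.
  split=> //; apply: wp_conseq (@wp_color s5 (Ordinal ik) K5 h2 h1 h3).
  move=> t6 s6 [t6b H6]; split; first by split; [rewrite mulSn; lia|].
  case: H6 => [[g1 g2 g3 g4]|g]; [left|by right].
  split=> // al; rewrite ltnS leq_eqVlt => /orP[/eqP Eal|]; last exact: h4.
  by rewrite (_ : al = Ordinal ik) //; exact: val_inj.
Qed.

End OneReach.
End Attempt.

(** * Finishing and cleaning up *)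

Section Finish.
Variables (n k Delta C b : nat) (c : coloring n k) (u v : 'I_n).
Hypothesis wfc : wf_coloring c.
Hypothesis cuv : c [set u; v] = None.
Hypothesis nuv : u != v.
Hypothesis kE : k = Delta + C.
Hypothesis CD : C + 2 <= Delta.
Hypothesis C1 : 1 <= C.
Hypothesis bC : b <= C.
Hypothesis ineq : Delta * (Delta - C + 1) < b * (C - 1) + 2.
Hypothesis degD : forall x, #|present c x| <= Delta.
Hypothesis degu : #|present c u| < Delta.
Hypothesis degv : #|present c v| < Delta.

(** Parents of vertices at positions up to [hd] are again at such positions, or [u]. So a path is a
    list without repetitions in a set of [hd + 2] vertices, and following it is paid for by the
    expanded vertices. *)
Lemma path_size tq pth trch hd f0 w : search_inv c u v tq pth trch hd f0 ->
  w \in tq -> index w tq <= hd -> size (pth w) <= hd.+2.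
Proof.
move=> SI wT iw; have ST := si_tree SI; have [U _] := si_tq SI.
have H m x : size (pth x) <= m -> x \in tq -> index x tq <= hd ->
    forall y, y \in pth x -> y = u \/ (y \in tq /\ index y tq <= hd).
  elim: m x => [|m IH] x; first by rewrite leqn0 size_eq0 => /eqP E xT; move: (st_cons ST xT); rewrite E.
  move=> sx xT ix y; rewrite (st_cons ST xT) inE => /orP[/eqP ->|]; first by right.
  case: (eqVneq x v) => [->|nv].
    by rewrite (par_v ST) (st_u ST) inE => /eqP ->; left.
  apply: IH; [|exact: (st_par ST)|exact: (si_pidx SI)].
  by move: sx; rewrite (st_cons ST xT).
have sub : {subset pth w <= u :: take hd.+1 tq}.
  move=> y /(H _ _ (leqnn _) wT iw) [->|[yT iy]]; first by rewrite inE eqxx.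
  by rewrite inE (in_take _ yT) ltnS iy orbT.
apply: leq_trans (uniq_leq_size (st_uniq ST wT) sub) _.
by rewrite /= ltnS size_take; case: ltnP => // h; exact: leq_trans h _.
Qed.

Section Loop.
Variables (tq : seq 'I_n) (pth : 'I_n -> seq 'I_n) (trch : 'I_n -> seq ('I_n * 'I_k)).
Variables (hd f0 : nat) (z : 'I_n).
Hypothesis SI : search_inv c u v tq pth trch hd f0.
Hypothesis sz : size (trch z) = b.+1.
Let ST := si_tree SI.
Notation par := (parent pth).
Notation memz cc := (has_memory c cc tq pth trch (common_table c z) [::]).

Let d0 : 'I_n * 'I_k.
Proof. by case: (trch z) sz => [//|d l] _. Qed.

Let w (j : nat) := (nth d0 (trch z) j).1.
Let y (j : nat) := (nth d0 (trch z) j).2.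

Lemma reach_facts j : j < b.+1 -> [/\ w j \in tq, c [set w j; z] = Some (y j),
  avail c par (par (w j)) (y j) & index (w j) tq <= hd].
Proof.
move=> jb; have : (w j, y j) \in trch z by rewrite -surjective_pairing mem_nth ?sz.
move/(si_reach SI) => [h1 h2 h3 h4]; split=> //.
by case: h4 => [|[->]] //; exact: ltnW.
Qed.

(** This is why the loop over the reaches needs no test that a next reach exists. *)
Lemma some_attempt_succeeds :
  ~ (forall j, j < b.+1 -> forall al, fails c pth z (w j) (y j) al).
Proof.
move=> fl.
have zV : z \in u :: tq.
  by case: (trch z) sz (si_vis SI (z := z)) => [//|[x f] l] _ h; apply: (h x f); rewrite inE eqxx.
apply: (fail_absurd wfc cuv nuv kE CD C1 bC ineq degD degu degv ST (z := z)
  (w := fun j : 'I_b.+1 => w j) (y := fun j : 'I_b.+1 => y j)).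
- move=> i j E; apply: val_inj; apply/eqP.
  rewrite -(nth_uniq d0.1 _ _ (si_uniq SI z)) ?size_map ?sz; [|exact: ltn_ord|exact: ltn_ord].
  have il (i' : 'I_b.+1) : i' < size (trch z) by rewrite sz; exact: ltn_ord i'.
  by rewrite (nth_map d0) ?il // (nth_map d0) ?il //; apply/eqP.
- by move=> j; have [] := reach_facts (ltn_ord j).
- by move=> j; have [] := reach_facts (ltn_ord j).
- by move=> j; have [] := reach_facts (ltn_ord j).
- move: zV; rewrite inE => /orP[/eqP ->|zT]; first by left.
  case: (eqVneq z v) => [->|nv]; first by right; left.
  (* The visit that put [z] into the tree was recorded as a reach, so the parent of [z] is one of
     the [w j]. *)
  right; right; have [f hf] := si_first SI zT nv.
  have hj : index (par z, f) (trch z) < b.+1 by rewrite -sz index_mem.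
  by exists (Ordinal hj); split=> //; rewrite /w /= nth_index.
- by move=> j al m; have [a h1 h2] := fl j (ltn_ord j) al m; exists a.
Qed.

Definition finished (s : state) : Prop := regs s 12 = 3 /\
  exists x, x \in tq /\ exists2 c', memz c' s & solution c u v (size (pth x)).+1 c'.

Lemma wp_attempts s : base k u v z s -> regs s 12 = 2 -> regs s 35 = 0 -> memz c s ->
  wp (While (Teq 12 9) attempt_code) s (fun t s' =>
    t <= b.+1 * (60 * hd.+2 + 261 * k + 101) + 1 /\ finished s').
Proof.
move=> B E12 E35 M.
have [_ [_ _ _ E9]] := B.
pose I j t (s' : state) := [/\ t <= j * (60 * hd.+2 + 261 * k + 101), j <= b.+1 &
  (([/\ regs s' 12 = 2, regs s' 35 = j, memz c s' &
    forall i, i < j -> forall al, fails c pth z (w i) (y i) al]) \/ finished s')].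
apply: wp_conseq (wp_while (I := I) (N := b.+1) _ _).
- move=> t s' [j [t0 [[h1 h2 h3] hn ag Et]]].
  case: h3 => [[h3 _ _ _]|h3]; first by move: hn; rewrite /= h3 ag ?E9.
  split=> //; rewrite Et addn1 ltnS; apply: leq_trans h1 _.
  by rewrite leq_mul2r h2 orbT.
- by split=> //; left.
move=> j t s' [h1 h2 h3] ag hb.
have B' : base k u v z s' by case: B => [[? ? ?] [? ? ? ?]]; split; split; rewrite ag.
case: h3 => [[g1 g2 g3 g4]|[g1 _]]; last by move: hb; rewrite /= g1 ag ?E9.
have jb : j < b.+1.
  rewrite ltn_neqAle h2 andbT; apply/eqP => jE.
  by apply: some_attempt_succeeds => i ib; apply: g4; rewrite jE.
split=> //; have [r1 r2 r3 r4] := reach_facts jb.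
have Ej : nth (w j, y j) (trch z) j = (w j, y j).
  by rewrite (set_nth_default d0) ?sz // -surjective_pairing.
have js : j < size (trch z) by rewrite sz.
apply: wp_conseq (wp_attempt wfc cuv nuv ST r1 r2 r3 B' g1 g2 js Ej g3).
move=> t1 s1 [t1b H1]; split=> //.
  by have := path_size SI r1 r4; rewrite mulSn; lia.
case: H1 => [[k1 [c' k2 k3]]|[k1 k2 k3 k4]]; [right|left].
  by split=> //; exists (w j); split=> //; exists c'.
split=> // i; rewrite ltnS leq_eqVlt => /orP[/eqP ->|]; [exact: k4|exact: g4].
Qed.

Lemma wp_finish s : base k u v z s -> regs s 12 = 2 ->
  has_memory c c tq pth trch (fun _ _ => 0) [::] s ->
  wp finish_code s (fun t s' =>
    t <= k * (20 * k + 20) + b.+1 * (60 * hd.+2 + 261 * k + 101) + 10 /\ finished s').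
Proof.
move=> B E12 M; rewrite /finish_code; wsteps.
have [[E4 E5 E23] [E6 E7 E8 E9]] := B.
apply: wp_conseq (wp_frame (wp_common M E23 E6 E7)) => t1 s1 [[t1b M1] ag1]; wsteps.
apply: wp_conseq (@wp_attempts _ _ _ _ _).
- by move=> t2 s2 [t2b H2]; split=> //; lia.
- by split; split; rewrite /= ag1.
- by rewrite /= ag1.
- by [].
- by apply: has_memory_regs M1.
Qed.

End Loop.
End Finish.

Section Cleanup.
Variables (n k : nat) (c cc : coloring n k).
Notation memg tq pth trch F := (has_memory c cc tq pth trch F [::]).

Definition clear_at (T : Type) (g : 'I_n -> seq T) (x : 'I_n) : 'I_n -> seq T :=
  fun y => if y == x then [::] else g y.

Lemma wp_clear_vertex s tq pth trch F (x : 'I_n) :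
  (forall y, c [set y; y] = None) ->
  memg tq pth trch F s -> regs s 40 = x -> regs s 7 = 0 -> regs s 8 = 1 -> regs s 9 = 2 ->
  wp clear_vertex s (fun t s' => t <= 6 * size (trch x) + 10 /\
    memg tq (clear_at pth x) (clear_at trch x) F s').
Proof.
move=> cl H E40 E7 E8 E9; rewrite /clear_vertex; wsteps.
rewrite /= E40 E9 (mem_count H); set s1 := set_reg _ _ _.
pose cut r y := if y == x then take r (trch x) else trch y.
pose I i t (s' : state) := exists r, [/\ t = i * 5, r + i = size (trch x), regs s' 21 = r &
  memg tq pth (cut r) F s'].
apply: wp_conseq (wp_while (I := I) (N := size (trch x)) _ _).
- move=> t s' [i [t0 [[r [h1 h2 h3 h4]] hn ag Et]]]; wsteps.
  have r0 : r = 0 by move: hn; rewrite /= h3 ag // /s1 /= E7; case: (r).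
  split; first by rewrite Et h1 -h2 r0; lia.
  have [F40 F7 F8] : [/\ regs s' 40 = x, regs s' 7 = 0 & regs s' 8 = 1] by rewrite !ag.
  move=> A i' j' /=; rewrite F40 F7 F8 h4 r0.
  case: A => [|[|[|[|[|[|[|A]]]]]]] //=.
  (* With its path erased, [x] becomes its own parent, and the color cell must hold the code of the
     loop at [x], which is 0 by [cl]. *)
  + rewrite -insub_ordE; case: (insub i') => [p|] //; rewrite (inj_eq Some_inj).
    rewrite /clear_at /parent /cut; case: (eqVneq p x) => [->|_] //=.
    by case: j' => [|[|[|j']]] //=; rewrite ?cl ?take0.
  + by case: (insub i') => [p|] //; rewrite /clear_at /cut; case: eqP => // _; rewrite take0.
  + by case: (insub i') => [p|] //; rewrite /clear_at /cut; case: eqP => // _; rewrite take0.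
- exists (size (trch x)); split=> //; first by rewrite addn0.
  move=> A i j; rewrite H; case: A => [|[|[|[|[|[|[|A]]]]]]] //=;
    case: (insub i) => [p|] //; rewrite /cut; case: (eqVneq p x) => [->|_] //; by rewrite take_size.
- move=> i t s' [r [h1 h2 h3 h4]] ag hb.
  have [F40 F7 F9] : [/\ regs s' 40 = x, regs s' 7 = 0 & regs s' 9 = 2] by rewrite !ag.
  have rp : 0 < r by move: hb; rewrite /= h3 F7.
  have Er : r = r.-1.+1 by rewrite prednK.
  split; first by lia.
  rewrite /clear_step; wsteps; exists r.-1; split; rewrite /= ?h3 //; try by lia.
  have rs : r.-1 < size (trch x) by lia.
  have nthE (T : Type) (g : T -> nat) (l : seq T) : r.-1 < size l -> forall j',
      nth 0 [seq g p | p <- take r.-1 l] j' =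
      if j' == r.-1 then 0 else nth 0 [seq g p | p <- take r l] j'.
    move=> hl j'; rewrite !map_take; case: (ltngtP j' r.-1) => hj.
    - by rewrite !nth_take //; lia.
    - by rewrite !nth_default // size_take size_map; case: ifP => hs; lia.
    - by rewrite nth_default // size_take size_map hj; case: ifP => hs; lia.
  move=> A i' j' /=; rewrite F40 F7 F9 h4.
  case: A => [|[|[|[|[|[|[|A]]]]]]] //=.
  + rewrite -insub_ordE; case: (insub i') => [p|] //; rewrite (inj_eq Some_inj) /cut.
    case: (eqVneq p x) => [->|_] //=; case: j' => [|[|[|j']]] //=.
    by rewrite size_take rs.
  + rewrite -insub_ordE; case: (insub i') => [p|] //; rewrite (inj_eq Some_inj) /cut.
    by case Ep : (p == x); rewrite //= nthE.
  + rewrite -insub_ordE; case: (insub i') => [p|] //; rewrite (inj_eq Some_inj) /cut.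
    by case Ep : (p == x); rewrite //= nthE.
Qed.

Lemma wp_clear_rows s F : (forall y, c [set y; y] = None) ->
  has_memory c cc [::] (fun _ => [::]) (fun _ => [::]) F [::] s ->
  (forall i j, k <= i -> F i j = 0) -> (forall i j, k <= j -> F i j = 0) ->
  regs s 6 = k -> regs s 7 = 0 ->
  wp (Const 30 0 ;; While (Tlt 30 6) clear_row) s (fun t s' =>
    t <= k * (3 * k + 10) + 5 /\ stores s' cc).
Proof.
move=> cl H F1 F2 E6 E7; wsteps; set s1 := set_reg _ _ _.
pose F' al m i j := if (i < al) || ((i == al) && (j < m)) then 0 else F i j.
pose I i t (s' : state) := [/\ t <= i * (3 * k + 10), i <= k, regs s' 30 = i &
  has_memory c cc [::] (fun _ => [::]) (fun _ => [::]) (F' i 0) [::] s'].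
apply: wp_conseq (wp_while (I := I) (N := k) _ _).
- move=> t s' [i [t0 [[h1 h2 h3 h4] hn ag Et]]].
  have Ei : i = k.
    apply/eqP; rewrite eqn_leq h2 leqNgt; apply: contra hn => /=.
    by rewrite h3 ag // /s1 /= E6.
  split; first by move: h1; rewrite Et Ei; lia.
  move=> A i' j'; rewrite h4; case: A => [|[|[|[|[|[|[|A]]]]]]] //=.
  + by case: (insub i') => [p|] //; case: j' => [|[|[|j']]] //=; rewrite /parent /= cl.
  + by rewrite nth_nil if_same.
  + by case: (insub i') => [p|] //; rewrite nth_nil.
  + by case: (insub i') => [p|] //; rewrite nth_nil.
  + by rewrite /F' Ei andbF orbF; case: ltnP => // /F1.
  + by rewrite nth_nil if_same.
- split=> //; apply: (memory_ext (F := F)) => [i j|]; first by rewrite /F' /= andbF.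
  by apply: has_memory_regs H.
move=> al t s' [h1 h2 h3 h4] ag hb.
have [G6 G7] : regs s' 6 = k /\ regs s' 7 = 0 by rewrite !ag.
have lt : al < k by move: hb; rewrite /= h3 G6.
split=> //; rewrite /clear_row; wsteps; set s2 := set_reg _ _ _.
pose J m t (s3 : state) := [/\ t <= m * 3, m <= k, regs s3 34 = m &
  has_memory c cc [::] (fun _ => [::]) (fun _ => [::]) (F' al m) [::] s3].
apply: wp_conseq (wp_while (I := J) (N := k) _ _).
- move=> t' s3 [m [t0 [[g1 g2 g3 g4] gn ag2 Et]]]; wsteps.
  have Em : m = k.
    apply/eqP; rewrite eqn_leq g2 leqNgt; apply: contra gn => /=.
    by rewrite g3 ag2 // /s2 /= G6.
  split; rewrite /= ?ag2 ?h3 //; first by rewrite mulSn Et; move: g1; rewrite Em; lia.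
    by rewrite /s2 /= h3.
  apply: memory_ext (has_memory_regs (s' := set_reg s3 30 _) _ g4) => // i j.
  rewrite /F' Em andbF orbF ltnS; case: (ltngtP i al) => //= _.
  by case: ltnP => // /F2.
- by split=> //; apply: has_memory_regs h4.
move=> m t' s3 [g1 g2 g3 g4] ag2 gb.
have [K6 K7 K30] : [/\ regs s3 6 = k, regs s3 7 = 0 & regs s3 30 = al] by rewrite !ag2.
have ltm : m < k by move: gb; rewrite /= g3 K6.
split=> //; wsteps; split; rewrite /= ?g3 //; first by rewrite mulSn; lia.
move=> A i j /=; rewrite K7 K30 g4; case: A => [|[|[|[|[|[|[|A]]]]]]] //=.
rewrite /F' ltnS [j <= m]leq_eqVlt; case: (ltngtP i al) => //= _.
by case: (j == m).
Qed.

Lemma wp_cleanup s tq pth trch F (u : 'I_n) :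
  (forall y, c [set y; y] = None) ->
  (forall i j, k <= i -> F i j = 0) -> (forall i j, k <= j -> F i j = 0) ->
  (forall x, x \notin u :: tq -> pth x = [::] /\ trch x = [::]) ->
  memg tq pth trch F s -> regs s 4 = u -> regs s 6 = k -> regs s 7 = 0 ->
  regs s 8 = 1 -> regs s 9 = 2 -> regs s 11 = size tq ->
  wp cleanup_code s (fun t s' =>
    t <= 6 * (\sum_(z < n) size (trch z)) + 20 * size tq + k * (3 * k + 10) + 30 /\
    stores s' cc).
Proof.
move=> cl F1 F2 out M E4 E6 E7 E8 E9 E11; rewrite /cleanup_code; wstep; wstep; wstep.
have sumE (g : 'I_n -> seq ('I_n * 'I_k)) x :
    \sum_(z < n) size (clear_at g x z) + size (g x) = \sum_(z < n) size (g z).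
  rewrite (bigD1 x) //= [in RHS](bigD1 x) //= {1}/clear_at eqxx add0n addnC.
  by congr (_ + _); apply: eq_bigr => z nz; rewrite /clear_at (negbTE nz).
have M0 : memg tq pth trch F (set_reg s 40 (regs s 4)) by apply: has_memory_regs M.
apply: wp_conseq (wp_frame (wp_clear_vertex (x := u) cl M0 _ _ _ _)) => //.
move=> t1 s1 [[t1b M1] ag1]; wstep.
(* The number of reaches still stored serves as a potential: clearing a vertex takes time
   proportional to its own reaches, which then leave the sum. *)
pose I i t (s' : state) := exists m pth' trch', [/\ [/\ m + i = size tq, regs s' 11 = m &
  t + 6 * (\sum_(z < n) size (trch' z)) <= 6 * (\sum_(z < n) size (clear_at trch u z)) + 20 * i],
  memg (take m tq) pth' trch' F s' &
  forall x, x \notin take m tq -> pth' x = [::] /\ trch' x = [::]].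
apply: wp_conseq (wp_while (I := I) (N := size tq) _ _).
- move=> t s' [i [t0 [[m [pth' [trch' [[h1 h2 h3] h4 h5]]]] hn ag Et]]].
  have m0 : m = 0 by move: hn; rewrite /= h2 ag // ag1 //= E7; case: (m).
  have M2 : memg [::] (fun _ => [::]) (fun _ => [::]) F s'.
    move=> A i' j'; rewrite h4 m0; case: A => [|[|[|[|[|[|[|A]]]]]]] //=.
    + case: (insub i') => [p|] //; have [|-> ->] := h5 p; first by rewrite m0 take0.
      by rewrite /parent; have [|-> _] := h5 p; first by rewrite m0 take0.
    + by rewrite take0.
    + by case: (insub i') => [p|] //; have [|_ ->] := h5 p; first by rewrite m0 take0.
    + by case: (insub i') => [p|] //; have [|_ ->] := h5 p; first by rewrite m0 take0.
  apply: wp_conseq (wp_clear_rows cl M2 F1 F2 _ _) => [t2 s2 [t2b H2]||].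
  + split=> //; have := sumE trch u; have Ei : i = size tq by rewrite -h1 m0.
    by move: h3 t1b t2b; rewrite Ei Et; lia.
  + by rewrite ag // ag1.
  + by rewrite ag // ag1.
- exists (size tq), (clear_at pth u), (clear_at trch u); split.
  + by split; rewrite ?ag1 //= ?addn0 ?muln0 ?addn0.
  + by rewrite take_size.
  + move=> x; rewrite take_size => xT; rewrite /clear_at; case: (x =P u) => // nx.
    by apply: out; rewrite inE negb_or xT andbT; apply/eqP.
move=> i t s' [m [pth' [trch' [[h1 h2 h3] h4 h5]]]] ag hb.
have [G7 G8 G9] : [/\ regs s' 7 = 0, regs s' 8 = 1 & regs s' 9 = 2] by rewrite !ag // !ag1.
have mp : 0 < m by move: hb; rewrite /= h2 G7.
have ms : m.-1 < size tq by lia.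
split; first by lia.
rewrite /clear_tree_step; wstep; wstep; wstep; wstep; wstep; wstep.
pose x := nth u tq m.-1.
set s2 := (X in wp _ X _).
have Em : m = m.-1.+1 by rewrite prednK.
have tE : take m tq = rcons (take m.-1 tq) x by rewrite {1}Em (take_nth u).
have M2 : memg (take m.-1 tq) pth' trch' F s2.
  move=> A i' j' /=; rewrite h2 G7 h4; case: A => [|[|[|[|[|[|[|A]]]]]]] //=.
  case: (j' == 0); rewrite ?andbF ?andbT //= tE map_rcons nth_rcons size_map size_takel ?(ltnW ms) //.
  case: (ltngtP i' m.-1) => // hi; first by rewrite nth_default // size_map size_takel // ltnW.
  by rewrite nth_default // size_map size_takel ?hi // ltnW.
have E40 : regs s2 40 = x.
  by rewrite /= h2 G7 h4 /= map_take nth_take ?(nth_map u) // {2}Em.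
apply: wp_conseq (wp_frame (wp_clear_vertex cl M2 E40 G7 G8 G9)) => t3 s3 [[t3b M3] ag3].
exists m.-1, (clear_at pth' x), (clear_at trch' x); split=> //.
- split; first by lia.
    by rewrite ag3 //= h2.
  by have := sumE trch' x; move: h3 t3b; lia.
move=> y yT; rewrite /clear_at; case: (y =P x) => // nx; apply: h5.
by rewrite tE mem_rcons inE negb_or yT andbT; apply/eqP.
Qed.

End Cleanup.

(** * The insertion *)

Lemma card_present_degree n k (c : coloring n k) G w : colored c = G ->
  #|present c w| <= degree G w.
Proof.
move=> cG; rewrite -(card_imset _ (@Some_inj _)).
apply: leq_trans (leq_imset_card c _); apply: subset_leq_card.
apply/subsetP => _ /imsetP[a aP ->]; move: aP; rewrite inE /missing.
case E: (nbr c w a) => [y|] // _; have Ec := nbr_some E.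
apply/imsetP; exists [set w; y]; last by rewrite Ec.
by rewrite inE -cG !inE Ec eqxx.
Qed.

Lemma sum_degree n (G : {set edge n}) : simple_graph G ->
  \sum_(w < n) degree G w = 2 * #|G|.
Proof.
move=> SG; rewrite /degree.
under eq_bigr => w _ do rewrite -sum1_card.
rewrite (exchange_big_dep (mem G)) /=; last by move=> w f _; rewrite inE => /andP[].
rewrite mulnC -sum_nat_const; apply: eq_bigr => f fG.
rewrite -(SG f fG) -sum1_card; apply: eq_bigl => w.
by rewrite inE fG.
Qed.

Lemma degree_insert n (G : {set edge n}) e w : e \notin G -> w \in e ->
  degree (e |: G) w = (degree G w).+1.
Proof.
move=> eG we; rewrite /degree.
have -> : [set f in e |: G | w \in f] = e |: [set f in G | w \in f].
  by apply/setP => f; rewrite !inE; case: (f =P e) => [->|].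
by rewrite cardsU1 inE (negbTE eG).
Qed.

Lemma degree_subset n (G H : {set edge n}) w : G \subset H -> degree G w <= degree H w.
Proof.
move=> /subsetP GH; apply: subset_leq_card; apply/subsetP => f.
by rewrite !inE => /andP[/GH -> ->].
Qed.

(** Each color available at the parent of an expanded vertex [w] has produced a reach, so it sits on
    an edge at [w]. *)
Lemma expanded_colors n k (c : coloring n k) u v tq pth trch hd f0 C :
  search_inv c u v tq pth trch hd f0 -> hd <= size tq ->
  (forall x, x \in u :: tq -> C < #|[set a | avail c (parent pth) x a]|) ->
  hd * C.+1 <= \sum_(w < n) #|present c w|.
Proof.
move=> SI hs hav; have [U _] := si_tq SI.
rewrite (bigID (mem (take hd tq))) /=; apply: leq_trans (leq_addr _ _).
have {1}-> : hd = #|take hd tq| by rewrite (card_uniqP (take_uniq _ U)) size_takel.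
rewrite -sum_nat_const; apply: leq_sum => w hw.
have wT := mem_take hw.
have iw : index w tq < hd by rewrite -(in_take _ wT).
have pT : parent pth w \in u :: tq by apply: (parent_in (si_tree SI)); exact: tree_in.
apply: leq_trans (hav _ pT) _.
apply: subset_leq_card; apply/subsetP => f; rewrite !inE => av.
have [z hz] := si_exp SI wT av (or_introl iw).
have [_ E _ _] := si_reach SI hz.
by case: (missing c w f) / (missingP c w f) => // h; case: (h z).
Qed.

Lemma time_bound (m D C b k hd S q p t1 t2 t3 t4 : nat) :
  k = D + C -> C + 2 <= D -> b <= C -> D * (D - C + 1) < b * (C - 1) + 2 ->
  hd * C.+1 <= 2 * m -> S <= hd * k + k -> q <= (hd * k + k).+1 -> p <= hd.+2 ->
  t1 <= 3 * C + 20 -> t2 <= hd.+1 * (51 * k + 11) + 1 ->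
  t3 <= 30 * p + 16 + (k * (20 * k + 20) + b.+1 * (60 * hd.+2 + 261 * k + 101) + 11) ->
  t4 <= 6 * S + 20 * q + k * (3 * k + 10) + 30 ->
  t1 + (t2 + (t3 + t4)) <= 3000 * (m + D ^ 2).
Proof.
move=> kE CD bC ineq h1 hS hq hp h2 h3 h4 h5.
(* Otherwise [D - C + 1] is at least [C + 2], and the left side of [ineq] is at least
   [D * C + 2 * D], while [b * (C - 1)] is at most [D * C]. So [C.+1], [D] and [k] have the same
   order of magnitude. *)
have D2 : D <= 2 * C.+1.
  rewrite leqNgt; apply/negP => h.
  have a1 : D * (D - C + 1) >= D * (C + 2) by rewrite leq_mul2l; lia.
  have a2 : b * (C - 1) <= D * C by apply: leq_mul; lia.
  by move: ineq a1 a2; rewrite mulnDr; lia.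
have e1 : hd * D <= 4 * m.
  have h : hd * D <= hd * (2 * C.+1) by rewrite leq_mul2l D2 orbT.
  by move: h h1; rewrite mulnCA; lia.
have e2 : hd * k <= 8 * m.
  have h : hd * k <= hd * (D * 2) by rewrite leq_mul2l; lia.
  by move: h e1; rewrite mulnA; lia.
have e3 : b * hd <= 4 * m.
  by apply: leq_trans e1; rewrite mulnC leq_mul2l; lia.
have e4 : hd <= 2 * m by move: h1; rewrite mulnS; lia.
have e5 : D <= D ^ 2 by rewrite -mulnn -{1}(muln1 D) leq_mul2l; lia.
have e6 : k * k <= 4 * D ^ 2.
  have h : k * k <= (D * 2) * (D * 2) by apply: leq_mul; lia.
  by move: h; rewrite -mulnn mulnACA; lia.
have e7 : b * k <= 2 * D ^ 2.
  have h : b * k <= D * (D * 2) by apply: leq_mul; lia.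
  by move: h; rewrite -mulnn mulnA; lia.
have e8 : 2 <= D by lia.
by move: e5 e6 e7; rewrite -mulnn; lia.
Qed.

Section Insertion.
Variables (n Delta C b : nat) (G : {set edge n}) (c : coloring n (Delta + C)) (u v : 'I_n).
Notation k := (Delta + C).
Hypothesis CD : C + 2 <= Delta.
Hypothesis C1 : 1 <= C.
Hypothesis b2 : 2 <= b.
Hypothesis bC : b <= C.
Hypothesis ineq : Delta * (Delta - C + 1) < b * (C - 1) + 2.
Hypothesis SG : simple_graph G.
Hypothesis nuv : u != v.
Hypothesis uvG : [set u; v] \notin G.
Hypothesis maxdeg : max_degree ([set u; v] |: G) <= Delta.
Hypothesis pec : proper_edge_coloring G c.

Let cG : colored c = G := pec.1.

Lemma proper_wf : wf_coloring c.
Proof. by split; [exact: pec.2|move=> e ce; apply: SG; rewrite -cG inE]. Qed.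

Let wfc := proper_wf.

Lemma uncolored : c [set u; v] = None.
Proof. by apply/eqP; move: uvG; rewrite -cG inE negbK. Qed.

Let cuv := uncolored.

Lemma degree_le w : degree ([set u; v] |: G) w <= Delta.
Proof. by apply: leq_trans maxdeg; exact: (leq_bigmax w). Qed.

Lemma present_le x : #|present c x| <= Delta.
Proof.
apply: leq_trans (card_present_degree x cG) _.
by apply: leq_trans (degree_le x); apply: degree_subset; exact: subsetUr.
Qed.

Lemma present_lt x : x \in [set u; v] -> #|present c x| < Delta.
Proof.
move=> xe; apply: leq_ltn_trans (card_present_degree x cG) _.
by rewrite -(degree_insert uvG xe) degree_le.
Qed.

Let degu : #|present c u| < Delta.
Proof. by apply: present_lt; rewrite !inE eqxx. Qed.
Let degv : #|present c v| < Delta.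
Proof. by apply: present_lt; rewrite !inE eqxx orbT. Qed.

Lemma tree_avail tq pth x : search_tree c u v tq pth -> x \in u :: tq ->
  C < #|[set a | avail c (parent pth) x a]|.
Proof. move=> ST; exact: (card_avail wfc nuv (erefl _) CD C1 bC ineq present_le degu degv ST). Qed.

(** [d] is the depth of a tree vertex, and a completed chain recolors at most two edges more.
    [C.+2 <= n] will make the logarithm at least 1, so that it absorbs additive constants; without
    recolored edges, its being nonnegative is enough. *)
Definition few_recolored (c' : coloring n k) : Prop :=
  #|recolored c c'| = 0 \/ exists d, [/\ #|recolored c c'| <= d.+2,
    C.+1 ^ (d - 2) <= n * b ^ (d - 2) & C.+2 <= n].

Definition answer (c' : coloring n k) : Prop :=
  exists ch, [/\ shift_extension c [set u; v] ch c', wf_coloring c',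
    colored c' = [set u; v] |: colored c & few_recolored c'].

Lemma color_answer tq pth trch hd f0 w f : found_color c u v b tq pth trch hd f0 w f ->
  answer (assign (shifted c (pth w)) [set parent pth w; w] f).
Proof.
move=> [[SI sb] f0k wT iw /andP[av1 av2]]; have ST := si_tree SI.
have [r E] := pth_shape ST wT.
have P := st_path ST wT; have U := st_uniq ST wT; rewrite E in P U.
have F := vpath_facts wfc cuv (par_u ST) P.
have m1 := sf_miss2 F (erefl _) av1.
have m2 := sf_miss1 F (erefl _) U av2.
have [ch [h1 h2 h3 h4]] := solution_assign wfc cuv nuv ST P m1 m2.
rewrite E; exists ch; split=> //.
have hr : #|recolored c (assign (shifted c [:: w, parent pth w & r]) [set parent pth w; w] f)| <= size r.
  by apply: leq_trans (card_recolored cuv h1) _; lia.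
case: (posnP (size r)) => r0; [left|right].
  by apply/eqP; rewrite -leqn0 -r0.
exists (size r); split; first exact: leq_trans hr (leq_trans (leqnSn _) (leqnSn _)).
  apply: (depth_bound wfc cuv nuv SI bC _ wT _ sb); last by rewrite E.
  by move=> x; exact: tree_avail.
have hd0 : 0 < hd.
  rewrite -iw lt0n; apply/eqP => i0.
  have wv : w = v by rewrite -(nth_index u wT) i0 -(si_tq SI).2 nth_index ?(st_vT ST).
  by move: r0; have := st_v ST; rewrite -wv E => -[_ ->].
apply: leq_trans (level_n _ _ 1); apply: (level1 wfc cuv SI) => // x.
exact: tree_avail.
Qed.

Lemma vertex_answer tq pth trch hd f0 z x c' :
  found_vertex c u v b tq pth trch hd f0 z -> x \in tq ->
  solution c u v (size (pth x)).+1 c' -> answer c'.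
Proof.
move=> [trch0 [f1 [[SI0 sb] f0k SI lt sz]]] xT [ch [h1 h2 h3 h4]].
have ST := si_tree SI; have [r E] := pth_shape ST xT.
exists ch; split=> //; right; exists (size r); split.
- by apply: leq_trans (card_recolored cuv h1) _; move: h4; rewrite E /=; lia.
- apply: (depth_bound wfc cuv nuv SI0 bC _ xT _ sb); last by rewrite E.
  by move=> y; exact: tree_avail.
(* While [v] is being expanded all reaches come from [v], but those of [z] come from [b + 1]
   different vertices. *)
have hd0 : 0 < hd.
  rewrite lt0n; apply/eqP => i0.
  have : size [seq p.1 | p <- trch z] <= size [:: v].
    apply: uniq_leq_size (si_uniq SI z) _ => _ /mapP[[w f] hw ->] /=.
    have [wT _ _ iw] := si_reach SI hw.
    have {}iw : index w tq = index v tq by rewrite (si_tq SI).2; case: iw; rewrite i0 // => -[].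
    by rewrite inE -(nth_index u wT) iw nth_index ?(st_vT ST).
  by rewrite size_map sz /=; lia.
apply: leq_trans (level_n _ _ 1); apply: (level1 wfc cuv SI) => // y.
exact: tree_avail.
Qed.

Lemma common_table_out z i j : (k <= i) || (k <= j) -> common_table c z i j = 0.
Proof.
rewrite /common_table /row_code => h; case: insubP => // al _ Ei.
case: nbr => // a; rewrite nth_default // size_map.
case/orP: h => h; first by move: (ltn_ord al); rewrite Ei ltnNge h.
apply: leq_trans h; rewrite size_filter; apply: leq_trans (count_size _ _) _.
by rewrite size_take size_enum_ord ltnn.
Qed.

Lemma wp_insertion s : stores s c -> insertion_input s Delta C b u v ->
  wp insertion_program s (fun t s' => t <= 3000 * (#|G| + Delta ^ 2) /\
    exists2 c', stores s' c' & answer c').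
Proof.
move=> HS HI; rewrite /insertion_program.
have b0 : 0 < b by exact: ltnW.
have hav := tree_avail.
wstep; apply: wp_conseq (wp_init wfc cuv nuv (erefl _) bC HS HI) => t1 s1 [t1b M1 En [E10 E11 E12]].
have OK0 : search_ok c u v b [:: v] (pth0 u v) (fun _ => [::]) 0 0.
  split; [exact: (init_inv c nuv)|by []].
wstep; apply: wp_conseq (wp_frame (wp_search wfc cuv nuv (erefl _) bC hav b0 OK0 M1 En E10 E11 E12)).
move=> t2 s2 [[tq [pth [trch [hd [M2 t2b E11' FD]]]]] ag2].
have [[F3 F4 F5] [F6 F7 F8 F9]] : env k u v b s2.
  by case: En => [[? ? ?] [? ? ? ?]]; split; split; rewrite ag2.
have [f0 [SI f0k lt]] : exists f0, [/\ search_inv c u v tq pth trch hd f0, f0 <= k & hd < size tq].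
  case: FD => f0 [[_ [w [f [[[SI _] h1 h2 h3 _] _ _]]]]|[_ [z [[trch0 [f1 [_ h1 h2 h3 _]]] _]]]].
    by exists f0; split=> //; rewrite -h3 index_mem.
  by exists f0.
have ST := si_tree SI.
have hm : hd * C.+1 <= 2 * #|G|.
  rewrite -(sum_degree SG); apply: leq_trans (expanded_colors SI (ltnW lt) (hav _ _ ^~ ST)) _.
  by apply: leq_sum => w _; exact: card_present_degree.
pose Q3 t (s' : state) := exists p, [/\ p <= hd.+2,
  t <= 30 * p + 16 + (k * (20 * k + 20) + b.+1 * (60 * hd.+2 + 261 * k + 101) + 11) &
  exists c' F, [/\ has_memory c c' tq pth trch F [::] s', answer c',
    forall i j, k <= i -> F i j = 0 & forall i j, k <= j -> F i j = 0]].
suff H3 : wp (If (Teq 12 8) (path_code ;; assign_code 26 27 22) finish_code) s2 Q3.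
  wstep; apply: wp_conseq (wp_frame H3) => t3 s3 [[p [pb t3b [c' [F [M3 an F1 F2]]]]] ag3].
  have out x : x \notin u :: tq -> pth x = [::] /\ trch x = [::].
    move=> xN; split; first by apply: (st_out ST); move: xN; rewrite inE negb_or => /andP[].
    by case E: (trch x) xN => [//|[w f] l]; rewrite (si_vis SI (w := w) (f := f)) // E inE eqxx.
  apply: wp_conseq (wp_cleanup (u := u) _ F1 F2 out M3 _ _ _ _ _ _) => [t4 s4 [t4b H4]|||||||].
  - split; last by exists c'.
    apply: (time_bound (erefl _) CD bC ineq hm _ _ pb t1b t2b t3b t4b).
      by apply: leq_trans (si_count SI) _; rewrite leq_add2l.
    by apply: leq_trans (si_size SI) _; rewrite ltnS leq_add2l.
  - by move=> y; exact: wf_loop.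
  - by rewrite ag3.
  - by rewrite ag3.
  - by rewrite ag3.
  - by rewrite ag3.
  - by rewrite ag3.
  - by rewrite ag3.
case: FD => f1 [[E12' [w [f [FC E13 E22]]]]|[E12' [z [FV E23]]]].
  apply: wp_if => hz; last by move: hz; rewrite /= E12' F8.
  have [[SI' sb] _ wT iw /andP[av1 av2]] := FC.
  have [r E] := pth_shape ST wT.
  wstep; apply: wp_conseq (wp_frame (wp_path wfc cuv nuv ST wT M2 E13 F4 F5 F7 F8)).
  move=> t3 s3 [[t3b M3 E26 E27] ag3].
  have P := st_path ST wT; have U := st_uniq ST wT; rewrite E in P U.
  have FF := vpath_facts wfc cuv (par_u ST) P.
  have m1 := sf_miss2 FF (erefl _) av1; have m2 := sf_miss1 FF (erefl _) U av2.
  have N := sf_none FF (erefl _); have W := sf_wf FF.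
  have np : parent pth w != w.
    by have [z' [p' [r' [[-> -> _] np]]]] := vpath_shape wfc nuv P.
  rewrite -E in m1 m2 N W.
  have E22' : regs s3 22 = f by rewrite ag3.
  apply: wp_conseq (wp_assign _ E26 E27 E22' W N m1 m2 np M3) => // t4 s4 [t4b M4].
  exists (size (pth w)); split; [|by lia|].
    by apply: path_size SI' wT _; rewrite iw.
  exists (assign (shifted c (pth w)) [set parent pth w; w] f), (fun _ _ => 0); split=> //.
  exact: color_answer FC.
apply: wp_if => hz; first by move: hz; rewrite /= E12' F8.
have [_ [_ [_ _ SI' _ sz]]] := FV.
have B : base k u v z s2 by split; split.
apply: wp_conseq (wp_finish wfc cuv nuv (erefl _) CD C1 bC ineq present_le degu degv SI' sz B E12' M2).
move=> t3 s3 [t3b [_ [x [xT [c' M3 sol]]]]].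
exists 0; split=> //; first by lia.
exists c', (common_table c z); split=> //.
- exact: vertex_answer FV xT sol.
- by move=> i j h; apply: common_table_out; rewrite h.
- by move=> i j h; apply: common_table_out; rewrite h orbT.
Qed.

End Insertion.

(** * Real logarithms *)

Import Order.TTheory GRing.Theory Num.Theory.
Local Open Scope ring_scope.

(** With [L] the logarithm, [d - 2 <= L] and thus [r <= L + 4]. Since [n] is at least [C + 2], hence
    at least [beta], also [1 <= L]; this gives the constant 5. *)
Lemma log_bound (R : realType) (n C b d r : nat) :
  (2 <= b)%N -> (b <= C)%N -> (C.+2 <= n)%N ->
  (C.+1 ^ (d - 2) <= n * b ^ (d - 2))%N -> (r <= d.+2)%N ->
  r%:R <= 5 * (ln n%:R / ln ((C%:R + 1) / b%:R)) :> R.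
Proof.
move=> b2 bC Cn hd hr; set beta := _ / _.
have b0 : 0 < b%:R :> R by rewrite ltr0n; lia.
have n0 : 0 < n%:R :> R by rewrite ltr0n; lia.
have beta1 : 1 < beta by rewrite /beta ltr_pdivlMr // mul1r natr1 ltr_nat ltnS.
have beta0 : 0 < beta by apply: lt_trans beta1.
have lb : 0 < ln beta by rewrite ln_gt0.
have h1 : beta ^+ (d - 2) <= n%:R.
  by rewrite expr_div_n ler_pdivrMr ?exprn_gt0 // natr1 -!natrX -natrM ler_nat.
have h2 : (d - 2)%:R <= ln n%:R / ln beta.
  rewrite ler_pdivlMr // mulr_natl -lnXn // ler_ln ?posrE ?exprn_gt0 //.
have h3 : 1 <= ln n%:R / ln beta.
  rewrite ler_pdivlMr // mul1r ler_ln ?posrE //.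
  rewrite ler_pdivrMr // natr1 -natrM ler_nat; nia.
have h4 : r%:R <= (d - 2)%:R + 4 :> R.
  by rewrite -(natrD _ _ 4) ler_nat; lia.
lra.
Qed.

Lemma log_ge0 (R : realType) (n C b : nat) : (0 < n)%N -> (2 <= b)%N -> (b <= C)%N ->
  0 <= ln n%:R / ln ((C%:R + 1) / b%:R) :> R.
Proof.
move=> n0 b2 bC; apply: divr_ge0; apply: ln_ge0; first by rewrite ler1n.
by rewrite ler_pdivlMr ?ltr0n ?mul1r ?natr1 ?ler_nat; lia.
Qed.

Lemma ratio_condition (R : realType) (Delta C b : nat) :
  (1 <= C)%N -> (C + 2 <= Delta)%N ->
  (b%:R * (C%:R - 1) + 2) / Delta%:R > Delta%:R - C%:R + 1 :> R ->
  (Delta * (Delta - C + 1) < b * (C - 1) + 2)%N.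
Proof.
move=> C1 CD; rewrite ltr_pdivlMr; last by rewrite ltr0n; lia.
rewrite -natrB; last by lia.
have -> : C%:R - 1 = (C - 1)%:R :> R by rewrite natrB.
by rewrite natr1 -!natrM -natrD ltr_nat mulnC addn1.
Qed.

Theorem mainTheorem6 :
  exists (p : program) (K1 K2 : nat),
  forall (R : realType) (n Delta C b : nat) (G : {set edge n})
         (c : coloring n (Delta + C)) (u v : 'I_n) (s : state),
    (1 <= C)%N -> (C + 2 <= Delta)%N ->
    (2 <= b)%N -> (b <= C)%N ->
    (b%:R * (C%:R - 1) + 2) / Delta%:R > Delta%:R - C%:R + 1 :> R ->
    simple_graph G ->
    u != v -> [set u; v] \notin G ->
    (max_degree ([set u; v] |: G) <= Delta)%N ->
    proper_edge_coloring G c ->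
    stores s c -> insertion_input s Delta C b u v ->
    exists (t : nat) (s' : state) (c' : coloring n (Delta + C))
           (chain : seq (edge n)),
      exec p s t s' /\
      stores s' c' /\
      shift_extension c [set u; v] chain c' /\
      proper_edge_coloring ([set u; v] |: G) c' /\
      #|recolored c c'|%:R <= K2%:R * (ln n%:R / ln ((C%:R + 1) / b%:R)) :> R /\
      (t <= K1 * (#|G| + Delta ^ 2))%N.
Proof.
exists insertion_program, 3000, 5.
move=> R n Delta C b G c u v s C1 CD b2 bC cond SG nuv uvG md pec HS HI.
have ineq := ratio_condition C1 CD cond.
have [t [s' [ex [tb [c' st [ch [sh wf col few]]]]]]] :=
  wp_insertion CD C1 b2 bC ineq SG nuv uvG md pec HS HI.
exists t, s', c', ch; do 3!split=> //.
split; first by split; [rewrite col pec.1|exact: wf.1].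
split=> //; case: few => [->|[d [hr hd hn]]]; last exact: (@log_bound _ _ _ _ d).
by apply: mulr_ge0 => //; apply: log_ge0 => //; apply: leq_ltn_trans (ltn_ord u).
Qed.
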